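(* Let $p\ge 0$, $\lambda>0$, $\gamma,\vartheta,\upsilon\in\mathbb{C}$, $a\in\mathbb{C}\setminus\{0,-1,-2,\dots\}$, with $\sigma\in\mathbb{C}$ when $|z|<1$, and $\Re(\sigma+\upsilon-\gamma-\vartheta)>1$ when $|z|=1$. Then $$\Phi_{\gamma,\vartheta;\upsilon}(z,\sigma,a;p,\lambda)=\frac{1}{\Gamma(\sigma)}\int_0^\infty t^{\sigma-1}e^{-at}\,F_p^\lambda\big(\gamma,\vartheta;\upsilon;ze^{-t}\big)\,dt .$$
   Context: $(\gamma)_n=\gamma(\gamma+1)\cdots(\gamma+n-1)$, $(\gamma)_0=1$, is the Pochhammer symbol; $B(x,y)$ is the classical beta function. The Mittag-Leffler function is $E_\lambda(w)=\sum_{n=0}^\infty \frac{w^n}{\Gamma(\lambda n+1)}$. For $\Re(x)>0$, $\Re(y)>0$ the extended beta function is $$B(x,y;p,\lambda)=B_p^\lambda(x,y)=\int_0^1 t^{x-1}(1-t)^{y-1}E_\lambda\Big(-\frac{p}{t(1-t)}\Big)dt.$$ The extended hypergeometric function is, for $p,\lambda\ge 0$, $\sigma_1,\sigma_2,\sigma_3\in\mathbb{C}$ and $|w|<1$, $$F_p^\lambda(\sigma_1,\sigma_2;\sigma_3;w)=\sum_{n=0}^\infty(\sigma_1)_n\frac{B(\sigma_2+n,\sigma_3-\sigma_2;p,\lambda)}{B(\sigma_2,\sigma_3-\sigma_2)}\frac{w^n}{n!}.$$ The extended Hurwitz-Lerch Zeta function is $$\Phi_{\gamma,\vartheta;\upsilon}(z,\sigma,a;p,\lambda)=\sum_{n=0}^\infty\frac{(\gamma)_n\,B(\vartheta+n,\upsilon-\vartheta;p,\lambda)}{B(\vartheta,\upsilon-\vartheta)\,n!}\frac{z^n}{(n+a)^\sigma},$$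 for $p\ge0$, $\lambda>0$, $\gamma,\vartheta,\upsilon\in\mathbb{C}$, $a\in\mathbb{C}\setminus\{0,-1,-2,\dots\}$, with $\sigma\in\mathbb{C}$ when $|z|<1$ and $\Re(\sigma+\upsilon-\gamma-\vartheta)>1$ when $|z|=1$.
   Formalization: The conditions Re(σ)>0 and Re(a)>0 are added: without them the integral in general diverges (e.g. p=0, z=0, σ=1, a=-1/2). Integrals are Lebesgue integrals, and an extended beta integral that diverges is given the value 0. *)

(* Defs.v *)
From HB Require Import structures.
From mathcomp Require Import all_boot all_order all_algebra.
From mathcomp Require Import all_classical all_reals all_analysis.
From mathcomp.real_closed Require Import complex.

Set Implicit Arguments.
Unset Strict Implicit.
Unset Printing Implicit Defensive.

Import Order.TTheory GRing.Theory Num.Theory.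
Import numFieldNormedType.Exports.

Local Open Scope classical_set_scope.
Local Open Scope ring_scope.
Local Open Scope complex_scope.

(* The complex numbers are [R[i]], with coordinates [complex.Re] and
   [complex.Im] valued in [R]. Since [R[i]] carries no canonical topology or
   measurable structure, sums and integrals are taken coordinatewise. *)

Definition csum (R : realType) (u : nat -> R[i]) : R[i] :=
  limn (series (fun n => complex.Re (u n)))
    +i* limn (series (fun n => complex.Im (u n))).

Definition cintegrable (R : realType) (D : set R) (f : R -> R[i]) : Prop :=
  (@lebesgue_measure R).-integrable D (fun t => (complex.Re (f t))%:E) /\
  (@lebesgue_measure R).-integrable D (fun t => (complex.Im (f t))%:E).

(* Equal to 0 when [f] is not Lebesgue integrable on [D]. *)
Definition cintegral (R : realType) (D : set R) (f : R -> R[i]) : R[i] :=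
  if `[< cintegrable D f >] then
    Rintegral (@lebesgue_measure R) D (fun t => complex.Re (f t))
      +i* Rintegral (@lebesgue_measure R) D (fun t => complex.Im (f t))
  else 0.

Definition cexp (R : realType) (w : R[i]) : R[i] :=
  (expR (complex.Re w))%:C * (cos (complex.Im w) +i* sin (complex.Im w)).

(* Principal argument, in ]-pi, pi] for [w != 0]. *)
Definition carg (R : realType) (w : R[i]) : R :=
  let theta := acos (complex.Re w / ComplexField.Normc.normc w) in
  if 0 <= complex.Im w then theta else - theta.

Definition clog (R : realType) (w : R[i]) : R[i] :=
  ln (ComplexField.Normc.normc w) +i* carg w.

(* Principal branch; only meant for [w != 0]. *)
Definition cpow (R : realType) (w s : R[i]) : R[i] := cexp (s * clog w).

Definition pochhammer (R : realType) (g : R[i]) (n : nat) : R[i] :=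
  \prod_(k < n) (g + k%:R).

Definition gamma_integral (R : realType) (s : R[i]) : R[i] :=
  cintegral `]0, +oo[ (fun t => cpow t%:C (s - 1) * cexp (- t%:C)).

(* Euler's integral when [0 < Re s], where the shift [m] is 0; continued to the
   left by Gamma(s) = Gamma(s + m) / (s)_m, with [m] least such that
   [0 < Re (s + m)]. At the poles the value is 0 (division by 0). *)
Definition cGamma (R : realType) (s : R[i]) : R[i] :=
  let m := Num.truncn (1 - complex.Re s) in
  gamma_integral (s + m%:R) / pochhammer s m.

Definition cBeta (R : realType) (x y : R[i]) : R[i] :=
  cGamma x * cGamma y / cGamma (x + y).

Definition mittag_leffler (R : realType) (lambda : R) (w : R[i]) : R[i] :=
  csum (fun n => w ^+ n / cGamma ((lambda * n%:R + 1)%:C)).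

Definition ext_beta (R : realType) (x y : R[i]) (p lambda : R) : R[i] :=
  cintegral `]0, 1[ (fun t =>
    cpow t%:C (x - 1) * cpow (1 - t)%:C (y - 1)
      * mittag_leffler lambda (- (p / (t * (1 - t)))%:C)).

Definition ext_hypergeometric (R : realType) (p lambda : R)
    (s1 s2 s3 w : R[i]) : R[i] :=
  csum (fun n =>
    pochhammer s1 n
      * (ext_beta (s2 + n%:R) (s3 - s2) p lambda / cBeta s2 (s3 - s2))
      * (w ^+ n / (n`!)%:R)).

Definition ext_hurwitz_lerch (R : realType) (gamma theta upsilon : R[i])
    (z sigma a : R[i]) (p lambda : R) : R[i] :=
  csum (fun n =>
    pochhammer gamma n * ext_beta (theta + n%:R) (upsilon - theta) p lambda
      / (cBeta theta (upsilon - theta) * (n`!)%:R)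
      * (z ^+ n / cpow (n%:R + a) sigma)).

(* Main.v *)
Require Import Defs.
From mathcomp Require Import all_boot all_order all_algebra.
From mathcomp Require Import ring lra zify.
From mathcomp Require Import all_classical all_reals all_analysis measurable_realfun.
From mathcomp.real_closed Require Import complex.

Import Order.TTheory GRing.Theory Num.Theory.
Import numFieldNormedType.Exports.

Local Open Scope classical_set_scope.
Local Open Scope ring_scope.
Local Open Scope complex_scope.

Set Implicit Arguments.
Unset Strict Implicit.
Unset Printing Implicit Defensive.

(** Put [c k = (gamma)_k B(theta + k, upsilon - theta; p, lambda) /
    (B(theta, upsilon - theta) k!)].  Under the integral sign the hypergeometric
    function is the power series with coefficients [c k] at [z exp(- t)], and the
    gamma integral of [t ^ (sigma - 1) exp (- (a + k) t)] is
    [Gamma(sigma) / (k + a) ^ sigma].  Hence the theorem is the interchange of a sum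
    and an integral ([hurwitz_swap]), after division by [Gamma(sigma)].  Dominated
    convergence justifies the interchange, and makes the integrand integrable, as
    soon as the sums of [|c k z ^ k| (k + 1) ^ (- Re sigma)] are bounded
    ([hurwitz_lerch_summable]).

    Three facts on the gamma function with complex arguments are needed.  The integral
    with a complex exponent [w], [Re w > 0], is [Gamma(s) / w ^ s]: along the path
    [w = exp (tau L)] the derivative in [tau] of the normalized integral is a
    combination of integrations by parts, so it is 0 ([gker_rotate]).  The functional
    equation is again an integration by parts ([gker_parts]).  Finally
    [Gamma(sigma) != 0]: a zero would propagate to all [sigma + n], whereas for a large
    real part the integrand concentrates near one point, and the integral,
    turned by the phase at that point, has a positive real part ([gker_phase_gt0],
    [cGamma_neq0]).

    For summability, [(gamma)_k / k!] is [O(k ^ (Re gamma - 1))]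
    ([pochhammer_growth]) and the extended beta integrals are bounded in [k], because
    raising [k] multiplies the integrand by [t < 1] ([cintegral_shrink_bounded]).
    This is enough for [|z| < 1], and for [|z| = 1] if
    [Re (upsilon - theta) <= 1].  In the remaining case the beta integrals have to be
    [O(k ^ (1 - Re (upsilon - theta)))].  This holds if the Mittag-Leffler factor is
    bounded ([beta_terms_decay]), as it is for [p = 0].

    For [lambda <= 2] one has [|E_lambda(- x)| <= 1] when [x >= 0] ([mlfun_le1]).  By
    Gauss's limit for the gamma function, [E_lambda(- x)] is a limit of Taylor
    coefficients of [(1 - z) ^ (- 1) / (1 + y (1 - z) ^ (- lambda))], where [y] varies with
    the index.  For fixed [y] these are the real parts of a sequence that solves a
    discrete renewal equation with coefficients of the right signs, so they are bounded by 1 ([renewal_bound], [bsum_le1]).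

    For [lambda > 2] and [p > 0] the beta integrals converge for no value of the
    parameters, so that all [c k] vanish ([ext_beta_eq0]).  Convergence would give,
    by substitution, that of a Laplace integral of [E_lambda]
    ([laplace_integrable]), whose moments have a generating function holomorphic at a
    zero of [1 + zeta (1 - z) ^ (- lambda)], the factor by which it must be multiplied
    to give [1 / (1 - z)] ([mlfun_not_integrable]). *)

(** * Integrals of real-valued functions *)
Section RealIntegrable.
Context d (T : measurableType d) (R : realType).
Variables (mu : {measure set T -> \bar R}) (D : set T).
Hypothesis mD : measurable D.
Implicit Types f g : T -> R.

Lemma integrable_EFinZ (k : R) f : mu.-integrable D (EFin \o f) ->
  mu.-integrable D (EFin \o (fun t => k * f t)).
Proof. by move=> fi; have := integrableZl mD k fi; exact: eq_integrable. Qed.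

Lemma integrable_EFinD f g : mu.-integrable D (EFin \o f) ->
  mu.-integrable D (EFin \o g) -> mu.-integrable D (EFin \o (fun t => f t + g t)).
Proof. by move=> fi gi; have := integrableD mD fi gi; exact: eq_integrable. Qed.

Lemma integrable_EFinB f g : mu.-integrable D (EFin \o f) ->
  mu.-integrable D (EFin \o g) -> mu.-integrable D (EFin \o (fun t => f t - g t)).
Proof. by move=> fi gi; have := integrableB mD fi gi; exact: eq_integrable. Qed.

Lemma Rintegral_sum_nat (f : nat -> T -> R) (M : nat) :
  (forall k, mu.-integrable D (EFin \o f k)) ->
  mu.-integrable D (EFin \o fun t => \sum_(0 <= k < M) f k t) /\
  Rintegral mu D (fun t => \sum_(0 <= k < M) f k t) =
    \sum_(0 <= k < M) Rintegral mu D (f k).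
Proof.
move=> fi; elim: M => [|M [IH1 IH2]].
  rewrite big_nil; have -> : (fun t : T => \sum_(0 <= k < 0) f k t) = cst 0.
    by apply/funext => t; rewrite big_nil.
  rewrite Rintegral_cst// mul0r; split=> //.
  exact: (@integrable0 _ _ _ mu D).
have -> : (fun t : T => \sum_(0 <= k < M.+1) f k t) =
    (fun t : T => \sum_(0 <= k < M) f k t + f M t).
  by apply/funext => t; rewrite big_nat_recr.
rewrite big_nat_recr//= -IH2 RintegralD//; split=> //.
exact: integrable_EFinD.
Qed.

End RealIntegrable.

(** * Gamma kernels on the half-line *)
Section HalfLine.
Context {R : realType}.
Local Notation mu := (@lebesgue_measure R).
Local Notation lmu :=
  (@lebesgue_measure R : {measure set (measurableTypeR R) -> \bar R}).
Local Notation itvn n := `[(n.+1%:R)^-1 : R, n.+1%:R]%classic.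
Local Notation posR := `]0%R : R, +oo[%classic.

Lemma bigcup_itv_inv_nat :
  \bigcup_n (itvn n) = posR.
Proof.
apply/seteqP; split=> [t [n _]|t] /=; rewrite !in_itv/= ?andbT.
  by move=> /andP[+ _]; apply: lt_le_trans; rewrite invr_gt0.
move=> t0; exists (Num.truncn (t + t^-1)) => //=.
have h := truncnS_gt (t + t^-1).
have ti : 0 < t^-1 by rewrite invr_gt0.
rewrite in_itv/=; apply/andP; split; last lra.
rewrite -[leRHS]invrK lef_pV2 ?posrE//; lra.
Qed.

Lemma nondecreasing_itv_inv_nat :
  nondecreasing_seq (fun n => (itvn n)).
Proof.
apply/nondecreasing_seqP => n; rewrite subsetEset; apply: subset_itv;
  rewrite bnd_simp ?ler_nat//.
by rewrite lef_pV2 ?posrE// ler_nat.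
Qed.

Lemma itv_inv_nat_sub n : (itvn n) `<=` posR.
Proof. by rewrite -bigcup_itv_inv_nat => t tn; exists n. Qed.

(** Monotone convergence along the compact intervals [1 / (n + 1), n + 1], on which
    the fundamental theorem of calculus applies. *)
Lemma ge0_integral_exhaust (f : R -> R) (K : R) :
  measurable_fun posR f -> (forall t : R, 0 < t -> 0 <= f t) ->
  (forall n, (\int[mu]_(t in (itvn n)) (f t)%:E <= K%:E)%E) ->
  (\int[mu]_(t in posR) (f t)%:E <= K%:E)%E.
Proof.
move=> mf f0 fK; rewrite -bigcup_itv_inv_nat.
have cv : (fun n => \int[mu]_(t in (itvn n)) (f t)%:E)%E @ \oo -->
    (\int[mu]_(t in \bigcup_n (itvn n)) (f t)%:E)%E.
  apply: (@ge0_nondecreasing_set_cvg_integral _ (measurableTypeR R) R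
    (fun n => (itvn n)) (EFin \o f) lmu).
  - exact: nondecreasing_itv_inv_nat.
  - by move=> n; exact: measurable_itv.
  - move=> n; apply/measurable_EFinP; apply: measurable_funS mf => //.
    exact: itv_inv_nat_sub.
  - move=> n t /itv_inv_nat_sub/=; rewrite in_itv/= andbT lee_fin; exact: f0.
rewrite -(cvg_lim _ cv)//.
apply: lime_le; last by apply: nearW => n; exact: fK.
by apply/cvg_ex; eexists; exact: cv.
Qed.

Lemma integral_exhaust_cvg (f : R -> R) :
  mu.-integrable posR (EFin \o f) ->
  (fun n => Rintegral mu (itvn n) f) @ \oo -->
    Rintegral mu posR f.
Proof.
move=> fi.
have /measurable_EFinP mf := measurable_int _ fi.
apply: fine_cvg; rewrite fineK; last exact: integrable_fin_num.
have -> : (fun n => \int[mu]_(x in (itvn n)) (f x)%:E)%E =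
  (fun n => \int[mu]_(x in posR)
     ((EFin \o f) \_ (itvn n)) x)%E.
  apply/funext => n; rewrite -integral_mkcondr setIidr//.
  exact: itv_inv_nat_sub.
apply: (@dominated_cvg _ (measurableTypeR R) R lmu posR _ _ _ (fun t => `|f t|%:E)).
- exact: measurable_itv.
- move=> n; apply/measurable_restrict => //=.
  apply/measurable_EFinP; apply: measurable_funS mf => //.
- move=> t t0.
  have : t \in posR by rewrite inE.
  rewrite -bigcup_itv_inv_nat inE => -[N _ tN].
  apply: cvg_near_cst; near=> n.
  rewrite patchE mem_set//=.
  have : (N <= n)%N by near: n; exists N.
  by move=> /nondecreasing_itv_inv_nat; rewrite subsetEset => /(_ t tN).
- by [].
- exact: integrable_norm.
- move=> n t _; rewrite patchE; case: ifPn => _ //=.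
  by rewrite normr0 lee_fin.
Unshelve. all: by end_near. Qed.

Lemma continuous_at_within_itv (f : R -> R) (a b : R) : 0 < a ->
  (forall t : R, 0 < t -> {for t, continuous f}) ->
  {within `[a, b], continuous f}.
Proof.
move=> a0 cf; apply: continuous_in_subspaceT => t.
by rewrite inE/= in_itv/= => /andP[at_ _]; apply: cf; exact: lt_le_trans at_.
Qed.

Lemma integral_itvn_derive (F f : R -> R) (n : nat) :
  (forall t : R, 0 < t -> is_derive t 1 F (f t)) ->
  (forall t : R, 0 < t -> {for t, continuous f}) ->
  (\int[mu]_(t in (itvn n)) (f t)%:E = (F n.+1%:R - F (n.+1%:R^-1))%:E)%E.
Proof.
move=> dF cf; have n0 : 0 < n.+1%:R^-1 :> R by rewrite invr_gt0.
have cF t : 0 < t -> {for t, continuous F}.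
  by move=> /dF ?; apply/differentiable_continuous/derivable1_diffP.
case: n n0 => [|n] n0.
  by rewrite invr1 set_itv1 integral_set1 subrr.
have nn : (n.+2%:R^-1 < n.+2%:R :> R).
  rewrite (@lt_trans _ _ 1)// ?ltr1n// invf_lt1// ltr1n//.
rewrite (@continuous_FTC2 _ f F)//.
- exact: continuous_at_within_itv.
- split.
  + move=> t; rewrite in_itv/= => /andP[nt _].
    by have [] := dF t (lt_trans n0 nt).
  + by apply: cvg_at_right_filter; exact: cF.
  + by apply: cvg_at_left_filter; apply: cF; exact: lt_trans nn.
- move=> t; rewrite in_itv/= => /andP[nt _].
  by have tF := dF t (lt_trans n0 nt); rewrite derive1E derive_val.
Qed.

(** The improper fundamental theorem of calculus. F is sampled only along
    [1 / (n + 1)] and [n + 1], so limits of sequences are enough. *)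
Lemma Rintegral_derive (F f : R -> R) (l0 l1 : R) :
  (forall t : R, 0 < t -> is_derive t 1 F (f t)) ->
  (forall t : R, 0 < t -> {for t, continuous f}) ->
  mu.-integrable posR (EFin \o f) ->
  F (n.+1%:R^-1) @[n --> \oo] --> l0 -> F (n.+1%:R) @[n --> \oo] --> l1 ->
  Rintegral mu posR f = l1 - l0.
Proof.
move=> dF cf fi F0 F1; have := integral_exhaust_cvg fi.
have -> : (fun n => Rintegral mu (itvn n) f) =
  (fun n => F n.+1%:R - F (n.+1%:R^-1)).
  by apply/funext => n; rewrite /Rintegral (integral_itvn_derive n dF cf).
move=> /cvg_lim <- //; apply/cvg_lim => //; exact: cvgB.
Qed.

(** The real part of [t ^ (x + i y) exp (- (m + i n) t) exp (i th)] for t > 0. The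
    phase th closes the family under differentiation in t and in the exponents, and
    th = - pi / 2 gives the imaginary part. *)
Definition gker (x y m n th t : R) : R :=
  expR (x * ln t - m * t) * cos (y * ln t - n * t + th).

Implicit Types (x y m n th t : R).

Lemma gker_le x y m n th t : `|gker x y m n th t| <= expR (x * ln t - m * t).
Proof.
rewrite normrM (ger0_norm (expR_ge0 _)) ler_piMr ?expR_ge0//; exact: cos_max.
Qed.

Lemma is_derive_gker x y m n th t : 0 < t -> is_derive t 1 (gker x y m n th)
  (x * gker (x - 1) y m n th t - m * gker x y m n th t
   - y * gker (x - 1) y m n (th - pi / 2) t + n * gker x y m n (th - pi / 2) t).
Proof.
move=> t0.
have dln := is_derive1_ln t0.
pose G : R -> R := (expR \o (x *: (@ln R) - m *: id)) *
   (cos \o (y *: (@ln R) - n *: id + cst th)).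
rewrite -[gker x y m n th in X in is_derive _ _ X _]/G.
apply: is_derive_eq.
rewrite /gker !fctE /= !addrA !cosBpihalf /GRing.scale/=.
have -> : (x - 1) * ln t - m * t = x * ln t - m * t - ln t by ring.
rewrite (expRB _ (ln t)) lnK ?posrE//.
field; exact: lt0r_neq0.
Qed.

Lemma derivable_gker x y m n th t : 0 < t -> derivable (gker x y m n th) t 1.
Proof. by move=> /(is_derive_gker x y m n th) []. Qed.

Lemma continuous_gker x y m n th t : 0 < t -> {for t, continuous (gker x y m n th)}.
Proof.
by move=> t0; apply/differentiable_continuous/derivable1_diffP/derivable_gker.
Qed.

Lemma measurable_gker x y m n th D : measurable D ->
  measurable_fun D (gker x y m n th).
Proof.
move=> mD; apply: measurable_funTS.
have mid : measurable_fun setT (@idfun R) by exact: measurable_id.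
have lin a b c : measurable_fun setT (fun t : R => a * ln t - b * t + c).
  apply: measurable_funD => //; apply: measurable_funB => //;
  apply: measurable_funM => //; exact: measurable_ln.
apply: measurable_funM.
  apply: measurableT_comp => //.
  by have := lin x m 0; under eq_fun do rewrite addr0.
apply: measurableT_comp => //.
by apply: continuous_measurable_fun; exact: continuous_cos.
Qed.

Lemma ln_sub_linear_le (a c t : R) : 0 < a -> 0 < c -> 0 < t ->
  a * ln t - c * t <= a * (ln (a / c) - 1).
Proof.
move=> a0 c0 t0; have d0 : 0 < a / c by rewrite divr_gt0.
have lt : ln t <= t / (a / c) - 1 + ln (a / c).
  rewrite -lerBlDr -ln_div ?posrE//.
  have := @le_ln1Dx R (t / (a / c) - 1); rewrite subrKC; apply.
  by rewrite ltrBrDr addNr divr_gt0.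
have := ler_wpM2l (ltW a0) lt; rewrite mulrDr mulrBr mulr1.
have -> : a * (t / (a / c)) = c * t by field; rewrite !lt0r_neq0.
lra.
Qed.

(** The right-hand side is, up to a constant, the derivative of the bounded function
    [- 1 / (1 + t ^ x)], so the gamma kernel is integrable near both ends at
    once. *)
Lemma le_expR_logistic x m t : 0 < x -> 0 < m -> 0 < t ->
  expR ((x - 1) * ln t - m * t) <=
  (2 + 2 * expR (2 * x * (ln (2 * x / m) - 1))) *
   (expR ((x - 1) * ln t) * (1 + expR (x * ln t)) ^- 2).
Proof.
move=> x0 m0 t0; rewrite expRD mulrCA ler_pM2l ?expR_gt0//.
set E := expR (x * ln t); have E0 : 0 < E by exact: expR_gt0.
rewrite ler_pdivlMr ?exprn_gt0 ?addr_gt0//.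
have E2 : E ^+ 2 * expR (- (m * t)) <= expR (2 * x * (ln (2 * x / m) - 1)).
  rewrite /E -expRM_natl -expRD ler_expR mulrA.
  by apply: ln_sub_linear_le => //; rewrite mulr_gt0.
have e1 : expR (- (m * t)) <= 1.
  by rewrite -expR0 ler_expR oppr_le0 ltW// mulr_gt0.
have e0 := expR_ge0 (- (m * t)).
set e := expR _ in E2 e1 e0 *; set C := expR _ in E2 *.
have : 0 <= e * (E - 1) ^+ 2 by rewrite mulr_ge0// sqr_ge0.
nra.
Qed.

Lemma is_derive_logistic x t : 0 < t ->
  is_derive t 1 (fun t => - (1 + expR (x * ln t))^-1)
    (x * (expR ((x - 1) * ln t) * (1 + expR (x * ln t)) ^- 2)).
Proof.
move=> t0; have dln := is_derive1_ln t0.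
have n0 : (cst 1 + (expR \o (x *: (@ln R)))) t != 0.
  by rewrite lt0r_neq0// addr_gt0 ?expR_gt0.
have dV := @is_deriveV R (cst 1 + (expR \o (x *: (@ln R)))) t _ 1 n0.
pose G : R -> R := - (fun t => ((cst 1 + (expR \o (x *: (@ln R)))) t)^-1).
rewrite -[fun t => _ in X in is_derive _ _ X _]/G.
apply: is_derive_eq.
rewrite !fctE /= /GRing.scale/=.
have -> : (x - 1) * ln t = x * ln t - ln t by ring.
rewrite (expRB _ (ln t)) lnK ?posrE//.
move: n0; rewrite !fctE/= /GRing.scale/= => n0.
by field; rewrite n0 lt0r_neq0.
Qed.

Lemma integrable_exp_ln x m : -1 < x -> 0 < m ->
  mu.-integrable posR (fun t => (expR (x * ln t - m * t))%:E).
Proof.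
move=> x1 m0.
have gE : (fun t => expR (x * ln t - m * t)) = gker x 0 m 0 0.
  by apply/funext => t; rewrite /gker !mul0r subr0 addr0 cos0 mulr1.
have mf : measurable_fun posR (fun t => expR (x * ln t - m * t)).
  by rewrite gE; apply: measurable_gker; exact: measurable_itv.
apply/integrableP; split; first exact/measurable_EFinP.
pose z := x + 1; have z0 : 0 < z by rewrite /z; lra.
pose C := 2 + 2 * expR (2 * z * (ln (2 * z / m) - 1)).
have C0 : 0 <= C by rewrite addr_ge0// mulr_ge0// expR_ge0.
pose p t := expR ((z - 1) * ln t) * (1 + expR (z * ln t)) ^- 2.
have dp t : 0 < t -> is_derive t 1 (fun t => C / z * - (1 + expR (z * ln t))^-1) (C * p t).
  move=> t0; have dl := is_derive_logistic z t0.
  pose G : R -> R := (C / z) *: (fun t => - (1 + expR (z * ln t))^-1).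
  rewrite -[fun t => _ in X in is_derive _ _ X _]/G.
  apply: is_derive_eq; rewrite /GRing.scale/= -/(p t).
  by field; exact: lt0r_neq0.
have cp t : 0 < t -> {for t, continuous (fun t => C * p t)}.
  move=> t0; have dln := is_derive1_ln t0.
  apply/differentiable_continuous/derivable1_diffP.
  have n0 : ((cst 1 + (expR \o (z *: (@ln R)))) * (cst 1 + (expR \o (z *: (@ln R))))) t != 0.
    by rewrite lt0r_neq0// mulr_gt0// addr_gt0 ?expR_gt0.
  have dV := @is_deriveV R ((cst 1 + (expR \o (z *: (@ln R)))) * (cst 1 + (expR \o (z *: (@ln R))))) t _ 1 n0.
  pose G : R -> R := C *: ((expR \o ((z - 1) *: (@ln R))) *
     (fun t => (((cst 1 + (expR \o (z *: (@ln R)))) * (cst 1 + (expR \o (z *: (@ln R))))) t)^-1)).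
  rewrite -[fun t => _ in X in derivable X]/G.
  apply: ex_derive.
under eq_integral do rewrite gee0_abs ?lee_fin ?expR_ge0//.
apply: (@le_lt_trans _ _ (C / z)%:E); last by rewrite ltry.
apply: ge0_integral_exhaust => // n.
have n0 : 0 < n.+1%:R^-1 :> R by rewrite invr_gt0.
apply: (@le_trans _ _ (\int[mu]_(t in itvn n) (C * p t)%:E)%E).
  apply: ge0_le_integral.
  - exact: measurable_itv.
  - by move=> t _; rewrite lee_fin expR_ge0.
  - by apply/measurable_EFinP; apply: measurable_funS mf => //; exact: itv_inv_nat_sub.
  - apply/measurable_EFinP.
    apply: subspace_continuous_measurable_fun; first exact: measurable_itv.
    exact: continuous_at_within_itv.
  - move=> t; rewrite /= in_itv/= => /andP[nt _]; rewrite lee_fin.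
    have t0 := lt_le_trans n0 nt.
    have -> : x = z - 1 by rewrite /z addrK.
    exact: le_expR_logistic.
rewrite (integral_itvn_derive n dp cp) lee_fin -mulrBr.
rewrite ler_piMr//; first by rewrite divr_ge0// ltW.
set a := expR _; set b := expR _.
have a0 : 0 < a by exact: expR_gt0.
have b0 : 0 < b by exact: expR_gt0.
have : (1 + b)^-1 <= 1 by rewrite invf_le1 ?lerDl ?ltW// addr_gt0.
have : 0 <= (1 + a)^-1 by rewrite invr_ge0 addr_ge0// ltW.
lra.
Qed.

Lemma integrable_gker x y m n th : -1 < x -> 0 < m ->
  mu.-integrable posR (EFin \o gker x y m n th).
Proof.
move=> x1 m0; apply: le_integrable (integrable_exp_ln x1 m0).
- exact: measurable_itv.
- by apply/measurable_EFinP; apply: measurable_gker; exact: measurable_itv.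
- by move=> t _; rewrite !abse_EFin lee_fin (ger0_norm (expR_ge0 _)) gker_le.
Qed.

Lemma cvg_expR_lnN x : 0 < x ->
  expR (- (x * ln (n.+1%:R : R))) @[n --> \oo] --> (0 : R).
Proof.
move=> x0; apply/cvgrPdist_lt => e e0; near=> n.
rewrite sub0r normrN ger0_norm ?expR_ge0//.
rewrite -[ltRHS]lnK ?posrE// ltr_expR.
have : expR (- ln e / x) < n.+1%:R.
  have /lt_trans : expR (- ln e / x) < n%:R.
    by near: n; exact: nbhs_infty_gtr.
  by apply; rewrite ltr_nat.
rewrite -[ltRHS](@lnK R) ?posrE// ltr_expR ltr_pdivrMr// mulrC; lra.
Unshelve. all: by end_near. Qed.

Lemma cvg_gker_0 x y m n th : 0 < x -> 0 < m ->
  gker x y m n th (k.+1%:R^-1) @[k --> \oo] --> (0 : R).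
Proof.
move=> x0 m0; apply: norm_cvg0.
apply: (squeeze_cvgr _ (cvg_cst 0) (cvg_expR_lnN x0)).
apply: nearW => k; rewrite normr_ge0/= (le_trans (gker_le _ _ _ _ _ _))//.
rewrite ler_expR lnV ?posrE// mulrN lerBlDr lerDl mulr_ge0// ltW//.
Qed.

Lemma cvg_gker_y x y m n th : 0 < x -> 0 < m ->
  gker x y m n th k.+1%:R @[k --> \oo] --> (0 : R).
Proof.
move=> x0 m0; apply: norm_cvg0.
pose w := x + 1; have w0 : 0 < w by rewrite /w; lra.
pose C := expR (w * (ln (w / m) - 1)).
apply: (squeeze_cvgr (h := fun k => C * expR (- (1 * ln (k.+1%:R : R)))) _ (cvg_cst 0)); last first.
  by rewrite -[X in _ --> X](mulr0 C); apply: cvgMr; apply: cvg_expR_lnN.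
apply: nearW => k; rewrite normr_ge0/= (le_trans (gker_le _ _ _ _ _ _))//.
rewrite -expRD ler_expR mul1r.
set t := k.+1%:R; have t0 : 0 < t by rewrite ltr0n.
have := ln_sub_linear_le w0 m0 t0.
rewrite /w; lra.
Qed.

(** The derivative of gker x y m n th integrates to 0. In complex form this is
    [s G(s) = w G(s + 1)], where [s = x + i y], [w = m + i n] and G(s) is the
    integral of [t ^ (s - 1) exp (- w t)]. *)
Lemma gker_parts x y m n th : 0 < x -> 0 < m ->
  x * Rintegral mu posR (gker (x - 1) y m n th)
  - m * Rintegral mu posR (gker x y m n th)
  - y * Rintegral mu posR (gker (x - 1) y m n (th - pi / 2))
  + n * Rintegral mu posR (gker x y m n (th - pi / 2)) = 0.
Proof.
move=> x0 m0.
have i1 th' : mu.-integrable posR (EFin \o gker (x - 1) y m n th').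
  by apply: integrable_gker => //; lra.
have i2 th' : mu.-integrable posR (EFin \o gker x y m n th').
  by apply: integrable_gker => //; lra.
have mp : measurable (posR : set (measurableTypeR R)) by exact: measurable_itv.
have iZ k f (fi : mu.-integrable posR (EFin \o f)) := integrable_EFinZ mp k fi.
have iB f g (fi : mu.-integrable posR (EFin \o f))
  (gi : mu.-integrable posR (EFin \o g)) := integrable_EFinB mp fi gi.
have iD f g (fi : mu.-integrable posR (EFin \o f))
  (gi : mu.-integrable posR (EFin \o g)) := integrable_EFinD mp fi gi.
have j1 k th' := iZ k _ (i1 th'); have j2 k th' := iZ k _ (i2 th').
have jB := iB _ _ (iB _ _ (j1 x th) (j2 m th)) (j1 y (th - pi / 2)).
transitivity (Rintegral mu posR (fun t =>
  x * gker (x - 1) y m n th t - m * gker x y m n th t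
   - y * gker (x - 1) y m n (th - pi / 2) t + n * gker x y m n (th - pi / 2) t)).
  rewrite RintegralD//; congr (_ + _); last by rewrite RintegralZl.
  rewrite RintegralB//; [|exact: iB]; congr (_ - _); last by rewrite RintegralZl.
  by rewrite RintegralB// !RintegralZl.
rewrite -[RHS](subrr (0 : R)).
apply: (@Rintegral_derive (gker x y m n th)).
- move=> t t0; exact: is_derive_gker.
- move=> t t0.
  have c1 th' : {for t, continuous (gker (x - 1) y m n th')} by exact: continuous_gker.
  have c2 th' : {for t, continuous (gker x y m n th')} by exact: continuous_gker.
  by apply: continuousD; [apply: continuousB; [apply: continuousB|]|]; apply: continuousM => //; exact: cst_continuous.
- exact: iD.
- exact: cvg_gker_0.
- exact: cvg_gker_y.
Qed.

Lemma is_derive_expR_cos (A B : R -> R) (u dA dB : R) :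
  is_derive u 1 A dA -> is_derive u 1 B dB ->
  is_derive u 1 (fun v => expR (A v) * cos (B v))
    (expR (A u) * (dA * cos (B u) - dB * sin (B u))).
Proof.
move=> hA hB; pose G : R -> R := (expR \o A) * (cos \o B).
rewrite -[fun v => _ in X in is_derive _ _ X _]/G.
apply: is_derive_eq; rewrite /= /GRing.scale/=; ring.
Qed.

Lemma is_derive_affine (f : R -> R) (u df a k c : R) : is_derive u 1 f df ->
  is_derive u 1 (fun v => a + k * f v + c * v) (k * df + c).
Proof.
move=> hf.
have h := is_deriveD (is_deriveD (is_derive_cst a u 1) (is_deriveZ k hf))
  (is_deriveZ c (is_derive_id u 1)).
by apply: (is_derive_eq h); rewrite /GRing.scale/= add0r mulr1.
Qed.

(** * Rotating the exponent of the gamma integral *)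
Section Rotation.
Implicit Types (tau u z a : R).
Variables (x y l phi th : R).
Hypotheses (x0 : 0 < x) (phi_lt : `|phi| < pi / 2).

(* With s = x + i y and L = l + i phi: mm tau + i nn tau = exp (tau L) and c1 + i c2
   = s L. *)
Let mm tau := expR (tau * l) * cos (tau * phi).
Let nn tau := expR (tau * l) * sin (tau * phi).
Let c1 := x * l - y * phi.
Let c2 := x * phi + y * l.
Let tht tau := th + tau * c2.
Let F (tau t : R) := expR (tau * c1) * gker (x - 1) y (mm tau) (nn tau) (tht tau) t.
Let dF (tau t : R) := expR (tau * c1) *
  (c1 * gker (x - 1) y (mm tau) (nn tau) (tht tau) t
   - (l * mm tau - phi * nn tau) * gker x y (mm tau) (nn tau) (tht tau) t
   - c2 * gker (x - 1) y (mm tau) (nn tau) (tht tau - pi / 2) t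
   + (l * nn tau + phi * mm tau) *
     gker x y (mm tau) (nn tau) (tht tau - pi / 2) t).

Let xm1 : -1 < x - 1.
Proof. by rewrite ltrBrDr addNr. Qed.

Let xgtN1 : -1 < x.
Proof. by apply: lt_trans x0; rewrite oppr_lt0. Qed.

Let is_derive_F tau t : 0 < t -> is_derive tau 1 (F ^~ t) (dF tau t).
Proof.
move=> t0.
have dl k : is_derive tau 1 (fun u => u * k) k.
  have := is_derive_affine 0 0 k (is_derive_id tau (1:R)).
  by rewrite mul0r add0r; congr (is_derive _ _ _ _); apply/funext => u; ring.
have dM : is_derive tau 1 mm (l * mm tau - phi * nn tau).
  apply: is_derive_eq (is_derive_expR_cos (dl l) (dl phi)) _.
  by rewrite /mm /nn; ring.
have dN : is_derive tau 1 nn (l * nn tau + phi * mm tau).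
  have dB : is_derive tau 1 (fun u => - (pi / 2) + 0 * id u + phi * u) phi.
    by have := is_derive_affine (- (pi / 2)) 0 phi (is_derive_id tau (1:R));
      rewrite mul0r add0r.
  have := is_derive_expR_cos (dl l) dB.
  have -> : (fun v => expR (v * l) * cos (- (pi / 2) + 0 * id v + phi * v)) = nn.
    by apply/funext => v; rewrite mul0r addr0 addrC cosBpihalf (mulrC phi).
  move=> h; apply: (is_derive_eq h).
  rewrite (_ : - (pi / 2) + 0 * tau + phi * tau = tau * phi - pi / 2); last by ring.
  by rewrite cosBpihalf sinBpihalf /mm /nn; ring.
pose A u := (x - 1) * ln t + - t * mm u + c1 * u.
pose B u := (y * ln t + th) + - t * nn u + c2 * u.
have dA := is_derive_affine ((x - 1) * ln t) (- t) c1 dM.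
have dB := is_derive_affine (y * ln t + th) (- t) c2 dN.
have AE u : A u = (x - 1) * ln t - mm u * t + u * c1.
  by rewrite /A; ring.
have BE u : B u = y * ln t - nn u * t + tht u.
  by rewrite /B /tht; ring.
have -> : F ^~ t = fun u => expR (A u) * cos (B u).
  by apply/funext => u; rewrite /F /gker mulrA -expRD AE BE (addrC (u * c1)).
apply: is_derive_eq (is_derive_expR_cos dA dB) _.
rewrite -/(A tau) -/(B tau) /dF /gker.
have -> : y * ln t - nn tau * t + (tht tau - pi / 2) = B tau - pi / 2.
  by rewrite BE addrA.
rewrite -BE cosBpihalf.
have -> : x * ln t - mm tau * t = (x - 1) * ln t - mm tau * t + ln t by ring.
rewrite (expRD _ (ln t)) lnK ?posrE// AE expRD.
ring.
Qed.

(* The path is prolonged to an open interval I around [0, 1] on which Re (exp (tau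
   L)) stays above the constant m0. *)
Let e := (pi / 2 - `|phi|) / (2 * (`|phi| + 1)).
Let psi := (1 + e) * `|phi|.

Let e_gt0 : 0 < e.
Proof. by rewrite divr_gt0 ?subr_gt0// mulr_gt0// ltr_wpDl. Qed.

Let psi_lt : psi < pi / 2.
Proof.
have p0 : 0 <= `|phi| := normr_ge0 _.
have : e * (2 * (`|phi| + 1)) = pi / 2 - `|phi|.
  by rewrite /e divfK// lt0r_neq0// mulr_gt0// ltr_wpDl.
rewrite /psi; have := e_gt0; nra.
Qed.

Let e_le1 : e <= 1.
Proof.
have p0 : 0 <= `|phi| := normr_ge0 _.
rewrite ler_pdivrMr ?mulr_gt0 ?ltr_wpDl// mul1r.
have := @pihalf_lt2 R; lra.
Qed.

Let I := `](- e), (1 + e)[%classic.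

Let I_norm tau : I tau -> `|tau| <= 1 + e.
Proof. by rewrite /I/= in_itv/= ler_norml => /andP[]; lra. Qed.

Let m0 := expR (- (2 * `|l|)) * cos psi.

Let psi_ge0 : 0 <= psi.
Proof. by rewrite mulr_ge0// addr_ge0// ltW. Qed.

Let m0_gt0 : 0 < m0.
Proof.
rewrite mulr_gt0 ?expR_gt0// cos_gt0_pihalf// psi_lt andbT.
by apply: lt_le_trans psi_ge0; rewrite oppr_lt0; have := @pi_gt0 R; lra.
Qed.

Let I_mul tau a : I tau -> `|tau * a| <= 2 * `|a|.
Proof.
move=> /I_norm h; rewrite normrM ler_wpM2r//; have := e_le1; lra.
Qed.

Let mm_ge tau : I tau -> m0 <= mm tau.
Proof.
move=> It; rewrite /m0 /mm ler_pM ?expR_ge0//.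
- apply: cos_ge0_pihalf; rewrite (ltW psi_lt) andbT.
  by apply: le_trans psi_ge0; rewrite oppr_le0; have := @pi_gt0 R; lra.
- by rewrite ler_expR; have := I_mul l It; rewrite ler_norml => /andP[].
- rewrite -[leRHS]cos_norm.
  have h : `|tau * phi| <= psi by rewrite normrM /psi ler_wpM2r// I_norm.
  rewrite leNgt ltr_cos ?in_itv/= ?normr_ge0 ?psi_ge0//=; first by rewrite -leNgt.
    by rewrite (le_trans (ltW psi_lt))//; have := @pi_gt0 R; lra.
  by rewrite (le_trans h)// (le_trans (ltW psi_lt))//; have := @pi_gt0 R; lra.
Qed.

Let mn_le tau : I tau -> `|mm tau| <= expR (2 * `|l|) /\ `|nn tau| <= expR (2 * `|l|).
Proof.
move=> It; have h : expR (tau * l) <= expR (2 * `|l|).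
  by rewrite ler_expR (le_trans (ler_norm _))// I_mul.
split; rewrite normrM (ger0_norm (expR_ge0 _)) (le_trans _ h)// ler_piMr ?expR_ge0//.
  exact: cos_max.
exact: sin_max.
Qed.

Let gker_le0 z th' tau t : I tau -> 0 < t ->
  `|gker z y (mm tau) (nn tau) th' t| <= expR (z * ln t - m0 * t).
Proof.
move=> It t0; rewrite (le_trans (gker_le _ _ _ _ _ _))// ler_expR lerD2l lerN2.
by rewrite ler_wpM2r ?mm_ge// ltW.
Qed.

Let intF tau : I tau -> mu.-integrable posR (EFin \o F tau).
Proof.
move=> It; apply: integrable_EFinZ; first exact: measurable_itv.
apply: integrable_gker; first exact: xm1.
exact: lt_le_trans (mm_ge It).
Qed.

Let C := expR (2 * `|c1|) *
  (`|c1| + `|c2| + 2 * ((`|l| + `|phi|) * expR (2 * `|l|))).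
Let G t := C * (expR ((x - 1) * ln t - m0 * t) + expR (x * ln t - m0 * t)).

Let C_ge0 : 0 <= C.
Proof. by rewrite mulr_ge0 ?expR_ge0// !addr_ge0// !mulr_ge0 ?addr_ge0// expR_ge0. Qed.

Let dF_le tau t : I tau -> 0 < t -> `|dF tau t| <= G t.
Proof.
move=> It t0; rewrite normrM (ger0_norm (expR_ge0 _)) /G /C -mulrA ler_pM ?expR_ge0//.
  by rewrite ler_expR (le_trans (ler_norm _))// I_mul.
have [hm hn] := mn_le It.
have k1 := gker_le0 (x - 1) (tht tau) It t0.
have k2 := gker_le0 (x - 1) (tht tau - pi / 2) It t0.
have k3 := gker_le0 x (tht tau) It t0.
have k4 := gker_le0 x (tht tau - pi / 2) It t0.
set E1 := expR _ in k1 k2 *; set E2 := expR _ in k3 k4 *.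
set B := expR _ in hm hn *.
have E10 : 0 <= E1 by exact: expR_ge0.
have E20 : 0 <= E2 by exact: expR_ge0.
have B0 : 0 <= B by exact: expR_ge0.
set L := `|l|; set P := `|phi|.
have a1 : `|l * mm tau - phi * nn tau| <= (L + P) * B.
  by rewrite (le_trans (ler_normB _ _))// (normrM l) (normrM phi) mulrDl lerD// ler_wpM2l.
have a2 : `|l * nn tau + phi * mm tau| <= (L + P) * B.
  by rewrite (le_trans (ler_normD _ _))// (normrM l) (normrM phi) mulrDl lerD// ler_wpM2l.
rewrite (le_trans (ler_normD _ _))// (le_trans (lerD (ler_normB _ _) (lexx _)))//.
rewrite (le_trans (lerD (lerD (ler_normB _ _) (lexx _)) (lexx _)))//.
rewrite (normrM c1) (normrM c2) (normrM (l * mm tau - _)) (normrM (l * nn tau + _)).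
have b1 := ler_wpM2l (normr_ge0 c1) k1.
have b2 := ler_wpM2l (normr_ge0 c2) k2.
have b3 := ler_pM (normr_ge0 _) (normr_ge0 _) a1 k3.
have b4 := ler_pM (normr_ge0 _) (normr_ge0 _) a2 k4.
have d1 : 0 <= `|c1| * E2 by rewrite mulr_ge0.
have d2 : 0 <= `|c2| * E2 by rewrite mulr_ge0.
have d3 : 0 <= (L + P) * B * E1.
  by rewrite mulr_ge0// mulr_ge0// addr_ge0// normr_ge0.
lra.
Qed.

Let intG : mu.-integrable posR (EFin \o G).
Proof.
apply: integrable_EFinZ; first exact: measurable_itv.
apply: integrable_EFinD; first exact: measurable_itv.
  by apply: integrable_exp_ln.
by apply: integrable_exp_ln.
Qed.

Let W tau := Rintegral mu posR (F tau).

Let posR_gt0 t : posR t -> 0 < t.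
Proof. by rewrite /= in_itv/= andbT. Qed.

Let int_dF0 tau : I tau -> Rintegral mu posR (dF tau) = 0.
Proof.
move=> It; have mt : 0 < mm tau := lt_le_trans m0_gt0 (mm_ge It).
have i1 th' : mu.-integrable posR (EFin \o gker (x - 1) y (mm tau) (nn tau) th').
  by apply: integrable_gker.
have i2 th' : mu.-integrable posR (EFin \o gker x y (mm tau) (nn tau) th').
  by apply: integrable_gker.
have mp : measurable (posR : set (measurableTypeR R)) by exact: measurable_itv.
have j1 k th' := integrable_EFinZ mp k (i1 th').
have j2 k th' := integrable_EFinZ mp k (i2 th').
rewrite /dF RintegralZl//; last first.
  by apply: integrable_EFinD => //; do 2 apply: integrable_EFinB => //.
rewrite RintegralD//; last by do 2 apply: integrable_EFinB => //.
rewrite RintegralB//; last by apply: integrable_EFinB => //.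
rewrite RintegralB// !RintegralZl//.
have p1 := gker_parts y (nn tau) (tht tau) x0 mt.
have p2 := gker_parts y (nn tau) (tht tau - pi / 2) x0 mt.
have opp z t : gker z y (mm tau) (nn tau) (tht tau - pi / 2 - pi / 2) t =
    - gker z y (mm tau) (nn tau) (tht tau) t.
  by rewrite /gker !addrA !cosBpihalf sinBpihalf mulrN.
have opI z : -1 < z ->
   Rintegral mu posR (gker z y (mm tau) (nn tau) (tht tau - pi / 2 - pi / 2)) =
   - Rintegral mu posR (gker z y (mm tau) (nn tau) (tht tau)).
  move=> z1; have iz := integrable_gker y (nn tau) (tht tau) z1 mt.
  transitivity (Rintegral mu posR
    (fun t => -1 * gker z y (mm tau) (nn tau) (tht tau) t)).
    by congr Rintegral; apply/funext => t; rewrite opp mulN1r.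
  by rewrite RintegralZl// mulN1r.
rewrite !opI in p2; [|exact: xgtN1|exact: xm1].
move: p1 p2; rewrite /c1 /c2.
set A := Rintegral _ _ _; set B := Rintegral _ _ _; set A' := Rintegral _ _ _.
set B' := Rintegral _ _ _ => p1 p2.
rewrite [X in _ * X](_ : _ = l * (x * A - mm tau * B - y * A' + nn tau * B') -
 phi * (x * A' - mm tau * B' - y * - A + nn tau * - B)); last by ring.
by rewrite p1 p2; ring.
Qed.

Let is_derive_W tau : I tau -> is_derive tau 1 W 0.
Proof.
move=> It.
have d1 u t : I u -> posR t -> partial1of2 F u t = dF u t.
  move=> _ /posR_gt0 t0; rewrite partial1of2E.
  by have h := is_derive_F u t0; rewrite derive_val.
have G0 t : 0 <= G t by rewrite mulr_ge0 ?addr_ge0 ?expR_ge0.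
have dd u t : I u -> posR t -> derivable (F ^~ t) u 1.
  by move=> _ /posR_gt0 t0; have [] := is_derive_F u t0.
have ub u t : I u -> posR t -> `|partial1of2 F u t| <= G t.
  by move=> Iu pt; rewrite d1// dF_le// posR_gt0.
have mp : measurable (posR : set (measurableTypeR R)) by exact: measurable_itv.
have dW := @derivable_under_integral R _ _ lmu F posR mp tau _ _ It intF dd G G0 intG ub.
have eW := @differentiation_under_integral R _ _ lmu F posR mp tau _ _ It intF dd G G0 intG ub.
apply: DeriveDef => //; rewrite -derive1E eW -[RHS](int_dF0 It).
by apply: eq_Rintegral => t; rewrite inE => pt; rewrite d1.
Qed.

(** With [s = x + i y] and [L = l + i phi], this says that [exp (s L)] times the
    integral of [t ^ (s - 1) exp (- exp(L) t)] is [Gamma(s)], up to the phase th. F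
    tau has [exp (tau L)] in place of [exp(L)]; the tau-derivative of its integral
    is [L exp (tau s L)] times the left-hand side of gker_parts, hence 0. *)
Lemma gker_rotate :
  expR (x * l - y * phi) *
    Rintegral mu posR (gker (x - 1) y (expR l * cos phi) (expR l * sin phi)
      (th + (x * phi + y * l))) =
  Rintegral mu posR (gker (x - 1) y 1 0 th).
Proof.
have e0 := e_gt0.
have sub : `[(0:R), 1]%classic `<=` I.
  move=> t /=; rewrite !in_itv/= => /andP[t0 t1]; apply/andP; split.
    by apply: lt_le_trans t0; rewrite oppr_lt0.
  by apply: le_lt_trans t1 _; rewrite ltrDl.
have W01 : W 1 = W 0.
  have dW t : t \in `]0, 1[ -> is_derive t 1 W 0.
    by move=> t01; apply: is_derive_W; apply: sub; exact: subset_itv_oo_cc.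
  have cW : {within `[0, 1], continuous W}.
    apply: derivable_within_continuous => t t01.
    by have [] := is_derive_W (sub _ t01).
  have [c _] := MVT ltr01 dW cW.
  by rewrite mul0r => /subr0_eq.
move: W01; rewrite /W.
have i1 := intF (sub 1 _); have i0 := intF (sub 0 _).
have -> : Rintegral mu posR (F 0) = Rintegral mu posR (gker (x - 1) y 1 0 th).
  by congr Rintegral; apply/funext => t;
    rewrite /F /mm /nn /tht !mul0r expR0 cos0 sin0 mulr1 mulr0 addr0 mul1r.
move=> <-; rewrite /F RintegralZl//.
  by rewrite /mm /nn /tht !mul1r.
apply: integrable_gker; first exact: xm1.
by apply: lt_le_trans (mm_ge (sub 1 _)) => //=; rewrite in_itv/= ler01 lexx.
Qed.

End Rotation.

(** * The real gamma function and a positive oscillatory integral *)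
Definition rGamma (x : R) : R :=
  Rintegral mu posR (fun t => expR ((x - 1) * ln t - t)).

Lemma gker00 x m : gker x 0 m 0 0 = fun t => expR (x * ln t - m * t).
Proof.
by apply/funext => t; rewrite /gker !mul0r subr0 addr0 cos0 mulr1.
Qed.

Lemma rGammaE x : rGamma x = Rintegral mu posR (gker (x - 1) 0 1 0 0).
Proof.
by rewrite gker00; congr Rintegral; apply/funext => t; rewrite mul1r.
Qed.

Lemma integrable_Gamma x : 0 < x ->
  mu.-integrable posR (fun t => (expR ((x - 1) * ln t - t))%:E).
Proof.
move=> x0; have := @integrable_exp_ln (x - 1) 1.
rewrite ltrBrDr addNr => /(_ x0 ltr01).
by congr (integrable _ _ _); apply/funext => t; rewrite mul1r.
Qed.

Lemma rGammaS x : 0 < x -> rGamma (x + 1) = x * rGamma x.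
Proof.
move=> x0; have := gker_parts 0 0 0 x0 ltr01.
rewrite !rGammaE addrK !mul0r !mul1r subr0 addr0.
by move/eqP; rewrite subr_eq0 => /eqP <-.
Qed.

Lemma Rintegral_gt0_itv (f : R -> R) (a b e : R) :
  mu.-integrable posR (EFin \o f) -> 0 < a -> a < b -> 0 < e ->
  (forall t : R, 0 < t -> 0 <= f t) -> (forall t : R, a <= t <= b -> e <= f t) ->
  0 < Rintegral mu posR f.
Proof.
move=> fi a0 ab e0 f0 fe.
have sub : `[a, b]%classic `<=` posR.
  by move=> t /=; rewrite !in_itv/= andbT => /andP[+ _]; exact: lt_le_trans.
have mab : measurable (`[a, b]%classic : set (measurableTypeR R)) by exact: measurable_itv.
have : ((e * (b - a))%:E <= \int[mu]_(t in posR) (f t)%:E)%E.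
  apply: (@le_trans _ _ (\int[mu]_(t in `[a, b]) (cst e%:E t))%E).
    by rewrite integral_cst//= lebesgue_measure_itv/= lte_fin ab EFinM EFinB.
  apply: (@le_trans _ _ (\int[mu]_(t in `[a, b]) (f t)%:E)%E).
    apply: ge0_le_integral => //.
    - by move=> t _; rewrite lee_fin ltW.
    - by apply: (measurable_funS _ sub (measurable_int _ fi)).
  apply: ge0_subset_integral => //.
  - exact: measurable_int fi.
  - by move=> t /=; rewrite in_itv/= andbT lee_fin; exact: f0.
move=> h; rewrite -lte_fin /Rintegral fineK; last exact: integrable_fin_num.
by apply: lt_le_trans h; rewrite lte_fin mulr_gt0// subr_gt0.
Qed.

Lemma rGamma_gt0 x : 0 < x -> 0 < rGamma x.
Proof.
move=> x0; apply: (@Rintegral_gt0_itv _ 1 2 (expR (- (`|x - 1| + 2)))).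
- exact: integrable_Gamma.
- by [].
- by rewrite ltr1n.
- exact: expR_gt0.
- by move=> t _; exact: expR_ge0.
- move=> t /andP[t1 t2]; rewrite ler_expR.
  have l0 : 0 <= ln t by exact: ln_ge0.
  have l1 : ln t <= 1.
    have := @le_ln1Dx R (t - 1); rewrite subrKC => h.
    by apply: le_trans (h _) _; lra.
  have := ler_norm (- (x - 1)); rewrite normrN => h.
  have n0 := normr_ge0 (x - 1).
  by nra.
Qed.

Lemma cos_ge1Bsqr (u : R) : 1 - u ^+ 2 / 2 <= cos u.
Proof.
have h v : 0 <= v -> `|sin v| <= v :> R.
  rewrite le_eqVlt => /predU1P[<-|v0]; first by rewrite sin0 normr0.
  have [c _] := MVT v0 (fun z _ => is_derive_sin z)
    (continuous_subspaceT (@continuous_sin R)).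
  rewrite sin0 !subr0 => ->; rewrite normrM (gtr0_norm v0) ler_piMl ?(ltW v0)//.
  exact: cos_max.
have sv : sin (u / 2) ^+ 2 <= (u / 2) ^+ 2.
  rewrite -[leLHS]real_normK ?num_real// -[leRHS]real_normK ?num_real//.
  rewrite lerXn2r ?nnegrE ?normr_ge0//.
  by case: (leP 0 (u / 2)) => [u0|/ltW u0];
    [rewrite (ger0_norm u0) h|rewrite (ler0_norm u0) -normrN -sinN h// oppr_ge0].
have -> : cos u = 1 - 2 * sin (u / 2) ^+ 2.
  rewrite -{1}(divfK (_ : 2 != 0 :> R) u) ?pnatr_eq0//.
  rewrite mulr_natr cos_mulr2n sin2cos2 -mulr_natr; ring.
lra.
Qed.

(** A bound by powers of v, whose integrals against a gamma kernel are again values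
    of the gamma function. *)
Lemma sqr_ln_le (v : R) : 0 < v -> ln v ^+ 2 <= (v - 1) ^+ 2 + (1 - v^-1) ^+ 2.
Proof.
move=> v0.
have h1 : ln v <= v - 1.
  by have := @le_ln1Dx R (v - 1); rewrite subrKC; apply; lra.
have h2 : 1 - v^-1 <= ln v.
  rewrite -[v in ln v]invrK lnV ?posrE ?invr_gt0//.
  have vi : 0 < v^-1 by rewrite invr_gt0.
  have := @le_ln1Dx R (v^-1 - 1); rewrite subrKC => h.
  have := h _; lra.
move: h1 h2; set l := ln v; set a := v - 1; set b := 1 - v^-1 => h1 h2.
case: (leP 0 l) => l0.
  by have := sqr_ge0 b; nra.
by have := sqr_ge0 a; nra.
Qed.

Lemma integral_lin_Gamma (s : seq (R * R)) :
  all (fun p => 0 < p.2) s ->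
  mu.-integrable posR
    (EFin \o (fun t => \sum_(p <- s) p.1 * expR ((p.2 - 1) * ln t - t))) /\
  Rintegral mu posR (fun t => \sum_(p <- s) p.1 * expR ((p.2 - 1) * ln t - t)) =
  \sum_(p <- s) p.1 * rGamma p.2.
Proof.
have mp : measurable (posR : set (measurableTypeR R)) by exact: measurable_itv.
elim: s => [_|[c a] s IH /=/andP[a0 /IH[sI es]]].
  have -> : (fun t : R => \sum_(p <- [::]) p.1 * expR ((p.2 - 1) * ln t - t)) = cst 0.
    by apply/funext => t; rewrite big_nil.
  split; first exact: integrable0.
  by rewrite big_nil Rintegral_cst// mul0r.
have -> : (fun t : R => \sum_(p <- (c, a) :: s) p.1 * expR ((p.2 - 1) * ln t - t)) =
   fun t => c * expR ((a - 1) * ln t - t) +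
     \sum_(p <- s) p.1 * expR ((p.2 - 1) * ln t - t).
  by apply/funext => t; rewrite big_cons.
have ia := integrable_EFinZ mp c (integrable_Gamma a0).
split; first exact: integrable_EFinD.
rewrite RintegralD// es big_cons/= RintegralZl//.
exact: integrable_Gamma.
Qed.

Lemma phase_bound (M b : R) : 4 < M -> 0 <= b -> 5 + 6 * b < M ->
  0 < M * (M - 1) - b * ((M - 1) * (M + 2) / M + M).
Proof.
move=> M4 b0 Mb; have M0 : 0 < M by lra.
have h1 : (M - 1) * (M + 2) / M <= M + 1 by rewrite ler_pdivrMr//; nra.
have h2 : b * ((M - 1) * (M + 2) / M + M) <= b * (2 * M + 1).
  by rewrite ler_wpM2l//; lra.
nra.
Qed.

(** For large x the mass of t ^ (x - 1) exp (- t) sits near [t = x - 1]. Once the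
    phase [y ln (x - 1)] is removed, the cosine is at least
    [1 - y ^ 2 (ln t - ln (x - 1)) ^ 2 / 2], and by sqr_ln_le its integral is at
    least an explicit positive multiple of Gamma(x - 2). *)
Lemma gker_phase_gt0 (x y : R) : 6 + y ^+ 2 * 3 < x ->
  0 < Rintegral mu posR (gker (x - 1) y 1 0 (- (y * ln (x - 1)))).
Proof.
move=> xb; have y20 := sqr_ge0 y.
have [M xE] : exists M, x = M + 1 by exists (x - 1); rewrite subrK.
have M0 : 4 < M by lra.
have Mp : 0 < M by lra.
pose b := y ^+ 2 / 2; have b0 : 0 <= b by rewrite divr_ge0.
(* Coefficients and exponents of the minorant t ^ M exp (- t) (1 - b ((t / M - 1) ^
   2 + (1 - M / t) ^ 2)), expanded in powers of t. *)
pose s := [:: (1 - 2 * b, M + 1); (- (b / M ^+ 2), M + 1 + 1 + 1);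
  (2 * b / M, M + 1 + 1); (2 * b * M, M); (- (b * M ^+ 2), M - 1)].
have sP : all (fun p => 0 < p.2) s.
  by rewrite /s /=; apply/and5P; split; rewrite ?andbT; lra.
have [sI es] := integral_lin_Gamma sP.
have g0 : 0 < rGamma (M - 1) by apply: rGamma_gt0; lra.
apply: (@lt_le_trans _ _ (\sum_(p <- s) p.1 * rGamma p.2)).
  have e1 : rGamma M = (M - 1) * rGamma (M - 1).
    by rewrite -rGammaS ?subrK//; clear -M0; lra.
  have e2 := rGammaS Mp.
  have e3 : rGamma (M + 1 + 1) = (M + 1) * rGamma (M + 1) by apply: rGammaS; clear -Mp; lra.
  have e4 : rGamma (M + 1 + 1 + 1) = (M + 1 + 1) * rGamma (M + 1 + 1).
    by apply: rGammaS; clear -Mp; lra.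
  rewrite /s !big_cons big_nil/= e4 e3 e2 e1 addr0.
  set g := rGamma (M - 1) in g0 *.
  rewrite [X in _ < X](_ : _ = g * (M * (M - 1) - b * ((M - 1) * (M + 2) / M + M))).
    by rewrite mulr_gt0// phase_bound// /b; clear -xb xE; lra.
  field; exact: lt0r_neq0.
rewrite -es; apply: le_Rintegral => //.
- by apply: integrable_gker => //; lra.
- move=> t /=; rewrite in_itv/= andbT => t0.
  rewrite /s !big_cons big_nil/= addr0 /gker xE addrK mul1r mul0r subr0.
  set u := expR (M * ln t - t).
  have u0 : 0 < u by exact: expR_gt0.
  have tE : expR (ln t) = t by exact: lnK.
  have T2 : expR ((M + 1 + 1 + 1 - 1) * ln t - t) = u * t ^+ 2.
    by rewrite expr2 -tE -!expRD tE; congr expR; ring.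
  have T1 : expR ((M + 1 + 1 - 1) * ln t - t) = u * t.
    by rewrite -[t in RHS]tE -!expRD; congr expR; ring.
  have Tm1 : expR ((M - 1) * ln t - t) = u / t.
    by rewrite -[t in _ / t]tE -expRN -!expRD; congr expR; ring.
  have Tm2 : expR ((M - 1 - 1) * ln t - t) = u / t / t.
    have tV : t^-1 = expR (- ln t) by rewrite expRN tE.
    by rewrite tV -!expRD; congr expR; ring.
  rewrite T2 T1 Tm1 Tm2.
  have v0 : 0 < t / M by rewrite divr_gt0.
  have := cos_ge1Bsqr (y * (ln t - ln M)).
  rewrite mulrBr => hc.
  have hl := sqr_ln_le v0; rewrite ln_div ?posrE// in hl.
  apply: (@le_trans _ _ (u * (1 - b * ((t / M - 1) ^+ 2 + (1 - (t / M)^-1) ^+ 2)))).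
    rewrite le_eqVlt; apply/orP; left; apply/eqP; field.
    by rewrite !lt0r_neq0.
  rewrite ler_wpM2l ?(ltW u0)//; apply: le_trans hc.
  rewrite lerD2l lerN2 -mulrBr exprMn mulrAC ler_wpM2l//.
Qed.

End HalfLine.

(** * The complex gamma function *)
Section ComplexKernel.
Context {R : realType}.
Implicit Types (x y m n th t : R).
Local Notation mu := (@lebesgue_measure R).
Local Notation posR := `]0%R : R, +oo[%classic.

Lemma eq_cintegrable (D : set R) (f g : R -> R[i]) : measurable D ->
  (forall t, D t -> f t = g t) -> cintegrable D f -> cintegrable D g.
Proof.
move=> mD fg [fr fi]; split.
  by apply: eq_integrable fr => // t; rewrite inE => /fg ->.
by apply: eq_integrable fi => // t; rewrite inE => /fg ->.
Qed.

Lemma eq_cintegral (D : set R) (f g : R -> R[i]) : measurable D ->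
  (forall t, D t -> f t = g t) -> cintegral D f = cintegral D g.
Proof.
move=> mD fg; rewrite /cintegral.
have -> : cintegrable D f = cintegrable D g.
  by apply/propext; split; apply: eq_cintegrable => // t /fg.
case: ifP => // _; congr (_ +i* _);
  by apply: eq_Rintegral => t; rewrite inE => /fg ->.
Qed.

Lemma cintegralE (D : set R) (f : R -> R[i]) : cintegrable D f ->
  cintegral D f = Rintegral mu D (fun t => complex.Re (f t))
      +i* Rintegral mu D (fun t => complex.Im (f t)).
Proof. by move=> fi; rewrite /cintegral asboolT. Qed.

Lemma carg_gt0 t : 0 < t -> carg t%:C = 0.
Proof.
move=> t0; rewrite /carg /= lexx expr0n addr0 sqrtr_sqr gtr0_norm// divff ?acos1//.
exact: lt0r_neq0.
Qed.

Lemma clog_gt0 t : 0 < t -> clog t%:C = (ln t)%:C.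
Proof.
by move=> t0; rewrite /clog carg_gt0//= expr0n addr0 sqrtr_sqr gtr0_norm.
Qed.

Lemma cexpE (a b : R) : cexp (a +i* b) = (expR a * cos b) +i* (expR a * sin b).
Proof. by rewrite /cexp/=; simpc. Qed.

Lemma cexpD (v w : R[i]) : cexp (v + w) = cexp v * cexp w.
Proof.
case: v w => [a b] [c d]; rewrite -[(a +i* b) + _]/((a + c) +i* (b + d)) !cexpE expRD cosD sinD.
by simpc; congr (_ +i* _); ring.
Qed.

Lemma cexp0 : cexp (0 : R[i]) = 1.
Proof. by rewrite cexpE expR0 cos0 sin0 !mul1r. Qed.

Lemma cexp_neq0 (w : R[i]) : cexp w != 0.
Proof.
apply/eqP => w0; have := cexpD w (- w).
by rewrite subrr cexp0 w0 mul0r => /eqP; rewrite oner_eq0.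
Qed.

Lemma ckernelE (s w : R[i]) t : 0 < t ->
  cpow t%:C (s - 1) * cexp (- (w * t%:C)) =
  gker (complex.Re s - 1) (complex.Im s) (complex.Re w) (complex.Im w) 0 t
  +i* gker (complex.Re s - 1) (complex.Im s) (complex.Re w) (complex.Im w)
        (- (pi / 2)) t.
Proof.
move=> t0; rewrite /cpow clog_gt0// -cexpD.
case: s w => [x y] [m n] /=; simpc; rewrite cexpE /gker addr0 cosBpihalf.
by congr (expR _ * cos _ +i* (expR _ * sin _)); ring.
Qed.

Lemma posR_measurable : measurable posR.
Proof. exact: measurable_itv. Qed.

Lemma posR_gt0 t : posR t -> 0 < t.
Proof. by rewrite /= in_itv/= andbT. Qed.

Lemma ckernel_integral (s w : R[i]) : 0 < complex.Re s -> 0 < complex.Re w ->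
  let K := fun th => Rintegral mu posR
    (gker (complex.Re s - 1) (complex.Im s) (complex.Re w) (complex.Im w) th) in
  cintegrable posR (fun t => cpow t%:C (s - 1) * cexp (- (w * t%:C))) /\
  cintegral posR (fun t => cpow t%:C (s - 1) * cexp (- (w * t%:C))) =
    K 0 +i* K (- (pi / 2)).
Proof.
move=> s0 w0 K.
have i th := integrable_gker (complex.Im s) (complex.Im w) th
   (ltac:(rewrite ltrBrDr addNr; exact: s0) : -1 < complex.Re s - 1) w0.
pose f t := gker (complex.Re s - 1) (complex.Im s) (complex.Re w) (complex.Im w) 0 t
  +i* gker (complex.Re s - 1) (complex.Im s) (complex.Re w) (complex.Im w)
        (- (pi / 2)) t.
have fi : cintegrable posR f by split; exact: i.
split.
  apply: eq_cintegrable fi; first exact: posR_measurable.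
  by move=> t /posR_gt0 t0; rewrite ckernelE.
rewrite (eq_cintegral posR_measurable (g := f)) ?cintegralE//.
by move=> t /posR_gt0 t0; rewrite ckernelE.
Qed.

Lemma gamma_integralE (s : R[i]) : 0 < complex.Re s ->
  gamma_integral s =
    Rintegral mu posR (gker (complex.Re s - 1) (complex.Im s) 1 0 0) +i*
    Rintegral mu posR (gker (complex.Re s - 1) (complex.Im s) 1 0 (- (pi / 2))).
Proof.
move=> s0; have [_] := @ckernel_integral s 1 s0 ltr01.
rewrite /= => <-; apply: eq_cintegral; first exact: posR_measurable.
by move=> t _; rewrite mul1r.
Qed.

Lemma cGammaE (s : R[i]) : 0 < complex.Re s -> cGamma s = gamma_integral s.
Proof.
move=> s0; rewrite /cGamma.
have -> : Num.truncn (1 - complex.Re s) = 0%N.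
  by apply/eqP; rewrite -leqn0 truncn_le_nat ltrBlDr ltrDl.
by rewrite addr0 /pochhammer big_ord0 divr1.
Qed.

Lemma integral_gker_phase (x y m n th al : R) : -1 < x -> 0 < m ->
  Rintegral mu posR (gker x y m n (th + al)) =
  cos al * Rintegral mu posR (gker x y m n th) -
  sin al * Rintegral mu posR (gker x y m n (th - pi / 2)).
Proof.
move=> x1 m0; have i th' := integrable_gker y n th' x1 m0.
have mp : measurable (posR : set (measurableTypeR R)) by exact: measurable_itv.
transitivity (Rintegral mu posR (fun t => cos al * gker x y m n th t -
   sin al * gker x y m n (th - pi / 2) t)).
  congr Rintegral; apply/funext => t.
  by rewrite /gker !addrA cosBpihalf cosD; ring.
rewrite RintegralB//; try exact: integrable_EFinZ.
by rewrite !RintegralZl.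
Qed.

(** The complex form of gker_rotate; [exp (tau L)] stays in the right half-plane for
    [0 <= tau <= 1]. *)
Lemma ckernel_integral_cexp (s L : R[i]) : 0 < complex.Re s ->
  `|complex.Im L| < pi / 2 ->
  cexp (s * L) * cintegral posR (fun t => cpow t%:C (s - 1) * cexp (- (cexp L * t%:C)))
  = cGamma s.
Proof.
case: s L => [x y] [l phi] /= x0 ph; rewrite cGammaE//.
have m0 : 0 < complex.Re (cexp (l +i* phi)).
  by rewrite cexpE/= mulr_gt0 ?expR_gt0// cos_gt0_pihalf// -ltr_norml.
rewrite (ckernel_integral (s := x +i* y) _ m0).2//= gamma_integralE//=.
rewrite -!(gker_rotate _ l _ x0 ph).
rewrite cexpE/= in m0.
have xm : -1 < x - 1 by rewrite ltrBrDr addNr.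
rewrite !mul0r subr0 addr0.
pose al := x * phi + y * l.
rewrite -/al (integral_gker_phase _ _ 0 al xm m0).
rewrite (integral_gker_phase _ _ (- (pi / 2)) al xm m0).
have -> : - (pi / 2) - pi / 2 = 0 + - pi :> R by rewrite add0r; field.
rewrite (integral_gker_phase _ _ 0 (- pi) xm m0) cosN sinN cospi sinpi.
rewrite sub0r oppr0 mul0r subr0 mulN1r.
set A := Rintegral _ _ _; set B := Rintegral _ _ _.
have -> : (x +i* y) * (l +i* phi) = (x * l - y * phi) +i* al by [].
rewrite cexpE; set e := expR _; set c := cos al; set d := sin al.
rewrite -[LHS]/((e * c * A - e * d * B) +i* (e * c * B + e * d * A)).
by congr (_ +i* _); ring.
Qed.

Lemma clog_Re_gt0 (w : R[i]) : 0 < complex.Re w ->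
  cexp (clog w) = w /\ `|complex.Im (clog w)| < pi / 2.
Proof.
case: w => [a b] /= a0; rewrite /clog cexpE /carg /=.
set r := Num.sqrt (a ^+ 2 + b ^+ 2).
have ab0 : 0 < a ^+ 2 + b ^+ 2 by rewrite ltr_pwDl ?exprn_gt0 ?sqr_ge0.
have r0 : 0 < r by rewrite sqrtr_gt0.
have rE : r ^+ 2 = a ^+ 2 + b ^+ 2 by rewrite sqr_sqrtr// ltW.
have ar : a <= r.
  rewrite -[leLHS](gtr0_norm a0) -sqrtr_sqr; apply: ler_wsqrtr.
  by rewrite lerDl sqr_ge0.
have q0 : 0 < a / r by rewrite divr_gt0.
have q1 : a / r <= 1 by rewrite ler_pdivrMr// mul1r.
have qb : -1 <= a / r <= 1 by rewrite q1 andbT (le_trans _ (ltW q0))// oppr_le0.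
have cq : cos (acos (a / r)) = a / r by apply: acosK; rewrite in_itv/=.
have sq : sin (acos (a / r)) = `|b| / r.
  rewrite sin_acos// -sqrtr_sqr -[r in RHS]gtr0_norm// -sqrtr_sqr.
  rewrite -sqrtrV ?sqr_ge0// -sqrtrM ?sqr_ge0//; congr Num.sqrt.
  rewrite expr_div_n rE; field; exact: lt0r_neq0.
have tq : acos (a / r) < pi / 2.
  rewrite -acos0 ltNge; apply/negP => h.
  have := q0; rewrite -cq ltNge => /negP; apply.
  have : ~~ (cos (acos (0 : R)) < cos (acos (a / r))).
    rewrite ltr_cos ?in_itv/= ?acos_ge0 ?acos_lepi//= ?lexx ?oppr_le0 ?ler01//.
    by rewrite -leNgt.
  by rewrite acos0 cos_pihalf -leNgt.
split; last first.
  have t0 := acos_ge0 qb.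
  by case: ifP => _; rewrite ?normrN ger0_norm.
rewrite lnK ?posrE//.
case: ifPn => b0; rewrite ?cosN ?sinN cq sq.
  by rewrite (ger0_norm b0); congr (_ +i* _); rewrite mulrC divfK// lt0r_neq0.
rewrite -ltNge in b0.
rewrite (ltr0_norm b0) mulNr opprK.
by congr (_ +i* _); rewrite mulrC divfK// lt0r_neq0.
Qed.

Lemma cintegral_power (s w : R[i]) : 0 < complex.Re s -> 0 < complex.Re w ->
  cintegrable posR (fun t => cpow t%:C (s - 1) * cexp (- (w * t%:C))) /\
  cintegral posR (fun t => cpow t%:C (s - 1) * cexp (- (w * t%:C))) =
    cGamma s / cpow w s.
Proof.
move=> s0 w0; have [h _] := ckernel_integral s0 w0; split=> //.
have [wE wl] := clog_Re_gt0 w0.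
have := ckernel_integral_cexp s0 wl; rewrite wE => <-.
by rewrite mulrC mulKf// /cpow cexp_neq0.
Qed.

Lemma cGammaS (s : R[i]) : 0 < complex.Re s -> cGamma (s + 1) = s * cGamma s.
Proof.
case: s => [x y] /= x0; have x10 : 0 < x + 1 by rewrite addr_gt0.
rewrite !cGammaE// !gamma_integralE//=; simpc; rewrite addrK.
have h1 := gker_parts y 0 0 x0 ltr01.
have h2 := gker_parts y 0 (- (pi / 2)) x0 ltr01.
have xm : -1 < x - 1 by rewrite ltrBrDr addNr.
rewrite sub0r in h1.
have E : - (pi / 2) - pi / 2 = 0 + - pi :> R by rewrite add0r; field.
rewrite E (integral_gker_phase _ _ 0 (- pi) xm ltr01) cosN sinN cospi sinpi in h2.
rewrite oppr0 mul0r subr0 mulN1r !mul0r addr0 mul1r in h2.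
rewrite !mul0r addr0 mul1r in h1.
move: h1 h2; set A := Rintegral _ _ _; set B := Rintegral _ _ _.
set A' := Rintegral _ _ _; set B' := Rintegral _ _ _.
move: A B A' B' => A B A' B' {E} h1 h2.
by congr (_ +i* _); [clear -h1; lra|clear -h2; lra].
Qed.

Lemma natr_complex (n : nat) : n%:R = (n%:R : R)%:C :> R[i].
Proof. by rewrite rmorph_nat. Qed.

Lemma Re_addn (s : R[i]) (n : nat) : complex.Re (s + n%:R) = complex.Re s + n%:R.
Proof. by rewrite natr_complex; case: s. Qed.

Lemma Im_addn (s : R[i]) (n : nat) : complex.Im (s + n%:R) = complex.Im s.
Proof. by rewrite natr_complex; case: s => a b /=; rewrite addr0. Qed.

Lemma cGamma_addn (s : R[i]) (n : nat) : 0 < complex.Re s ->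
  cGamma (s + n%:R) = pochhammer s n * cGamma s.
Proof.
move=> s0; elim: n => [|n IH].
  by rewrite addr0 /pochhammer big_ord0 mul1r.
rewrite -natr1 addrA cGammaS.
  by rewrite IH /pochhammer big_ord_recr/=; ring.
by rewrite Re_addn ltr_wpDr.
Qed.

(** A zero at s would give zeros at all s + n, against gker_phase_gt0 for large
    n. *)
Lemma cGamma_neq0 (s : R[i]) : 0 < complex.Re s -> cGamma s != 0.
Proof.
move=> s0; apply/eqP => G0.
(* The shift makes Re (s + N) exceed the threshold of gker_phase_gt0. *)
pose N := (Num.truncn (6 + complex.Im s ^+ 2 * 3)).+1.
have : cGamma (s + N%:R) = 0 by rewrite cGamma_addn// G0 mulr0.
have ReN : 6 + complex.Im s ^+ 2 * 3 < complex.Re (s + N%:R).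
  rewrite Re_addn (lt_le_trans (truncnS_gt _))// lerDr ltW//.
have ReN0 : 0 < complex.Re (s + N%:R).
  by apply: le_lt_trans ReN; rewrite addr_ge0// mulr_ge0// sqr_ge0.
rewrite cGammaE// gamma_integralE// Im_addn => -[g1 g2].
have /(_ (complex.Im s) ReN) := @gker_phase_gt0 R (complex.Re (s + N%:R)).
rewrite -[X in gker _ _ _ _ X]add0r integral_gker_phase//.
  by rewrite sub0r g1 g2 !mulr0 subrr ltxx.
by rewrite ltrBrDr addNr.
Qed.

Lemma cGamma_real x : 0 < x -> cGamma x%:C = (rGamma x)%:C.
Proof.
move=> x0; rewrite cGammaE// gamma_integralE//= rGammaE; congr (_ +i* _).
transitivity (Rintegral mu posR (fun _ : R => 0)).
  congr Rintegral; apply/funext => t.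
  by rewrite /gker !mul0r subr0 add0r cosN cos_pihalf mulr0.
by rewrite Rintegral_cst ?mul0r//; exact: measurable_itv.
Qed.

End ComplexKernel.

(** * Interchange of sum and integral *)
Section SeriesIntegral.
Local Open Scope ring_scope.
Context d (T : measurableType d) (R : realType).
Variables (mu : {measure set T -> \bar R}) (D : set T).
Hypothesis mD : measurable D.
Variables (f h : nat -> T -> R) (K : R).
Hypothesis fi : forall n, mu.-integrable D (EFin \o f n).
Hypothesis hi : forall n, mu.-integrable D (EFin \o h n).
Hypothesis fh : forall n t, D t -> `|f n t| <= h n t.
Hypothesis hK : forall N, \sum_(0 <= n < N) Rintegral mu D (h n) <= K.
Hypothesis hc : forall t, D t -> cvgn (series (h ^~ t)).

Let g t := limn (series (h ^~ t)).

Let h0 n t : D t -> 0 <= h n t.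
Proof. by move=> Dt; apply: le_trans (fh n Dt). Qed.

Let gE t : D t -> (\sum_(n <oo) (h n t)%:E)%E = (g t)%:E.
Proof.
move=> Dt; apply/cvg_lim => //.
have -> : (fun N => (\sum_(0 <= n < N) (h n t)%:E)%E) = EFin \o series (h ^~ t).
  by apply/funext => N; rewrite /= /series/= sumEFin.
by apply: cvg_EFin; [exact: nearW|exact: hc].
Qed.

Let g0 t : D t -> 0 <= g t.
Proof.
move=> Dt; apply: limr_ge; first exact: hc.
by apply: nearW => N; apply: sumr_ge0 => n _; exact: h0.
Qed.

Let gi : mu.-integrable D (EFin \o g).
Proof.
have mh n : measurable_fun D (fun t => (h n t)%:E) by exact: measurable_int (hi n).
apply/integrableP; split.
  apply: (eq_measurable_fun (fun t => (\sum_(n <oo) (h n t)%:E)%E)).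
    by move=> t; rewrite inE => /gE.
  apply: (@emeasurable_fun_cvg _ _ _ _ (fun N t => (\sum_(0 <= n < N) (h n t)%:E)%E)).
    by move=> N; apply: emeasurable_sum.
  move=> t Dt; apply: is_cvg_nneseries => n _ _.
  by rewrite lee_fin h0.
rewrite (eq_integral (fun t => (\sum_(n <oo) (h n t)%:E)%E)); last first.
  move=> t; rewrite inE => Dt; by rewrite gE// gee0_abs// lee_fin g0.
rewrite integral_nneseries//.
apply: (@le_lt_trans _ _ K%:E); last exact: ltry.
apply: lime_le.
  by apply: is_cvg_nneseries => n _ _; apply: integral_ge0 => t Dt; rewrite lee_fin h0.
apply: nearW => N.
under eq_bigr do rewrite -(fineK (integrable_fin_num mD (hi _))).
by rewrite sumEFin lee_fin hK.
Qed.

Let fc t : D t -> series (f ^~ t) @ \oo --> limn (series (f ^~ t)).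
Proof.
move=> Dt; apply: (@normed_cvg R R (f ^~ t)).
apply: (series_le_cvg _ _ _ (hc Dt)) => n //=; [exact: h0|exact: fh].
Qed.

(** Dominated convergence; the dominating function is the sum of the h n, integrable
    by monotone convergence since the sums of their integrals stay below K. *)
Lemma integral_series :
  mu.-integrable D (EFin \o (fun t => limn (series (f ^~ t)))) /\
  series (fun n => Rintegral mu D (f n)) @ \oo -->
    Rintegral mu D (fun t => limn (series (f ^~ t))).
Proof.
have mf n : measurable_fun D (f n) by apply/measurable_EFinP; exact: measurable_int (fi n).
have mS N : measurable_fun D (fun t => (series (f ^~ t) N)%:E).
  by apply/measurable_EFinP; rewrite /series/=; apply: measurable_sum.
have Sc t : D t -> (series (f ^~ t) N)%:E @[N --> \oo] --> (limn (series (f ^~ t)))%:E.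
  by move=> Dt; apply: cvg_EFin; [exact: nearW|exact: fc].
have dom N t : D t -> (`|(series (f ^~ t) N)%:E| <= (g t)%:E)%E.
  move=> Dt; rewrite lee_fin (le_trans (ler_norm_sum _ _ _))//.
  apply: (@le_trans _ _ (series (h ^~ t) N)).
    by apply: ler_sum => n _; exact: fh.
  apply: nondecreasing_cvgn_le; last exact: hc.
  by apply: nondecreasing_series => n _ _; exact: h0.
have [i1 _ c1] := @dominated_convergence _ T R mu D mD
  (fun N t => (series (f ^~ t) N)%:E) (fun t => (limn (series (f ^~ t)))%:E)
  (EFin \o g) mS
  (emeasurable_fun_cvg _ _ mS Sc) (aeW _ Sc) gi
  (aeW _ (fun t N => dom N t)).
split=> //.
have -> : series (fun n => Rintegral mu D (f n)) =
   (fun N => Rintegral mu D (fun t => series (f ^~ t) N)).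
  by apply/funext => N; rewrite /series/= (Rintegral_sum_nat mD N fi).2.
apply: fine_cvg; rewrite fineK//.
exact: integrable_fin_num.
Qed.

End SeriesIntegral.

(** * Complex series and integrals, by coordinates *)
Section ComplexSeries.
Context {R : realType}.
Implicit Types (x y m n th t : R) (z : R[i]).
Local Notation mu := (@lebesgue_measure R).
Local Notation normc := (@ComplexField.Normc.normc R).

Lemma normcE z : normc z = Num.sqrt (complex.Re z ^+ 2 + complex.Im z ^+ 2).
Proof. by case: z. Qed.

Lemma normc_ge0 z : 0 <= normc z.
Proof. by rewrite normcE sqrtr_ge0. Qed.

Lemma norm_Re_le z : `|complex.Re z| <= normc z.
Proof. by rewrite normcE -sqrtr_sqr ler_wsqrtr// lerDl sqr_ge0. Qed.

Lemma norm_Im_le z : `|complex.Im z| <= normc z.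
Proof. by rewrite normcE -sqrtr_sqr ler_wsqrtr// lerDr sqr_ge0. Qed.

Lemma normc_le z : normc z <= `|complex.Re z| + `|complex.Im z|.
Proof.
rewrite normcE -[leRHS]ger0_norm ?addr_ge0// -sqrtr_sqr ler_wsqrtr//.
rewrite sqrrD !real_normK ?num_real// lerD2r lerDl.
by rewrite mulrn_wge0// mulr_ge0.
Qed.

Lemma normcM z w : normc (z * w) = normc z * normc w.
Proof. exact: ComplexField.Normc.normcM. Qed.

Lemma normcX z (k : nat) : normc (z ^+ k) = normc z ^+ k.
Proof.
elim: k => [|k IH]; last by rewrite !exprS normcM IH.
by rewrite !expr0 normcE/= expr1n expr0n addr0 sqrtr1.
Qed.

Lemma normc_cexp z : normc (cexp z) = expR (complex.Re z).
Proof.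
case: z => a b; rewrite cexpE normcE/= !exprMn -mulrDr cos2Dsin2 mulr1.
by rewrite sqrtr_sqr ger0_norm ?expR_ge0.
Qed.

Lemma normr_normc z : `|z| = (normc z)%:C.
Proof. by []. Qed.

Lemma cvgn_nneg_bounded (u : nat -> R) K : (forall k, 0 <= u k) ->
  (forall N, series u N <= K) -> cvgn (series u).
Proof.
move=> u0 uK; apply: nondecreasing_is_cvgn.
  by apply: nondecreasing_series => k _ _.
by exists K => _ [N _ <-].
Qed.

Definition ccvg (u : nat -> R[i]) :=
  cvgn (series (fun k => complex.Re (u k))) /\
  cvgn (series (fun k => complex.Im (u k))).

Lemma csumZ (k : R[i]) (u : nat -> R[i]) : ccvg u ->
  csum (fun j => k * u j) = k * csum u.
Proof.
case: k => a b [ur ui]; rewrite /csum.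
set U := series (fun j => complex.Re (u j)) in ur *.
set V := series (fun j => complex.Im (u j)) in ui *.
have eR : series (fun j => complex.Re ((a +i* b) * u j)) = fun N => a * U N - b * V N.
  apply/funext => N; rewrite /U /V /series/= !mulr_sumr -sumrB.
  by apply: eq_bigr => j _; case: (u j).
have eI : series (fun j => complex.Im ((a +i* b) * u j)) = fun N => a * V N + b * U N.
  apply/funext => N; rewrite /U /V /series/= !mulr_sumr -big_split/=.
  by apply: eq_bigr => j _; case: (u j).
rewrite eR eI.
have -> : limn (fun N => a * U N - b * V N) = a * limn U - b * limn V.
  by apply/cvg_lim => //; apply: cvgB; apply: cvgMr.
have -> : limn (fun N => a * V N + b * U N) = a * limn V + b * limn U.
  by apply/cvg_lim => //; apply: cvgD; apply: cvgMr.
by [].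
Qed.

(** Convergence is asked of the scaled series; since k != 0 it passes to the
    other. *)
Lemma csumZ_neq0 (k : R[i]) (u : nat -> R[i]) : k != 0 ->
  ccvg (fun j => k * u j) -> csum (fun j => k * u j) = k * csum u.
Proof.
move=> k0 ku; have := csumZ k^-1 ku.
have -> : (fun j => k^-1 * (k * u j)) = u by apply/funext => j; rewrite mulKf.
by move=> ->; rewrite mulVKf.
Qed.

Lemma cintegralZ (D : set R) (k : R[i]) (g : R -> R[i]) :
  measurable (D : set (measurableTypeR R)) -> cintegrable D g ->
  cintegrable D (fun t => k * g t) /\
  cintegral D (fun t => k * g t) = k * cintegral D g.
Proof.
move=> mD; case: k => p q [gr gi].
have i1 : cintegrable D (fun t => (p +i* q) * g t).
  split.
    have := integrable_EFinB mD (integrable_EFinZ mD p gr) (integrable_EFinZ mD q gi).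
    by apply: eq_integrable => // t _ /=; case: (g t).
  have := integrable_EFinD mD (integrable_EFinZ mD p gi) (integrable_EFinZ mD q gr).
  by apply: eq_integrable => // t _ /=; case: (g t).
split=> //; rewrite !cintegralE//.
transitivity (Rintegral mu D (fun t => p * complex.Re (g t) - q * complex.Im (g t)) +i*
   Rintegral mu D (fun t => p * complex.Im (g t) + q * complex.Re (g t))).
  by congr (_ +i* _); congr Rintegral; apply/funext => t; case: (g t).
rewrite RintegralB ?RintegralD//; try exact: integrable_EFinZ.
by rewrite !RintegralZl.
Qed.

Lemma csum_cintegral (D : set R) (f : nat -> R -> R[i]) (h : nat -> R -> R) (K : R) :
  measurable D -> (forall k, cintegrable D (f k)) ->
  (forall k, mu.-integrable D (EFin \o h k)) ->
  (forall k t, D t -> normc (f k t) <= h k t) ->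
  (forall N, \sum_(0 <= k < N) Rintegral mu D (h k) <= K) ->
  (forall t, D t -> cvgn (series (h ^~ t))) ->
  [/\ cintegrable D (fun t => csum (f ^~ t)),
    ccvg (fun k => cintegral D (f k)) &
    csum (fun k => cintegral D (f k)) = cintegral D (fun t => csum (f ^~ t))].
Proof.
move=> mD fi hi fh hK hc.
have fhr k t : D t -> `|complex.Re (f k t)| <= h k t.
  by move=> Dt; apply: le_trans (fh k t Dt); exact: norm_Re_le.
have fhi k t : D t -> `|complex.Im (f k t)| <= h k t.
  by move=> Dt; apply: le_trans (fh k t Dt); exact: norm_Im_le.
have mD' : measurable (D : set (measurableTypeR R)) := mD.
have [ir cr] := integral_series mD' (f := fun k t => complex.Re (f k t)) (fun k => (fi k).1) hi fhr hK hc.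
have [ii ci] := integral_series mD' (f := fun k t => complex.Im (f k t)) (fun k => (fi k).2) hi fhi hK hc.
have F : cintegrable D (fun t => csum (f ^~ t)) by [].
have eR : (fun k => complex.Re (cintegral D (f k))) =
    (fun k => Rintegral mu D (fun t => complex.Re (f k t))).
  by apply/funext => k; rewrite cintegralE.
have eI : (fun k => complex.Im (cintegral D (f k))) =
    (fun k => Rintegral mu D (fun t => complex.Im (f k t))).
  by apply/funext => k; rewrite cintegralE.
split=> //.
  by rewrite /ccvg eR eI; split; apply/cvg_ex; eexists; [exact: cr|exact: ci].
rewrite (cintegralE F) /csum eR eI.
by congr (_ +i* _); apply/cvg_lim.
Qed.

End ComplexSeries.

(** * Termwise integration of the Hurwitz-Lerch series *)
Section Swap.
Context {R : realType}.
Implicit Types (x y m t : R) (z s a w : R[i]).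
Local Notation mu := (@lebesgue_measure R).
Local Notation posR := `]0%R : R, +oo[%classic.
Local Notation normc := (@ComplexField.Normc.normc R).

Lemma Rintegral_Gamma_scale x m : 0 < x -> 0 < m ->
  Rintegral mu posR (fun t => expR ((x - 1) * ln t - m * t)) =
  expR (- (x * ln m)) * rGamma x.
Proof.
move=> x0 m0; have p0 : `|0 : R| < pi / 2 by rewrite normr0 divr_gt0 ?pi_gt0.
have := gker_rotate 0 (ln m) 0 x0 p0.
rewrite lnK ?posrE// cos0 sin0 mulr1 !mulr0 mul0r !addr0 subr0 -rGammaE => <-.
rewrite !gker00 mulrA -expRD addNr expR0 mul1r//.
Qed.

Lemma cexp_natmul w (k : nat) : cexp (w * k%:R) = cexp w ^+ k.
Proof.
elim: k => [|k IH]; first by rewrite mulr0 cexp0 expr0.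
by rewrite -natr1 mulrDr mulr1 cexpD IH exprSr.
Qed.

Lemma ln_addn_ge a (k : nat) : 0 < complex.Re a ->
  ln (Num.min (complex.Re a) 1) + ln k.+1%:R <= ln (complex.Re a + k%:R).
Proof.
move=> a0; set al := complex.Re a; have m0 : 0 < Num.min al 1 by rewrite lt_min a0 ltr01.
rewrite -lnM ?posrE// ler_ln ?posrE ?mulr_gt0// ?ltr_wpDr//.
have h1 : Num.min al 1 <= al by rewrite ge_min lexx.
have h2 : Num.min al 1 <= 1 by rewrite ge_min lexx orbT.
rewrite -natr1 mulrDr mulr1 addrC lerD//.
by rewrite -[leRHS]mul1r ler_wpM2r.
Qed.

Lemma expR_decay x t : 0 < x -> 0 < t -> exists2 C, 0 <= C &
  forall k : nat, expR (- (k%:R * t)) <= C * expR (- (x * ln k.+1%:R)).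
Proof.
move=> x0 t0; exists (expR (t + x * (ln (x / t) - 1))) => [|k]; first exact: expR_ge0.
rewrite -expRD ler_expR.
have k0 : 0 < k.+1%:R :> R by [].
have := ln_sub_linear_le x0 t0 k0; rewrite -natr1 mulrDr mulr1; lra.
Qed.

(** The k-th term integrates to [Gamma(s) c k z ^ k / (k + a) ^ s], and the integral
    of its norm is at most a constant times [|c k z ^ k| (k + 1) ^ (- Re s)]. *)
Lemma hurwitz_swap (c : nat -> R[i]) z s a (K : R) :
  0 < complex.Re s -> 0 < complex.Re a ->
  (forall N, \sum_(0 <= k < N)
     normc (c k * z ^+ k) * expR (- (complex.Re s * ln k.+1%:R)) <= K) ->
  let F t := cpow t%:C (s - 1) * cexp (- (a * t%:C)) *
     csum (fun k => c k * (z * cexp (- t%:C)) ^+ k) in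
  cintegrable posR F /\
  csum (fun k => c k * (z ^+ k / cpow (k%:R + a) s)) =
    (cGamma s)^-1 * cintegral posR F.
Proof.
move=> s0 a0 hK F.
pose x := complex.Re s; pose al := complex.Re a.
pose d k := normc (c k * z ^+ k).
have d0 k : 0 <= d k by exact: normc_ge0.
have ak k : 0 < complex.Re (a + k%:R) by rewrite Re_addn ltr_wpDr.
pose f k t := c k * z ^+ k * (cpow t%:C (s - 1) * cexp (- ((a + k%:R) * t%:C))).
pose h k t := d k * expR ((x - 1) * ln t - (al + k%:R) * t).
have mp : measurable (posR : set (measurableTypeR R)) by exact: measurable_itv.
have fi0 k := (cintegral_power s0 (ak k)).1.
have x1 : -1 < x - 1 by rewrite ltrBrDr addNr.
have alk k : 0 < al + k%:R by have := ak k; rewrite Re_addn.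
have hi k : mu.-integrable posR (EFin \o h k).
  by apply: integrable_EFinZ => //; exact: integrable_exp_ln.
have fi k := (cintegralZ (c k * z ^+ k) mp (fi0 k)).1.
have fE k := (cintegralZ (c k * z ^+ k) mp (fi0 k)).2.
have fh k t : posR t -> normc (f k t) <= h k t.
  move=> /posR_gt0 t0; rewrite /f normcM -/(d k) /h ler_wpM2l//.
  rewrite /cpow clog_gt0// -cexpD normc_cexp ler_expR.
  rewrite natr_complex /al /x le_eqVlt; apply/orP; left; apply/eqP.
  by case: s a {s0 a0 hK F x al ak f h fi0 x1 alk hi fi fE} => [s1 s2] [a1 a2]/=; ring.
pose B := expR (- (x * ln (Num.min al 1))).
have hK' N : \sum_(0 <= k < N) Rintegral mu posR (h k) <= K * (B * rGamma x).
  apply: (@le_trans _ _ (\sum_(0 <= k < N)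
     (normc (c k * z ^+ k) * expR (- (x * ln k.+1%:R))) * (B * rGamma x))).
    apply: ler_sum => k _; rewrite /h.
    rewrite RintegralZl//; last exact: integrable_exp_ln.
    rewrite Rintegral_Gamma_scale// -mulrA ler_wpM2l// !mulrA ler_wpM2r//.
      by rewrite ltW// rGamma_gt0.
    rewrite -expRD ler_expR -opprD lerN2 -mulrDr ler_wpM2l ?(ltW s0)//.
    by rewrite addrC ln_addn_ge.
  by rewrite -mulr_suml ler_wpM2r ?hK// mulr_ge0 ?expR_ge0// ltW// rGamma_gt0.
have hc t : posR t -> cvgn (series (h ^~ t)).
  move=> /posR_gt0 t0.
  have [C C0 Ck] := expR_decay s0 t0.
  apply: (@cvgn_nneg_bounded _ _ (expR ((x - 1) * ln t - al * t) * C * K)).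
    by move=> k; rewrite mulr_ge0// expR_ge0.
  move=> N; rewrite /series/=.
  apply: le_trans (ler_wpM2l _ (hK N)); last by rewrite mulr_ge0// expR_ge0.
  rewrite mulr_sumr; apply: ler_sum => k _.
  rewrite /h (mulrDl al) opprD addrA expRD -/(d k).
  rewrite [leLHS]mulrCA -!mulrA ler_wpM2l ?expR_ge0//.
  by rewrite mulrCA ler_wpM2l// Ck.
have [I1 I2 I3] := csum_cintegral mp fi hi fh hK' hc.
have FE t : posR t -> csum (f ^~ t) = F t.
  move=> pt; have t0 := posR_gt0 pt.
  have k0 : cpow t%:C (s - 1) * cexp (- (a * t%:C)) != 0 by rewrite mulf_neq0// cexp_neq0.
  have e : (f ^~ t) = fun k => cpow t%:C (s - 1) * cexp (- (a * t%:C)) *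
      (c k * (z * cexp (- t%:C)) ^+ k).
    apply/funext => k; rewrite /f exprMn -cexp_natmul.
    rewrite mulrDl opprD cexpD mulNr (mulrC k%:R t%:C); ring.
  rewrite e csumZ_neq0// -e; split.
    apply: (@normed_cvg R R (fun k => complex.Re (f k t))).
    apply: (series_le_cvg _ _ _ (hc t pt)) => k //=.
      by apply: le_trans (fh k t pt); exact: normc_ge0.
    by apply: le_trans (fh k t pt); exact: norm_Re_le.
  apply: (@normed_cvg R R (fun k => complex.Im (f k t))).
  apply: (series_le_cvg _ _ _ (hc t pt)) => k //=.
    by apply: le_trans (fh k t pt); exact: normc_ge0.
  by apply: le_trans (fh k t pt); exact: norm_Im_le.
split; first by apply: eq_cintegrable I1.
rewrite -(eq_cintegral (f := fun t => csum (f ^~ t)) mp FE) -I3 -csumZ//.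
congr csum; apply/funext => k.
rewrite fE (cintegral_power s0 (ak k)).2 (addrC a).
by rewrite [RHS]mulrCA mulKf ?cGamma_neq0// mulrA.
Qed.

End Swap.

(** * Growth of Pochhammer symbols *)
Section Growth.
Context {R : realType}.
Implicit Types (x y t q r : R) (z g : R[i]).
Local Notation lnS k := (@ln R k.+1%:R).
Local Notation normc := (@ComplexField.Normc.normc R).

Lemma ratio_succ (k : nat) : k.+1%:R / k.+2%:R = 1 + - k.+2%:R^-1 :> R.
Proof.
have n0 : k.+2%:R != 0 :> R by [].
by apply: (mulIf n0); rewrite divfK// mulrDl mul1r mulNr mulVf// -[k.+2%:R]natr1 addrK.
Qed.

Lemma harmonic_ln (n : nat) :
  lnS n <= \sum_(0 <= k < n) k.+1%:R^-1 <= 1 + lnS n.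
Proof.
have step (k : nat) : lnS k.+1 - lnS k <= k.+1%:R^-1 :> R.
  rewrite -ln_div ?posrE// -addn1 natrD mulrDl divff// mul1r.
  by apply: le_ln1Dx; rewrite (@lt_trans _ _ 0)// ?invr_gt0// oppr_lt0.
have step' (k : nat) : k.+2%:R^-1 <= lnS k.+1 - lnS k :> R.
  rewrite -opprB -ln_div ?posrE// lerNr.
  have -> : k.+1%:R / k.+2%:R = 1 + - k.+2%:R^-1 :> R.
    exact: ratio_succ.
  by apply: le_ln1Dx; rewrite ltrN2 invf_lt1// ltr1n.
apply/andP; split.
  elim: n => [|n IH]; first by rewrite big_nil ln1.
  by rewrite big_nat_recr//= -(subrK (lnS n) (lnS n.+1)) addrC lerD.
suff up : \sum_(0 <= k < n.+1) k.+1%:R^-1 <= 1 + lnS n :> R.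
  by apply: le_trans up; rewrite big_nat_recr//= lerDl invr_ge0.
elim: n => [|n IH]; first by rewrite big_nat1 ln1 invr1 addr0.
rewrite big_nat_recr//= -(subrK (lnS n) (lnS n.+1)) [_ - _ + _]addrC addrA.
by rewrite lerD.
Qed.

Lemma sum_inv_sqr (n : nat) : \sum_(0 <= k < n) k.+1%:R ^- 2 <= 2 :> R.
Proof.
suff h : \sum_(0 <= k < n.+1) k.+1%:R ^- 2 <= 2 - n.+1%:R^-1 :> R.
  apply: le_trans (le_trans h _); last by rewrite lerBlDr lerDl invr_ge0.
  by rewrite big_nat_recr//= lerDl invr_ge0 exprn_ge0.
elim: n => [|n IH]; first by rewrite big_nat1 expr1n invr1; lra.
rewrite big_nat_recr//=; apply: le_trans (lerD IH (lexx _)) _.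
have n0 : 0 < n.+1%:R :> R by [].
have e : n.+2%:R = n.+1%:R + 1 :> R by rewrite natr1.
rewrite e; set a := n.+1%:R in n0 *.
rewrite -subr_ge0.
have -> : 2 - (a + 1)^-1 - (2 - a^-1 + (a + 1) ^- 2) = (a * (a + 1) ^+ 2)^-1.
  by field; rewrite !lt0r_neq0// addr_gt0.
by rewrite invr_ge0 mulr_ge0 ?ltW// exprn_gt0// addr_gt0.
Qed.

(** With [g = x + i y], the squared norm of [(g + k) / (k + 1)] is
    [1 + 2 (x - 1) / (k + 1) + Q / (k + 1) ^ 2]. Bounding 1 + u by exp u turns the
    product into the exponential of a harmonic sum plus a bounded one. *)
Lemma pochhammer_growth g : exists2 C, 0 <= C &
  forall n : nat, normc (pochhammer g n) / n`!%:R <=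
    C * expR ((complex.Re g - 1) * lnS n).
Proof.
case: g => x y /=; pose Q := (x - 1) ^+ 2 + y ^+ 2.
have Q0 : 0 <= Q by rewrite addr_ge0// sqr_ge0.
pose H (n : nat) : R := \sum_(0 <= k < n) k.+1%:R^-1.
pose S (n : nat) : R := \sum_(0 <= k < n) k.+1%:R ^- 2.
have key n : (normc (pochhammer (x +i* y) n) / n`!%:R) ^+ 2 <=
    expR (2 * (x - 1) * H n + Q * S n).
  elim: n => [|n IH].
    rewrite /pochhammer big_ord0 /H /S !big_nil !mulr0 addr0 expR0.
    by rewrite normcE/= expr1n expr0n addr0 sqrtr1 divr1 expr1n.
  rewrite /pochhammer big_ord_recr/= -/(pochhammer _ n) normcM factS natrM.
  rewrite (mulrC n.+1%:R) invfM mulrACA exprMn.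
  rewrite /H /S !big_nat_recr//= -/(H n) -/(S n) (mulrDr (2 * (x - 1))) (mulrDr Q) addrACA expRD.
  rewrite ler_pM ?sqr_ge0//.
  rewrite natr_complex; simpc; rewrite exprMn sqr_sqrtr ?addr_ge0 ?sqr_ge0//.
  apply: le_trans _ (expR_ge1Dx _); rewrite le_eqVlt; apply/orP; left; apply/eqP.
  rewrite /Q -natr1; set a := n%:R.
  have a0 : a + 1 != 0 by rewrite /a natr1 pnatr_eq0.
  by field.
exists (expR (`|x - 1| + Q)) => [|n]; first exact: expR_ge0.
rewrite -expRD -(@ler_pXn2r _ 2)// ?nnegrE ?expR_ge0//.
  apply: le_trans (key n) _; rewrite -expRM_natl ler_expR.
  have /andP[h1 h2] := harmonic_ln n.
  have h3 : Q * S n <= Q * 2 by rewrite ler_wpM2l// sum_inv_sqr.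
  have : (x - 1) * H n <= `|x - 1| + (x - 1) * lnS n.
    rewrite -lerBlDr -mulrBr; apply: le_trans (ler_norm _) _.
    rewrite normrM ler_piMr// ger0_norm ?subr_ge0//.
    by rewrite /H lerBlDr.
  by move: h3; set L := ln _; move: (H n) (S n) => a b; lra.
by rewrite divr_ge0// normc_ge0.
Qed.

(** Comparison with the telescoping differences of k ^ (1 - q). *)
Lemma pseries_bounded q : 1 < q -> exists K, forall N : nat,
  \sum_(0 <= k < N) expR (- (q * lnS k)) <= K.
Proof.
move=> q1; pose e := q - 1; have e0 : 0 < e by rewrite subr_gt0.
have step (k : nat) : expR (- (q * lnS k.+1)) <=
    e^-1 * (expR (- (e * lnS k)) - expR (- (e * lnS k.+1))).
  have h : e / k.+2%:R <= e * (lnS k.+1 - lnS k).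
    rewrite ler_wpM2l ?(ltW e0)// -opprB -ln_div ?posrE// lerNr.
    have -> : k.+1%:R / k.+2%:R = 1 + - k.+2%:R^-1 :> R.
      exact: ratio_succ.
    by apply: le_ln1Dx; rewrite ltrN2 invf_lt1// ltr1n.
  have -> : - (e * lnS k) = - (e * lnS k.+1) + e * (lnS k.+1 - lnS k).
    by ring.
  have -> : - (q * lnS k.+1) = - (e * lnS k.+1) + - lnS k.+1 by rewrite /e; ring.
  rewrite !expRD (expRN (lnS k.+1)) lnK ?posrE//.
  rewrite [leRHS]mulrC ler_pdivlMr//.
  rewrite -[X in _ - X]mulr1 -mulrBr -mulrA ler_wpM2l ?expR_ge0//.
  rewrite mulrC lerBrDl.
  by apply: le_trans _ (expR_ge1Dx _); rewrite lerD2l.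
exists (1 + e^-1) => N.
suff h n : \sum_(0 <= k < n.+1) expR (- (q * lnS k)) <=
   1 + e^-1 * (1 - expR (- (e * lnS n))).
  apply: le_trans (_ : _ <= \sum_(0 <= k < N.+1) expR (- (q * lnS k))) _.
    by rewrite big_nat_recr//= lerDl expR_ge0.
  apply: le_trans (h N) _.
  by rewrite lerD2l ler_piMr ?invr_ge0 ?(ltW e0)// lerBlDr lerDl expR_ge0.
elim: n => [|n IH].
  by rewrite big_nat1 ln1 !mulr0 oppr0 expR0 subrr mulr0 addr0.
rewrite big_nat_recr//=; apply: le_trans (lerD IH (step n)) _.
by rewrite -addrA -mulrDr addrA subrK.
Qed.

End Growth.

(** * Decay of beta-type integrals *)
Section BetaDecay.
Context {R : realType}.
Implicit Types (t q C : R) (x y : R[i]).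
Local Notation mu := (@lebesgue_measure R).
Local Notation I01 := (`]0%R : R, 1%R[%classic).
Local Notation normc := (@ComplexField.Normc.normc R).

Lemma I01P t : I01 t -> 0 < t < 1.
Proof. by rewrite /= in_itv. Qed.

Lemma normc_real t : normc t%:C = `|t|.
Proof. by rewrite normcE/= expr0n addr0 sqrtr_sqr. Qed.

Lemma normc0 : normc 0 = 0.
Proof. by rewrite (normc_real 0) normr0. Qed.

Lemma normc_cintegral_le (D : set R) (f : R -> R[i]) : measurable D ->
  cintegrable D f -> normc (cintegral D f) <=
    Rintegral mu D (fun t => `|complex.Re (f t)|) +
    Rintegral mu D (fun t => `|complex.Im (f t)|).
Proof.
move=> mD fi; rewrite cintegralE//; apply: le_trans (normc_le _) _.
by apply: lerD; apply: le_normr_Rintegral => //; [exact: fi.1|exact: fi.2].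
Qed.

(** If f n0 is integrable it dominates all later f k, and only finitely many indices
    come before; an f k that is not integrable has integral 0. *)
Lemma cintegral_shrink_bounded (f : nat -> R -> R[i]) :
  (forall (k : nat) t, 0 < t < 1 -> f k.+1 t = t%:C * f k t) ->
  exists2 M, 0 <= M & forall k, normc (cintegral I01 (f k)) <= M.
Proof.
move=> fS.
have [[n0 fn0]|nint] := pselect (exists k, cintegrable I01 (f k)); last first.
  exists 0 => // k; rewrite /cintegral asboolF ?normc0//.
  by apply: contra_not nint => ?; exists k.
have mI : measurable (I01 : set (measurableTypeR R)) by exact: measurable_itv.
pose J := Rintegral mu I01 (fun t => `|complex.Re (f n0 t)|) +
    Rintegral mu I01 (fun t => `|complex.Im (f n0 t)|).
have J0 : 0 <= J by rewrite addr_ge0// Rintegral_ge0.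
exists (\sum_(k < n0) normc (cintegral I01 (f k)) + J).
  by rewrite addr_ge0// sumr_ge0// => k _; exact: normc_ge0.
move=> k; case: (ltnP k n0) => kn.
  rewrite (bigD1 (Ordinal kn))//= -addrA lerDl addr_ge0// sumr_ge0// => i _.
  exact: normc_ge0.
have [fk|fk] := pselect (cintegrable I01 (f k)); last first.
  rewrite /cintegral asboolF// normc0 addr_ge0// sumr_ge0// => i _; exact: normc_ge0.
rewrite -[leLHS]add0r lerD//; first by rewrite sumr_ge0// => i _; exact: normc_ge0.
apply: le_trans (normc_cintegral_le mI fk) _.
have fE t : 0 < t < 1 -> exists2 r, 0 <= r <= 1 & f k t = r%:C * f n0 t.
  move=> t01; rewrite -(subnK kn); elim: (k - n0)%N => [|j [r r01 IH]].
    by exists 1; rewrite ?ler01 ?lexx// mul1r.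
  exists (t * r); last by rewrite addSn fS// IH mulrA rmorphM.
  case/andP: t01 => t0 t1; case/andP: r01 => r0 r1.
  by rewrite mulr_ge0 ?(ltW t0)//= mulr_ile1// ltW.
apply: lerD; apply: le_Rintegral => //.
- exact: integrable_norm fk.1.
- exact: integrable_norm fn0.1.
- move=> t /I01P /fE [r /andP[r0 r1] ->]; case: (f n0 t) => a b /=.
  by rewrite mul0r subr0 normrM ger0_norm// ler_piMl.
- exact: integrable_norm fk.2.
- exact: integrable_norm fn0.2.
- move=> t /I01P /fE [r /andP[r0 r1] ->]; case: (f n0 t) => a b /=.
  by rewrite mul0r addr0 normrM ger0_norm// ler_piMl.
Qed.

Lemma normc_cintegral_sup (f : R -> R[i]) C : 0 <= C ->
  (forall t, 0 < t < 1 -> normc (f t) <= C) -> normc (cintegral I01 f) <= 2 * C.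
Proof.
move=> C0 fC.
have [fi|fi] := pselect (cintegrable I01 f); last first.
  by rewrite /cintegral asboolF// normc0 mulr_ge0.
have mI : measurable (I01 : set (measurableTypeR R)) by exact: measurable_itv.
apply: le_trans (normc_cintegral_le mI fi) _.
have ci : mu.-integrable I01 (EFin \o cst C).
  apply: measurable_bounded_integrable => //.
    by rewrite /= lebesgue_measure_itv/= lte_fin ltr01 -EFinB ltry.
  exact: bounded_cst.
have cE : Rintegral mu I01 (cst C) = C.
  by rewrite Rintegral_cst//= lebesgue_measure_itv/= lte_fin ltr01/= subr0 mulr1.
rewrite mulrDl mul1r -[X in _ <= X + _]cE -[X in _ <= _ + X]cE.
apply: lerD; apply: le_Rintegral => //.
- exact: integrable_norm fi.1.
- by move=> t /I01P /fC; apply: le_trans; exact: norm_Re_le.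
- exact: integrable_norm fi.2.
- by move=> t /I01P /fC; apply: le_trans; exact: norm_Im_le.
Qed.

(** The logarithmic form of t ^ k (1 - t) ^ q = O(k ^ (- q)). *)
Lemma pow_mul_le (k : nat) q t : 0 < q -> 0 < t < 1 ->
  k%:R * ln t + q * ln (1 - t) <= 1 - q + q * ln q - q * ln k.+1%:R.
Proof.
move=> q0 /andP[t0 t1]; pose h := 1 - t; have h0 : 0 < h by rewrite subr_gt0.
have h1 : h <= 1 by rewrite lerBlDr lerDl ltW.
have l1 : ln t <= - h.
  by have := @le_ln1Dx R (- h); rewrite subKr; apply; rewrite ltrN2 ltrBlDr ltrDl.
have k0 : 0 < k.+1%:R :> R by [].
have l2 : ln h <= h * k.+1%:R / q - 1 + ln q - ln k.+1%:R.
  have := @le_ln1Dx R (h * k.+1%:R / q - 1); rewrite subrKC ln_div ?posrE// ?mulr_gt0//.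
  rewrite lnM ?posrE// => H; rewrite lerBrDr -lerBlDr; apply: H.
  by rewrite ltrBrDr addNr divr_gt0// mulr_gt0.
have := ler_wpM2l (ltW q0) l2; have := ler_wpM2l (ler0n R k) l1.
have -> : q * (h * k.+1%:R / q - 1 + ln q - ln k.+1%:R) =
   h * k.+1%:R - q + q * ln q - q * ln k.+1%:R by field; exact: lt0r_neq0.
have -> : h * k.+1%:R = h * k%:R + h by rewrite -natr1 mulrDr mulr1.
rewrite -/h; set L := ln k.+1%:R; set K := k%:R; set a := K * ln t.
by set b := q * ln h; move: L K a b => L K a b H1 H2; lra.
Qed.

(** A shift of the index by a costs at most a factor a + 1 in power decay. *)
Lemma ltn_mul_sub (a k : nat) : (a <= k)%N -> (k < a.+1 * (k - a).+1)%N.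
Proof. by move=> ak; rewrite mulSn mulnS; move: (a * (k - a))%N => b; lia. Qed.

Lemma cpowS t x : 0 < t -> cpow t%:C (x + 1) = t%:C * cpow t%:C x.
Proof.
move=> t0; have {2}-> : t%:C = cexp (clog t%:C).
  by rewrite clog_gt0// cexpE cos0 sin0 lnK ?posrE// mulr1 mulr0.
by rewrite /cpow -cexpD mulrDl mul1r addrC.
Qed.

(** For k beyond |Re x - 1| the integrand itself is O(k ^ (- (Re y - 1))) uniformly
    in t; the finitely many other integrals fall under cintegral_shrink_bounded. *)
Lemma beta_terms_decay x y (E : R -> R[i]) M : 1 < complex.Re y ->
  (forall t, 0 < t < 1 -> normc (E t) <= M) ->
  exists2 C, 0 <= C & forall k : nat,
    normc (cintegral I01 (fun t =>
      cpow t%:C (x + k%:R - 1) * cpow (1 - t)%:C (y - 1) * E t)) <=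
    C * expR (- ((complex.Re y - 1) * ln k.+1%:R)).
Proof.
set q := complex.Re y - 1; rewrite -subr_gt0 -/q => q0 EM.
pose f (k : nat) t := cpow t%:C (x + k%:R - 1) * cpow (1 - t)%:C (y - 1) * E t.
have M0 : 0 <= M.
  have h : 0 < (2^-1 : R) < 1 by rewrite invr_gt0 ltr0n invf_lt1// ltr1n.
  exact: le_trans (normc_ge0 _) (EM _ h).
have fS (k : nat) t : 0 < t < 1 -> f k.+1 t = t%:C * f k t.
  move=> /andP[t0 _]; rewrite /f.
  have -> : x + k.+1%:R - 1 = x + k%:R - 1 + 1 by rewrite -natr1; ring.
  by rewrite cpowS// !mulrA.
have [B B0 fB] := cintegral_shrink_bounded fS.
have fN k t : 0 < t < 1 -> normc (f k t) <=
   M * expR ((complex.Re x - 1) * ln t + (k%:R * ln t + q * ln (1 - t))).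
  move=> t01; case/andP: (t01) => t0 t1.
  rewrite /f normcM mulrC ler_pM ?normc_ge0// ?EM//.
  rewrite /cpow !clog_gt0// ?subr_gt0// -cexpD normc_cexp ler_expR /q.
  rewrite natr_complex le_eqVlt; apply/orP; left; apply/eqP.
  by case: x y {q q0 f fS fB} => [x1 x2] [y1 y2]/=; ring.
pose n1 := (Num.truncn `|complex.Re x - 1|).+1.
have n1x : - n1%:R <= complex.Re x - 1.
  rewrite lerNl; apply: le_trans (ltW (truncnS_gt _)).
  by rewrite -normrN ler_norm.
pose A := expR (1 - q + q * ln q).
have f1 k t : (n1 <= k)%N -> 0 < t < 1 ->
   normc (f k t) <= M * A * expR (- (q * ln (k - n1).+1%:R)).
  move=> kn t01; apply: le_trans (fN k t t01) _; rewrite -mulrA ler_wpM2l// /A -expRD.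
  rewrite ler_expR; apply: le_trans (pow_mul_le (k - n1) q0 t01).
  rewrite addrA lerD2r -mulrDl; case/andP: t01 => t0 t1.
  rewrite ler_wnM2r ?ln_le0 ?(ltW t1)// natrB//; lra.
have lnle (k : nat) : ln k.+1%:R <= ln (n1.+1%:R : R) + ln (k - n1).+1%:R.
  rewrite -lnM ?posrE// ler_ln ?posrE ?mulr_gt0// -natrM ler_nat.
  case: (leqP n1 k) => kn; last first.
    by rewrite (leq_trans kn)// (leq_trans (leqnSn _))// leq_pmulr.
  exact: ltn_mul_sub.
exists ((B + 2 * (M * A)) * expR (q * ln n1.+1%:R)).
  by rewrite mulr_ge0 ?expR_ge0// addr_ge0// !mulr_ge0// expR_ge0.
move=> k; rewrite -/(f k) -mulrA -expRD.
set w := expR _.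
have wE : expR (- (q * ln (k - n1).+1%:R)) <= w.
  rewrite ler_expR; have := ler_wpM2l (ltW q0) (lnle k); rewrite mulrDr.
  by set u := q * _; set v := q * _; set v' := q * _; move: u v v' => u v v'; lra.
have w0 : 0 <= w by exact: expR_ge0.
have MA : 0 <= M * A by rewrite mulr_ge0 ?expR_ge0.
case: (leqP n1 k) => kn.
  have C0 : 0 <= M * A * expR (- (q * ln (k - n1).+1%:R)) by rewrite mulr_ge0 ?expR_ge0.
  apply: le_trans (normc_cintegral_sup C0 (fun t => f1 k t kn)) _.
  rewrite [leRHS]mulrDl -[leLHS]add0r; apply: lerD; first exact: mulr_ge0.
  by rewrite -[leRHS]mulrA ler_wpM2l// ler_wpM2l.
have w1 : 1 <= w.
  apply: le_trans wE; move: kn; rewrite -subn_eq0 => kn.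
  by rewrite (eqP (_ : (k - n1 == 0)%N)) ?ln1 ?mulr0 ?oppr0 ?expR0//; lia.
apply: le_trans (fB k) _; rewrite mulrDl -[leLHS]addr0 lerD//.
  by rewrite ler_peMr.
by rewrite !mulr_ge0// expR_ge0.
Qed.

End BetaDecay.

(** * Combining growth and decay rates *)
Section Summability.
Context {R : realType}.
Implicit Types (t q r C M : R) (g z s : R[i]).
Local Notation normc := (@ComplexField.Normc.normc R).

Lemma normcV z : normc z^-1 = (normc z)^-1.
Proof. exact: ComplexField.Normc.normcV. Qed.

(** The exponents Re g - 1, - q and - Re s of k add up to less than - 1. *)
Lemma terms_summable g s z (b : nat -> R[i]) (B : R[i]) C q : 0 <= C ->
  (forall k : nat, normc (b k * z ^+ k) <= C * expR (- (q * ln k.+1%:R))) ->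
  complex.Re g < q + complex.Re s ->
  exists K, forall N : nat, \sum_(0 <= k < N)
    normc (pochhammer g k * (b k / B) / k`!%:R * z ^+ k) *
      expR (- (complex.Re s * ln k.+1%:R)) <= K.
Proof.
move=> C0 bC qs; have [D D0 gD] := pochhammer_growth g.
have [K KP] := @pseries_bounded R (q + complex.Re s - complex.Re g + 1)
  (ltac:(rewrite ltrDr subr_gt0; exact: qs)).
pose A := C * D / normc B.
have A0 : 0 <= A by rewrite divr_ge0 ?mulr_ge0 ?normc_ge0.
exists (A * K) => N; apply: le_trans (ler_wpM2l A0 (KP N)).
rewrite mulr_sumr; apply: ler_sum => k _.
have -> : pochhammer g k * (b k / B) / k`!%:R * z ^+ k =
    (pochhammer g k / k`!%:R) * (b k * z ^+ k) / B by rewrite !mulrA; ring.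
rewrite !normcM !normcV -normcM (natr_complex k`!) normc_real.
rewrite (ger0_norm (ler0n R k`!)).
set L := ln _.
have -> : - ((q + complex.Re s - complex.Re g + 1) * L) =
   (complex.Re g - 1) * L + (- (q * L) + - (complex.Re s * L)) by ring.
rewrite !expRD /A.
set e1 := expR _; set e2 := expR _; set e3 := expR _.
have -> : C * D / normc B * (e2 * (e3 * e1)) = D * e2 * (C * e3) / normc B * e1 by ring.
rewrite ler_wpM2r ?expR_ge0// ler_wpM2r ?invr_ge0 ?normc_ge0//.
by rewrite ler_pM ?divr_ge0 ?normc_ge0// ?gD.
Qed.

Lemma geometric_decay z M q (b : nat -> R[i]) : 0 <= M -> normc z < 1 ->
  (forall k, normc (b k) <= M) -> 0 < q ->
  exists2 C, 0 <= C &
    forall k : nat, normc (b k * z ^+ k) <= C * expR (- (q * ln k.+1%:R)).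
Proof.
move=> M0 z1 bM q0.
pose r := Num.max (normc z) 2^-1.
have r0 : 0 < r by rewrite lt_max invr_gt0 ltr0n orbT.
have r1 : r < 1 by rewrite gt_max z1 invf_lt1// ltr1n.
have t0 : 0 < - ln r by rewrite oppr_gt0 ln_lt0// r0.
have [C C0 CP] := expR_decay q0 t0.
exists (M * C) => [|k]; first exact: mulr_ge0.
rewrite normcM normcX -mulrA ler_pM ?normc_ge0 ?exprn_ge0 ?normc_ge0//.
apply: le_trans (CP k); rewrite mulrN opprK expRM_natl lnK ?posrE//.
by rewrite lerXn2r ?nnegrE ?normc_ge0 ?(ltW r0)// le_max lexx.
Qed.

End Summability.

(** * Gauss's limit for the gamma function *)
Section Gauss.
Context {R : realType}.
Implicit Types (t a al : R) (N : nat).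

Lemma rGamma1 : rGamma (1 : R) = 1.
Proof.
rewrite /rGamma; pose F t := - expR (- t).
have e : (fun t => expR ((1 - 1) * ln t - t)) = (fun t => expR (- t)).
  by apply/funext => t; rewrite subrr mul0r sub0r.
have i1 := @integrable_Gamma R 1 ltr01; rewrite e.
have d t : is_derive t 1 F (expR (- t)).
  pose G : R -> R := - (expR \o (- id)).
  rewrite -[F]/G; apply: is_derive_eq.
  by rewrite /= mulrN1 opprK.
transitivity (0 - (- 1) : R); last by rewrite sub0r opprK.
apply: (@Rintegral_derive R F) => //.
- move=> t _; apply: continuous_comp; first exact: continuousN.
  exact: continuous_expR.
- by have := i1; congr (integrable _ _ _); apply/funext => t; rewrite subrr mul0r sub0r.
- have -> : -1 = - expR (- 0) :> R by rewrite oppr0 expR0.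
  apply: cvgN; apply: (@cvg_comp _ _ _ (fun n : nat => - (n.+1%:R^-1 : R)) expR).
    by apply: cvgN; exact: cvg_harmonic.
  exact: continuous_expR.
- have -> : 0 = - 0 :> R by rewrite oppr0.
  by apply: cvgN; have := @cvgn_expR R; rewrite -cvg_shiftS.
Qed.

Lemma rGamma_nat N : rGamma N.+1%:R = N`!%:R :> R.
Proof.
elim: N => [|N IH]; first exact: rGamma1.
by rewrite -natr1 rGammaS// IH -natrM.
Qed.

(** Integrate (t / N) ^ al >= 1 + al (1 - N / t) against t ^ N exp (- t). *)
Lemma rGamma_lower N al : (0 < N)%N -> 0 <= al ->
  N`!%:R * expR (al * ln N%:R) <= rGamma (N.+1%:R + al).
Proof.
case: N => // N _ al0; set n := N.+1%:R; have n0 : 0 < n :> R by [].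
have e : N.+2%:R = n + 1 :> R by rewrite natr1.
have [sI sE] := @integral_lin_Gamma R [:: (1 + al, n + 1); (- (al * n), n)]
  (ltac:(by rewrite /= addr_gt0//= n0)).
have E : expR (al * ln n) * \sum_(p <- [:: (1 + al, n + 1); (- (al * n), n)]) p.1 * rGamma p.2 =
   N.+1`!%:R * expR (al * ln n).
  rewrite !big_cons big_nil/= addr0 mulrC; congr (_ * _).
  rewrite -e !rGamma_nat factS natrM -/n; ring.
rewrite -E -sE -RintegralZl//.
apply: le_Rintegral.
- exact: measurable_itv.
- by apply: integrable_EFinZ => //; exact: measurable_itv.
- by apply: integrable_Gamma; rewrite ltr_wpDr.
- move=> t /posR_gt0 t0; rewrite !big_cons big_nil/= addr0 addrK e.
  have -> : (n + 1 + al - 1) * ln t - t = (n * ln t - t) + al * ln t by ring.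
  have -> : (n - 1) * ln t - t = (n * ln t - t) - ln t by ring.
  rewrite !(expRD (n * ln t - t)) expRN lnK ?posrE//.
  set u := expR (n * ln t - t).
  have -> : al * ln t = al * ln n + al * (ln t - ln n) by ring.
  rewrite expRD.
  rewrite [leRHS]mulrCA ler_wpM2l ?expR_ge0//.
  have -> : (1 + al) * u + - (al * n) * (u / t) = u * (1 + al * (1 - n / t)) by ring.
  rewrite ler_wpM2l ?expR_ge0//.
  apply: le_trans _ (expR_ge1Dx _); rewrite lerD2l ler_wpM2l//.
  rewrite -[ln t - ln n]opprB -ln_div ?posrE// lerNr opprB.
  have := @le_ln1Dx R (n / t - 1); rewrite subrKC; apply.
  by rewrite ltrBrDr addNr divr_gt0.
Qed.

(** Integrate (N / t) ^ al >= 1 - al (t / N - 1) against t ^ (N + al) exp (- t). *)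
Lemma rGamma_upper N al : (0 < N)%N -> 0 <= al ->
  rGamma (N.+1%:R + al) * (1 - al * (al + 1) / N%:R) <= N`!%:R * expR (al * ln N%:R).
Proof.
case: N => // N _ al0; set n := N.+1%:R; have n0 : 0 < n :> R by [].
have e : N.+2%:R = n + 1 :> R by rewrite natr1.
have na0 : 0 < n + 1 + al by rewrite ltr_wpDr// addr_gt0.
have [sI sE] := @integral_lin_Gamma R
  [:: (1 + al, n + 1 + al); (- (al / n), n + 1 + al + 1)]
  (ltac:(by rewrite /= na0 addr_gt0)).
have E : \sum_(p <- [:: (1 + al, n + 1 + al); (- (al / n), n + 1 + al + 1)])
   p.1 * rGamma p.2 = rGamma (N.+2%:R + al) * (1 - al * (al + 1) / n).
  rewrite !big_cons big_nil/= addr0 e rGammaS//.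
  by field; exact: lt0r_neq0.
have iN : 0 < N.+2%:R :> R by [].
rewrite -E -sE -rGamma_nat [leRHS]mulrC /rGamma -RintegralZl//; last exact: integrable_Gamma.
apply: le_Rintegral.
- exact: measurable_itv.
- exact: sI.
- by apply: integrable_EFinZ; [exact: measurable_itv|exact: integrable_Gamma].
- move=> t /posR_gt0 t0; rewrite !big_cons big_nil/= addr0 addrK e addrK.
  have -> : (n + 1 + al - 1) * ln t - t = (n * ln t - t) + al * ln t by ring.
  have -> : (n + 1 + al) * ln t - t = (n * ln t - t) + al * ln t + ln t by ring.
  rewrite !(expRD _ (ln t)) !(expRD (n * ln t - t)) lnK ?posrE//.
  set u := expR (n * ln t - t).
  have -> : al * ln n = al * ln t + - (al * (ln t - ln n)) by ring.
  rewrite (expRD (al * ln t)); set v := expR (al * ln t).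
  have -> : (1 + al) * (u * v) + - (al / n) * (u * v * t) =
    v * (u * (1 - al * (t / n - 1))) by ring.
  rewrite -[leRHS]mulrA ler_wpM2l ?expR_ge0// [leRHS]mulrC ler_wpM2l ?expR_ge0//.
  apply: le_trans _ (expR_ge1Dx _); rewrite lerD2l lerN2 ler_wpM2l//.
  rewrite -ln_div ?posrE//.
  have := @le_ln1Dx R (t / n - 1); rewrite subrKC; apply.
  by rewrite ltrBrDr addNr divr_gt0.
Qed.

(** The coefficient of [z ^ N] in [(1 - z) ^ (- a)]. *)
Definition bcoef (a : R) N : R := \prod_(k < N) ((a + k%:R) / k.+1%:R).

Lemma bcoef0 a : bcoef a 0 = 1.
Proof. by rewrite /bcoef big_ord0. Qed.

Lemma bcoefS a N : bcoef a N.+1 = bcoef a N * ((a + N%:R) / N.+1%:R).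
Proof. by rewrite /bcoef big_ord_recr. Qed.

Lemma bcoef_ge0 a N : 0 <= a -> 0 <= bcoef a N.
Proof. by move=> a0; apply: prodr_ge0 => k _; rewrite divr_ge0// addr_ge0. Qed.

Lemma bcoef_Gamma a N : 0 < a -> bcoef a N * (N`!%:R * rGamma a) = rGamma (a + N%:R).
Proof.
move=> a0; elim: N => [|N IH]; first by rewrite bcoef0 !mul1r addr0.
rewrite bcoefS factS natrM -natr1 addrA rGammaS ?ltr_wpDr// -IH natr1.
have : N.+1%:R != 0 :> R by [].
by move: N.+1%:R => n n0; field.
Qed.

(** Gauss's approximation of [1 / Gamma(al + 1)]. *)
Definition gauss_ratio al N : R := bcoef (al + 1) N.+1 * expR (- (al * ln N.+1%:R)).

Lemma gauss_ratio_ge0 al N : 0 <= al -> 0 <= gauss_ratio al N.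
Proof. by move=> al0; rewrite mulr_ge0 ?expR_ge0// bcoef_ge0// addr_ge0. Qed.

Lemma gauss_ratio_ge al N : 0 <= al -> (rGamma (al + 1))^-1 <= gauss_ratio al N.
Proof.
move=> al0; have a0 : 0 < al + 1 by rewrite ltr_wpDl.
have G0 := rGamma_gt0 a0.
rewrite /gauss_ratio expRN ler_pdivlMr ?expR_gt0// mulrC ler_pdivrMr//.
have := @rGamma_lower N.+1 al isT al0.
have -> : N.+2%:R + al = al + 1 + N.+1%:R by rewrite -natr1; ring.
rewrite -bcoef_Gamma// mulrA.
have f0 : 0 < N.+1`!%:R :> R by rewrite ltr0n fact_gt0.
by rewrite [_ * N.+1`!%:R]mulrC -mulrA ler_pM2l.
Qed.

Lemma gauss_ratio_le al N : 0 <= al -> al * (al + 1) < N.+1%:R ->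
  gauss_ratio al N <= (rGamma (al + 1))^-1 * (1 - al * (al + 1) / N.+1%:R)^-1.
Proof.
move=> al0 Nal; have a0 : 0 < al + 1 by rewrite ltr_wpDl.
have G0 := rGamma_gt0 a0.
have h0 : 0 < 1 - al * (al + 1) / N.+1%:R by rewrite subr_gt0 ltr_pdivrMr// mul1r.
rewrite /gauss_ratio expRN ler_pdivrMr ?expR_gt0//.
rewrite mulrAC ler_pdivlMr// mulrC ler_pdivlMl//.
have := @rGamma_upper N.+1 al isT al0.
have -> : N.+2%:R + al = al + 1 + N.+1%:R by rewrite -natr1; ring.
rewrite -bcoef_Gamma//.
have f0 : 0 < N.+1`!%:R :> R by rewrite ltr0n fact_gt0.
move=> h; rewrite -(ler_pM2l f0); apply: le_trans h.
by rewrite le_eqVlt; apply/orP; left; apply/eqP; ring.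
Qed.

Lemma gauss_ratio_cvg al : 0 <= al ->
  gauss_ratio al N @[N --> \oo] --> (rGamma (al + 1))^-1.
Proof.
move=> al0.
have h : (rGamma (al + 1))^-1 * (1 - al * (al + 1) * N.+1%:R^-1)^-1 @[N --> \oo] -->
    (rGamma (al + 1))^-1.
  rewrite -[X in _ --> X]mulr1; apply: cvgMr.
  rewrite -[X in _ --> X]invr1; apply: cvgV; first exact: oner_neq0.
  rewrite -[X in _ --> X]subr0; apply: cvgB; first exact: cvg_cst.
  rewrite -[X in _ --> X](mulr0 (al * (al + 1))); apply: cvgMr.
  exact: cvg_harmonic.
apply: (squeeze_cvgr _ (cvg_cst (rGamma (al + 1))^-1) h).
near=> N; rewrite gauss_ratio_ge//= gauss_ratio_le//.
have /lt_trans : al * (al + 1) < N%:R by near: N; exact: nbhs_infty_gtr.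
by apply; rewrite ltr_nat.
Unshelve. all: by end_near. Qed.

Lemma gauss_ratio_decr al N : 0 <= al -> gauss_ratio al N.+1 <= gauss_ratio al N.
Proof.
move=> al0; rewrite /gauss_ratio bcoefS -mulrA ler_wpM2l ?bcoef_ge0 ?addr_ge0//.
set n := N.+2%:R; have n0 : 0 < n :> R by [].
have -> : (al + 1 + N.+1%:R) / n = 1 + al / n.
  have -> : al + 1 + N.+1%:R = al + n by rewrite -addrA [1 + _]addrC natr1.
  by rewrite mulrDl divff ?lt0r_neq0// addrC.
apply: le_trans (ler_wpM2r (expR_ge0 _) (expR_ge1Dx _)) _.
rewrite -expRD ler_expR -subr_ge0.
have -> : - (al * ln N.+1%:R) - (al / n - al * ln n) = al * (ln n - ln N.+1%:R - n^-1).
  by ring.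
rewrite mulr_ge0// subr_ge0 -opprB -ln_div ?posrE// lerNr ratio_succ.
by apply: le_ln1Dx; rewrite ltrN2 invf_lt1// ltr1n.
Qed.

Lemma gauss_ratio_le0 al N0 N : 0 <= al -> (N0 <= N)%N ->
  gauss_ratio al N <= gauss_ratio al N0.
Proof.
move=> al0; elim: N => [|N IH]; first by rewrite leqn0 => /eqP ->.
rewrite leq_eqVlt => /predU1P[-> //|]; rewrite ltnS => /IH; apply: le_trans.
exact: gauss_ratio_decr.
Qed.

End Gauss.

(** * Taylor coefficients of (1 - z)^(-c) / (1 - rho (1 - z)^(-lam)) *)
Section Renewal.
Context {R : realType}.
Implicit Types (a b c r rho eta lam : R) (N : nat).
Local Notation normc := (@ComplexField.Normc.normc R).

Lemma bcoefSE a N : N.+1%:R * bcoef a N.+1 = (a + N%:R) * bcoef a N.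
Proof. by rewrite bcoefS mulrCA [N.+1%:R * _]mulrC divfK// mulrC. Qed.

(** [(1 - z) ^ (- a) (1 - z) ^ (- b) = (1 - z) ^ (- (a + b))] at the level of
    coefficients, by the recurrence bcoefSE. *)
Lemma bcoef_conv a b N :
  \sum_(k < N.+1) bcoef a k * bcoef b (N - k) = bcoef (a + b) N.
Proof.
elim: N => [|N IH]; first by rewrite big_ord1 subnn !bcoef0 mulr1.
have n0 : N.+1%:R != 0 :> R by [].
apply: (mulfI n0); rewrite bcoefSE -IH !mulr_sumr.
transitivity (\sum_(k < N.+2) (k%:R * bcoef a k * bcoef b (N.+1 - k) +
    bcoef a k * ((N.+1 - k)%:R * bcoef b (N.+1 - k)))).
  apply: eq_bigr => k _.
  rewrite [bcoef a k * (_ * _)]mulrCA -mulrA -mulrDl -natrD subnKC//.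
  by rewrite -ltnS.
rewrite big_split/= big_ord_recl/= mulr0n !mul0r add0r.
rewrite [X in _ + X]big_ord_recr/= subnn mulr0n mul0r mulr0 addr0.
rewrite -big_split/=; apply: eq_bigr => k _.
have kN : (k <= N)%N by rewrite -ltnS.
rewrite /bump/= add1n bcoefSE subSS subSn// bcoefSE natrB//; ring.
Qed.

Lemma bcoef1 N : bcoef 1 N = 1 :> R.
Proof.
by rewrite /bcoef big1// => k _; rewrite addrC natr1 divff.
Qed.

Lemma bcoef_le a N : 0 <= a -> bcoef a N <= (a + 1) ^+ N.
Proof.
move=> a0; elim: N => [|N IH]; first by rewrite bcoef0.
rewrite bcoefS exprSr ler_pM ?bcoef_ge0// ?divr_ge0 ?addr_ge0//.
rewrite ler_pdivrMr// mulrDl mul1r lerD// ?ler_nat//.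
by rewrite ler_peMr// ler1n.
Qed.

Lemma bcoef_neg_le0 b N : 0 < b -> b <= 1 -> bcoef (- b) N.+1 <= 0.
Proof.
move=> b0 b1; elim: N => [|N IH].
  by rewrite bcoefS bcoef0 mul1r addr0 divr1 oppr_le0 ltW.
rewrite bcoefS mulr_le0_ge0// divr_ge0// addrC subr_ge0 (le_trans b1)// ler1n//.
Qed.

Lemma normcD_le (z w : R[i]) : normc (z + w) <= normc z + normc w.
Proof. by rewrite -lecR rmorphD/= -!normr_normc ler_normD. Qed.

(** In generating functions, [((1 - z) ^ b + i eta) V(z) = (1 - z) ^ (b - 1)]. For
    [0 < b <= 1] the coefficients of [(1 - z) ^ b] after the first are nonpositive
    and those of [(1 - z) ^ (b - 1)] nonnegative. As [(1 - z) ^ (b - 1)] is the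
    product of [(1 - z) ^ b] and [1 / (1 - z)], induction gives
    [|1 + i eta| |V N| <= 1]. *)
Lemma renewal_bound (V : nat -> R[i]) eta b : 0 < b -> b <= 1 ->
  (forall N, 'i * eta%:C * V N + \sum_(k < N.+1) (bcoef (- b) k)%:C * V (N - k)%N =
     (bcoef (1 - b) N)%:C) ->
  forall N, normc (V N) <= 1.
Proof.
move=> b0 b1 HV; elim/ltn_ind => N IH.
have h : (1 +i* eta) * V N = (bcoef (1 - b) N)%:C +
    \sum_(k < N) (- bcoef (- b) k.+1)%:C * V (N - k.+1)%N.
  rewrite -HV big_ord_recl/= subn0 bcoef0 mul1r.
  have -> : \sum_(k < N) (- bcoef (- b) k.+1)%:C * V (N - k.+1)%N =
     - \sum_(k < N) (bcoef (- b) k.+1)%:C * V (N - k.+1)%N.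
    by rewrite -sumrN; apply: eq_bigr => k _; rewrite rmorphN mulNr.
  have -> : \sum_(i < N) (bcoef (- b) (lift ord0 i))%:C * V (N - lift ord0 i)%N =
     \sum_(k < N) (bcoef (- b) k.+1)%:C * V (N - k.+1)%N by [].
  have -> : 1 +i* eta = 'i * eta%:C + 1 by simpc.
  by rewrite mulrDl mul1r addrA addrK.
have n1 : 1 <= normc (1 +i* eta).
  by rewrite normcE/= -[leLHS]sqrtr1 ler_wsqrtr// expr1n lerDl sqr_ge0.
apply: (@le_trans _ _ (normc ((1 +i* eta) * V N))).
  by rewrite normcM ler_peMl ?normc_ge0.
rewrite h; apply: le_trans (normcD_le _ _) _.
apply: (@le_trans _ _ (bcoef (1 - b) N + \sum_(k < N) - bcoef (- b) k.+1)).
  apply: lerD; first by rewrite normc_real ger0_norm// bcoef_ge0// subr_ge0.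
  apply: (@le_trans _ _ (\sum_(k < N) normc ((- bcoef (- b) k.+1)%:C * V (N - k.+1)%N))).
    elim/big_ind2: _ => //; first by rewrite normc0.
    by move=> x1 x2 y1 y2 h1 h2; apply: le_trans (normcD_le _ _) (lerD h1 h2).
  apply: ler_sum => k _; rewrite normcM normc_real ger0_norm ?oppr_ge0 ?bcoef_neg_le0//.
  by rewrite ler_piMr ?oppr_ge0 ?bcoef_neg_le0// IH// ltn_subrL (leq_ltn_trans _ (ltn_ord k)).
have := bcoef_conv (- b) 1 N.
rewrite addrC => <-; rewrite big_ord_recl/= bcoef0 subn0 bcoef1 mul1r.
rewrite sumrN -addrA [X in _ + X](_ : _ = 0) ?addr0//.
apply/eqP; rewrite subr_eq0; apply/eqP; apply: eq_bigr => k _.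
by rewrite bcoef1 mulr1.
Qed.

Lemma poly_geometric_decay rho N : 0 <= rho -> rho < 1 -> exists2 C, 0 <= C &
  forall j : nat, rho ^+ j * j.+1%:R ^+ N <= C * expR (- (2 * ln (j.+1%:R : R))).
Proof.
move=> r0 r1; pose r := Num.max rho 2^-1.
have rp : 0 < r by rewrite lt_max invr_gt0 ltr0n orbT.
have rl : r < 1 by rewrite gt_max r1 invf_lt1// ltr1n.
have t0 : 0 < - ln r by rewrite oppr_gt0 ln_lt0// rp.
have x0 : 0 < N%:R + 2 :> R by rewrite ltr_wpDl.
have [C C0 CP] := expR_decay x0 t0.
exists C => // j; apply: (@le_trans _ _ (expR (- (j%:R * - ln r)) * j.+1%:R ^+ N)).
  rewrite ler_wpM2r ?exprn_ge0//.
  rewrite mulrN opprK expRM_natl lnK ?posrE//.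
  by rewrite lerXn2r ?nnegrE ?(ltW rp)// le_max lexx.
apply: le_trans (ler_wpM2r _ (CP j)) _; first by rewrite exprn_ge0.
have -> : j.+1%:R ^+ N = expR (N%:R * ln j.+1%:R) :> R by rewrite expRM_natl lnK ?posrE.
by rewrite -mulrA -expRD ler_wpM2l// ler_expR mulrDl; lra.
Qed.

Definition bterm rho lam c N (j : nat) : R := rho ^+ j * bcoef (lam * j%:R + c) N.

Lemma bterm_norm_cvg rho lam c N : `|rho| < 1 -> 0 <= lam -> 0 <= c ->
  cvgn (series (fun j => `|bterm rho lam c N j|)).
Proof.
move=> r1 l0 c0; have [C C0 CP] := @poly_geometric_decay `|rho| N (normr_ge0 _) r1.
have [K KP] := @pseries_bounded R 2 (ltr1n R 2).
pose A := (lam + c + 1) ^+ N; have A0 : 0 <= A by rewrite exprn_ge0// !addr_ge0.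
apply: (@cvgn_nneg_bounded _ _ (A * (C * K))) => // M.
apply: (@le_trans _ _ (A * (C * \sum_(0 <= k < M) expR (- (2 * ln (k.+1%:R : R)))))); last first.
  by rewrite ler_wpM2l// ler_wpM2l.
rewrite /series/= !mulr_sumr; apply: ler_sum => j _.
apply: le_trans (ler_wpM2l A0 (CP j)).
have a0 : 0 <= lam * j%:R + c by rewrite addr_ge0// mulr_ge0.
rewrite /bterm normrM normrX mulrCA ler_wpM2l ?exprn_ge0//.
rewrite ger0_norm ?bcoef_ge0// (le_trans (bcoef_le N a0))// /A -exprMn.
rewrite lerXn2r ?nnegrE ?addr_ge0 ?mulr_ge0 ?addr_ge0//.
rewrite -natr1 mulrDr mulr1 !mulrDl mul1r.
have : 0 <= c * j%:R by rewrite mulr_ge0.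
have : 0 <= j%:R :> R by [].
by move: (lam * j%:R) (c * j%:R) j%:R => u v w; lra.
Qed.

Lemma bterm_cvg rho lam c N : `|rho| < 1 -> 0 <= lam -> 0 <= c ->
  cvgn (series (bterm rho lam c N)).
Proof. by move=> r1 l0 c0; apply: (@normed_cvg R R); exact: bterm_norm_cvg. Qed.

(** The coefficient of [z ^ N] in [(1 - z) ^ (- c) / (1 - rho (1 - z) ^ (- lam))],
    expanded as a geometric series in rho. *)
Definition bsum rho lam c N : R := limn (series (bterm rho lam c N)).

Lemma cvg_sum_ord n (f : 'I_n -> nat -> R) (l : 'I_n -> R) :
  (forall k, f k @ \oo --> l k) ->
  (fun M => \sum_(k < n) f k M) @ \oo --> \sum_(k < n) l k.
Proof.
elim: n f l => [|n IH] f l fl.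
  by rewrite big_ord0; under eq_fun do rewrite big_ord0; exact: cvg_cst.
rewrite big_ord_recl; under eq_fun do rewrite big_ord_recl.
by apply: cvgD; [exact: fl|apply: IH => k; exact: fl].
Qed.

Lemma bsum_conv rho lam c b N : `|rho| < 1 -> 0 <= lam -> 0 <= c ->
  \sum_(k < N.+1) bcoef b k * bsum rho lam c (N - k) = bsum rho lam (c + b) N.
Proof.
move=> r1 l0 c0; apply/esym/cvg_lim => //.
have -> : series (bterm rho lam (c + b) N) =
   fun M => \sum_(k < N.+1) bcoef b k * series (bterm rho lam c (N - k)) M.
  apply/funext => M; rewrite /series/=.
  under [RHS]eq_bigr do rewrite mulr_sumr.
  rewrite exchange_big/=; apply: eq_bigr => j _.
  rewrite /bterm.
  have -> : lam * j%:R + (c + b) = b + (lam * j%:R + c) by ring.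
  rewrite -bcoef_conv mulr_sumr; apply: eq_bigr => k _; ring.
by apply: cvg_sum_ord => k; apply: cvgMr; exact: bterm_cvg.
Qed.

(** Splits off the first term of the geometric series. *)
Lemma bsum_shift rho lam c N : `|rho| < 1 -> 0 <= lam -> 0 <= c ->
  bsum rho lam c N = bcoef c N + rho * bsum rho lam (c + lam) N.
Proof.
move=> r1 l0 c0; apply/cvg_lim => //; rewrite -cvg_shiftS.
have -> : (fun n => series (bterm rho lam c N) n.+1) =
   fun M => bcoef c N + rho * series (bterm rho lam (c + lam) N) M.
  apply/funext => M; rewrite /series/= big_nat_recl//= {1}/bterm expr0 mul1r mulr0 add0r.
  congr (_ + _); rewrite mulr_sumr; apply: eq_bigr => j _.
  rewrite /bterm exprS -mulrA; congr (_ * (_ * bcoef _ _)).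
  by rewrite -natr1; ring.
apply: cvgD; first exact: cvg_cst.
by apply: cvgMr; apply: bterm_cvg => //; rewrite addr_ge0.
Qed.

(** With b = lam / 2, the generating function is the real part, coefficient by
    coefficient, of [(1 - z) ^ (b - 1) / ((1 - z) ^ b + i eta)], to which
    renewal_bound applies; lam <= 2 means b <= 1. *)
Lemma bsum_le1 eta lam N : 0 <= eta -> eta < 1 -> 0 < lam -> lam <= 2 ->
  `|bsum (- eta ^+ 2) lam 1 N| <= 1.
Proof.
move=> e0 e1 l0 l2; pose b := lam / 2; set rho := - eta ^+ 2.
have b0 : 0 < b by rewrite divr_gt0.
have b1 : b <= 1 by rewrite ler_pdivrMr// mul1r.
have r1 : `|rho| < 1.
  by rewrite normrN ger0_norm ?sqr_ge0// expr_lt1.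
have lge : 0 <= lam by exact: ltW.
(* X is the imaginary part: - eta (1 - z) ^ (- 1 - b) / (1 - rho (1 - z) ^ (-
   lam)). *)
pose W M := bsum rho lam 1 M.
pose X M := - eta * bsum rho lam (1 + b) M.
have HV M : 'i * eta%:C * (W M +i* X M) +
    \sum_(k < M.+1) (bcoef (- b) k)%:C * (W (M - k)%N +i* X (M - k)%N) =
     (bcoef (1 - b) M)%:C.
  have -> : \sum_(k < M.+1) (bcoef (- b) k)%:C * (W (M - k)%N +i* X (M - k)%N) =
     (\sum_(k < M.+1) bcoef (- b) k * W (M - k)%N) +i*
     (\sum_(k < M.+1) bcoef (- b) k * X (M - k)%N).
    elim/big_ind3: _ => // [x1 x2 x3 y1 y2 y3 -> -> //|k _].
    by simpc.
  have hW : \sum_(k < M.+1) bcoef (- b) k * W (M - k)%N = bcoef (1 - b) M + eta * X M.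
    rewrite /W bsum_conv// bsum_shift ?subr_ge0//.
    have -> : 1 - b + lam = 1 + b by rewrite /b; field.
    by rewrite /X /rho; ring.
  have hX : \sum_(k < M.+1) bcoef (- b) k * X (M - k)%N = - eta * W M.
    rewrite /X; under eq_bigr do rewrite mulrCA.
    by rewrite -mulr_sumr bsum_conv ?addr_ge0 ?(ltW b0)// addrK.
  rewrite hW hX; simpc; congr (_ +i* _); ring.
have := renewal_bound b0 b1 HV N; apply: le_trans.
exact: (norm_Re_le (W N +i* X N)).
Qed.

End Renewal.

(** * The Mittag-Leffler function on the negative axis *)
Section MittagLeffler.
Context {R : realType}.
Implicit Types (t x lam : R).

Lemma series_tail_le (f d : nat -> R) (J : nat) : (forall j, `|f j| <= d j) ->
  cvgn (series d) ->
  `|series f J| <= `|limn (series f)| + (limn (series d) - series d J).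
Proof.
move=> fd dc.
have d0 j : 0 <= d j by exact: le_trans (fd j).
have fc : cvgn (series f).
  by apply: (@normed_cvg R R); apply: (series_le_cvg _ _ fd dc).
rewrite -lerBlDl; apply: le_trans (lerB_dist _ _) _; rewrite distrC.
have h : `|series f M - series f J| @[M --> \oo] --> `|limn (series f) - series f J|.
  by apply: cvg_norm; apply: cvgB => //; exact: cvg_cst.
rewrite -(cvg_lim _ h)//; apply: limr_le; first by apply/cvg_ex; eexists; exact: h.
near=> M.
have JM : (J <= M)%N by near: M; exists J.
rewrite sub_series_geq//; apply: le_trans (ler_norm_sum _ _ _) _.
apply: (@le_trans _ _ (series d M - series d J)).
  by rewrite sub_series_geq//; apply: ler_sum.
rewrite lerD2r; apply: nondecreasing_cvgn_le => //.
by apply: nondecreasing_series => k _ _.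
Unshelve. all: by end_near. Qed.

(** The tails are controlled by d uniformly in N, so the bound passes to the series
    of limits. *)
Lemma series_bound_lim (f : nat -> nat -> R) (g d : nat -> R) B :
  (forall j, f N j @[N --> \oo] --> g j) ->
  (forall N j, `|f N j| <= d j) -> cvgn (series d) ->
  (forall N, `|limn (series (f N))| <= B) -> `|limn (series g)| <= B.
Proof.
move=> fg fd dc fB.
have d0 j : 0 <= d j by exact: le_trans (fd 0%N j).
have gd j : `|g j| <= d j.
  have h : `|f N j| @[N --> \oo] --> `|g j| by apply: cvg_norm; exact: fg.
  rewrite -(cvg_lim _ h)//; apply: limr_le; first by apply/cvg_ex; eexists; exact: h.
  by apply: nearW => N; exact: fd.
have gc : cvgn (series g).
  by apply: (@normed_cvg R R); apply: (series_le_cvg _ _ gd dc).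
have gJ J : `|series g J| <= B + (limn (series d) - series d J).
  have h : `|series (f N) J| @[N --> \oo] --> `|series g J|.
    apply: cvg_norm; rewrite /series/= big_mkord.
    under eq_fun do rewrite big_mkord.
    by apply: cvg_sum_ord => k; exact: fg.
  rewrite -(cvg_lim _ h)//; apply: limr_le; first by apply/cvg_ex; eexists; exact: h.
  apply: nearW => N; apply: le_trans (series_tail_le J (fd N) dc) _.
  by rewrite lerD2r.
have h1 : `|series g J| @[J --> \oo] --> `|limn (series g)|.
  exact: cvg_norm.
have h2 : B + (limn (series d) - series d J) @[J --> \oo] --> B.
  rewrite -[X in _ --> X]addr0; apply: cvgD; first exact: cvg_cst.
  rewrite -[X in _ --> X](subrr (limn (series d))).
  by apply: cvgB => //; exact: cvg_cst.
rewrite -(cvg_lim _ h1)// -(cvg_lim _ h2)//; apply: ler_lim.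
- by apply/cvg_ex; eexists; exact: h1.
- by apply/cvg_ex; eexists; exact: h2.
- by apply: nearW.
Qed.

Definition mlterm lam x (j : nat) : R := (- x) ^+ j / rGamma (lam * j%:R + 1).

Definition mlfun lam x : R := limn (series (mlterm lam x)).

Lemma mittag_lefflerE lam x : 0 < lam ->
  mittag_leffler lam (- x%:C) = (mlfun lam x)%:C.
Proof.
move=> l0; rewrite /mittag_leffler.
have -> : (fun n => (- x%:C) ^+ n / cGamma (lam * n%:R + 1)%:C) =
   fun n => (mlterm lam x n)%:C.
  apply/funext => n; rewrite cGamma_real; last by rewrite ltr_wpDl// mulr_ge0// ltW.
  by rewrite /mlterm rmorphM rmorphXn rmorphN fmorphV.
rewrite /csum/=; congr (_ +i* _).
have -> : series (fun _ : nat => 0 : R) = cst 0.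
  by apply/funext => N; rewrite /series/= big1.
exact: lim_cst.
Qed.

(** With 1 / Gamma replaced by its Gauss approximation, the Mittag-Leffler series at
    [- x] becomes a coefficient bsum with [rho = - x / (N + 1) ^ lam]. *)
Lemma bterm_gauss lam x (N j : nat) :
  (- x) ^+ j * gauss_ratio (lam * j%:R) N =
  bterm (- (x * expR (- (lam * ln N.+1%:R)))) lam 1 N.+1 j.
Proof.
rewrite /gauss_ratio /bterm -(mulNr x) exprMn -expRM_natr.
rewrite [bcoef _ _ * _]mulrC mulrA; congr (_ * expR _ * _); ring.
Qed.

Lemma ml_scale lam x : 0 < lam -> 0 <= x -> exists N0 : nat,
  forall N, (N0 <= N)%N -> x * expR (- (lam * ln (N.+1%:R : R))) < 1.
Proof.
move=> l0 x0; have h := cvg_expR_lnN l0.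
have : x * expR (- (lam * ln (n.+1%:R : R))) @[n --> \oo] --> (0 : R).
  by rewrite -[X in _ --> X](mulr0 x); apply: cvgMr.
move=> /cvgr_lt /(_ 1 ltr01) [N0 _ H]; exists N0 => N NN; exact: H.
Qed.

Lemma mlterm_le lam x (N j : nat) : 0 < lam -> 0 <= x ->
  `|mlterm lam x j| <= x ^+ j * gauss_ratio (lam * j%:R) N.
Proof.
move=> l0 x0; have a0 : 0 <= lam * j%:R by rewrite mulr_ge0// ltW.
have G0 : 0 < rGamma (lam * j%:R + 1) by apply: rGamma_gt0; rewrite ltr_wpDl.
rewrite normrM normrX normrN (ger0_norm x0) ger0_norm ?invr_ge0 ?(ltW G0)//.
by rewrite ler_wpM2l ?exprn_ge0// gauss_ratio_ge.
Qed.

Lemma gauss_dom_cvg lam x N : 0 < lam -> 0 <= x ->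
  x * expR (- (lam * ln (N.+1%:R : R))) < 1 ->
  cvgn (series (fun j => x ^+ j * gauss_ratio (lam * j%:R) N)).
Proof.
move=> l0 x0 xN.
have r1 : `|- (x * expR (- (lam * ln (N.+1%:R : R))))| < 1.
  by rewrite normrN ger0_norm// mulr_ge0// expR_ge0.
have := @bterm_norm_cvg R _ _ _ N.+1 r1 (ltW l0) ler01.
have -> : (fun j => `|bterm (- (x * expR (- (lam * ln N.+1%:R)))) lam 1 N.+1 j|) =
  (fun j => x ^+ j * gauss_ratio (lam * j%:R) N) => //.
apply/funext => j; rewrite -bterm_gauss normrM normrX normrN (ger0_norm x0).
by rewrite ger0_norm// gauss_ratio_ge0// mulr_ge0// ltW.
Qed.

Lemma mlterm_norm_cvg lam x : 0 < lam -> 0 <= x ->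
  cvgn (series (fun j => `|mlterm lam x j|)).
Proof.
move=> l0 x0; have [N0 /(_ N0 (leqnn _)) H] := ml_scale l0 x0.
apply: (series_le_cvg _ _ _ (gauss_dom_cvg l0 x0 H)) => j //.
  by rewrite mulr_ge0 ?exprn_ge0// gauss_ratio_ge0// mulr_ge0// ltW.
exact: mlterm_le.
Qed.

(** By bsum_le1 the approximations of bterm_gauss are bounded by 1. They converge
    termwise, dominated by the one at the fixed index N0 because gauss_ratio
    decreases in N. *)
Lemma mlfun_le1 lam x : 0 < lam -> lam <= 2 -> 0 <= x -> `|mlfun lam x| <= 1.
Proof.
move=> l0 l2 x0; have [N0 H] := ml_scale l0 x0.
apply: (@series_bound_lim
  (fun N j => (- x) ^+ j * gauss_ratio (lam * j%:R) (N + N0)) _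
  (fun j => x ^+ j * gauss_ratio (lam * j%:R) N0)).
- move=> j; apply: cvgMr; rewrite (cvg_shiftn N0).
  by apply: gauss_ratio_cvg; rewrite mulr_ge0// ltW.
- move=> N j; have a0 : 0 <= lam * j%:R by rewrite mulr_ge0// ltW.
  rewrite normrM normrX normrN (ger0_norm x0) ger0_norm ?gauss_ratio_ge0//.
  by rewrite ler_wpM2l ?exprn_ge0// gauss_ratio_le0// leq_addl.
- exact: gauss_dom_cvg (H _ (leqnn _)).
- move=> N; set M := (N + N0)%N.
  have xM := H M (leq_addl _ _).
  pose y := x * expR (- (lam * ln (M.+1%:R : R))).
  have y0 : 0 <= y by rewrite mulr_ge0// expR_ge0.
  have -> : (fun j => (- x) ^+ j * gauss_ratio (lam * j%:R) M) =
     bterm (- y) lam 1 M.+1.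
    by apply/funext => j; rewrite bterm_gauss.
  have -> : - y = - Num.sqrt y ^+ 2 by rewrite sqr_sqrtr.
  apply: bsum_le1 => //.
  by rewrite -[ltRHS]sqrtr1 ltr_sqrt.
Qed.

End MittagLeffler.

(** * Cauchy products *)
Section CauchyProduct.
Context {R : realType}.
Implicit Types (a b s u : nat -> R[i]) (l m z : R[i]).
Local Notation normc := (@ComplexField.Normc.normc R).

Definition ccvg_to s l :=
  (fun n => complex.Re (s n)) @ \oo --> complex.Re l /\
  (fun n => complex.Im (s n)) @ \oo --> complex.Im l.

Lemma ccvg_to_unique s l m : ccvg_to s l -> ccvg_to s m -> l = m.
Proof.
move=> [lr li] [mr mi]; case: l m lr li mr mi => [a b] [c d] /= lr li mr mi.
by congr (_ +i* _); [rewrite -(cvg_lim _ lr)// (cvg_lim _ mr)|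
  rewrite -(cvg_lim _ li)// (cvg_lim _ mi)].
Qed.

Lemma ccvg_to_cst l : ccvg_to (fun _ => l) l.
Proof. by split; exact: cvg_cst. Qed.

Lemma ccvg_toD s u l m : ccvg_to s l -> ccvg_to u m -> ccvg_to (fun n => s n + u n) (l + m).
Proof.
case: l m => [a b] [c d] [/= lr li] [/= mr mi]; split=> /=.
  have -> : (fun n => complex.Re (s n + u n)) =
     fun n => complex.Re (s n) + complex.Re (u n).
    by apply/funext => n; case: (s n); case: (u n).
  exact: cvgD.
have -> : (fun n => complex.Im (s n + u n)) =
   fun n => complex.Im (s n) + complex.Im (u n).
  by apply/funext => n; case: (s n); case: (u n).
exact: cvgD.
Qed.

Lemma ccvg_toM s u l m : ccvg_to s l -> ccvg_to u m -> ccvg_to (fun n => s n * u n) (l * m).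
Proof.
case: l m => [a b] [c d] [/= lr li] [/= mr mi]; split=> /=.
  have -> : (fun n => complex.Re (s n * u n)) = fun n =>
     complex.Re (s n) * complex.Re (u n) - complex.Im (s n) * complex.Im (u n).
    by apply/funext => n; case: (s n); case: (u n).
  by apply: cvgB; apply: cvgM.
have -> : (fun n => complex.Im (s n * u n)) = fun n =>
   complex.Re (s n) * complex.Im (u n) + complex.Im (s n) * complex.Re (u n).
  by apply/funext => n; case: (s n); case: (u n).
by apply: cvgD; apply: cvgM.
Qed.

Lemma ccvg_to_normc0 s : (fun n => normc (s n)) @ \oo --> (0 : R) -> ccvg_to s 0.
Proof.
move=> s0; split; apply: norm_cvg0; apply: (squeeze_cvgr _ (cvg_cst 0) s0);
  by apply: nearW => n; rewrite normr_ge0/= ?norm_Re_le ?norm_Im_le.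
Qed.

Definition csums a (n : nat) : R[i] := \sum_(0 <= k < n) a k.
Definition cconv a b (n : nat) : R[i] := \sum_(0 <= k < n.+1) a k * b (n - k)%N.

Lemma Re_csums a n : complex.Re (csums a n) = series (fun k => complex.Re (a k)) n.
Proof.
rewrite /csums /series/=; elim: n => [|n IH]; first by rewrite !big_nil.
rewrite !big_nat_recr//= -IH.
by case: (\sum_(0 <= k < n) a k) => x1 x2; case: (a n).
Qed.

Lemma Im_csums a n : complex.Im (csums a n) = series (fun k => complex.Im (a k)) n.
Proof.
rewrite /csums /series/=; elim: n => [|n IH]; first by rewrite !big_nil.
rewrite !big_nat_recr//= -IH.
by case: (\sum_(0 <= k < n) a k) => x1 x2; case: (a n).
Qed.

Lemma conv_sums (K : pzRingType) (a b : nat -> K) (M : nat) :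
  \sum_(0 <= n < M) \sum_(0 <= k < n.+1) a k * b (n - k)%N =
  \sum_(0 <= k < M) a k * \sum_(0 <= j < M - k) b j.
Proof.
elim: M => [|M IH]; first by rewrite !big_nil.
rewrite big_nat_recr//= IH [RHS]big_nat_recr//= [X in _ + X]big_nat_recr//= addrA.
rewrite subnn subSnn big_nat1; congr (_ + _).
rewrite -big_split/= [LHS]big_nat [RHS]big_nat; apply: eq_bigr => k /andP[_ kM].
by rewrite -mulrDr subSn 1?ltnW// big_nat_recr.
Qed.

(** The Cauchy product up to M contains the square of side M / 2 and is contained in
    the one of side M. Applied to norms, it bounds the error for complex series. *)
Lemma real_conv_nneg (a b : nat -> R) (A B : R) :
  (forall k, 0 <= a k) -> (forall k, 0 <= b k) ->
  series a @ \oo --> A -> series b @ \oo --> B ->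
  (fun M => series a M * series b M -
    \sum_(0 <= k < M) a k * series b (M - k)%N) @ \oo --> (0 : R).
Proof.
move=> a0 b0 aA bB.
have sA0 M : 0 <= series a M by apply: sumr_ge0.
have sB0 M : 0 <= series b M by apply: sumr_ge0.
have nda : nondecreasing_seq (series a) by apply: nondecreasing_series => k _ _.
have ndb : nondecreasing_seq (series b) by apply: nondecreasing_series => k _ _.
pose C M := \sum_(0 <= k < M) a k * series b (M - k)%N.
have CJ M J : (J.*2 <= M)%N -> series a J * series b J <= C M.
  move=> JM; have JM' : (J <= M)%N by apply: leq_trans JM; rewrite -addnn leq_addr.
  rewrite /C (big_cat_nat (n := J))//= -[leLHS]addr0 lerD//; last first.
    by apply: sumr_ge0 => k _; rewrite mulr_ge0.
  rewrite {1}/series/= mulr_suml; apply: ler_sum_nat => k /andP[_ kJ].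
  rewrite ler_wpM2l//; apply: ndb.
  by rewrite leq_subRL ?(leq_trans (ltnW kJ))// (leq_trans _ JM)// -addnn leq_add2r ltnW.
have CM M : C M <= series a M * series b M.
  rewrite /C {1}/series/= mulr_suml; apply: ler_sum => k _.
  by rewrite ler_wpM2l// ndb// leq_subr.
have h1 : series a M * series b M - series a M./2 * series b M./2 @[M --> \oo] --> (0 : R).
  rewrite -[X in _ --> X](subrr (A * B)).
  have half : (fun M => M./2) @ \oo --> \oo.
    move=> P [N _ NP]; exists N.*2 => // M /= NM; apply: NP => /=.
    by rewrite -[N]doubleK; apply: half_leq.
  apply: cvgB; first exact: cvgM.
  by apply: cvgM; apply: cvg_comp half _.
apply: (squeeze_cvgr _ (cvg_cst 0) h1); apply: nearW => M.
rewrite subr_ge0 CM/= lerD2l lerN2 CJ//.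
by rewrite -[leqRHS]odd_double_half leq_addl.
Qed.

Lemma ccvg_to_conv a b (A B : R[i]) :
  cvgn (series (fun k => normc (a k))) -> cvgn (series (fun k => normc (b k))) ->
  ccvg_to (csums a) A -> ccvg_to (csums b) B -> ccvg_to (csums (cconv a b)) (A * B).
Proof.
move=> na nb aA bB.
have e : csums (cconv a b) = fun M => csums a M * csums b M +
    (- 1) * (csums a M * csums b M - csums (cconv a b) M).
  by apply/funext => M; rewrite mulN1r opprB addrC subrK.
rewrite e -[A * B]addr0 -[X in A * B + X](mulr0 (-1)).
apply: ccvg_toD; first exact: ccvg_toM.
apply: ccvg_toM; first exact: ccvg_to_cst.
apply: ccvg_to_normc0.
have h := real_conv_nneg (fun k => normc_ge0 (a k)) (fun k => normc_ge0 (b k)) na nb.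
apply: (squeeze_cvgr _ (cvg_cst 0) h); apply: nearW => M.
rewrite normc_ge0/=.
have nsum (f : nat -> R[i]) (p q : nat) :
    normc (\sum_(p <= k < q) f k) <= \sum_(p <= k < q) normc (f k).
  elim/big_ind2: _ => //; first by rewrite normc0.
  by move=> x1 x2 y1 y2 h1 h2; apply: le_trans (normcD_le _ _) (lerD h1 h2).
rewrite /csums /cconv conv_sums mulr_suml -sumrB.
apply: le_trans (nsum _ _ _) _.
rewrite {1}/series/= mulr_suml -sumrB; apply: ler_sum => k _.
rewrite -!mulrBr normcM ler_wpM2l ?normc_ge0//.
have tail (V : zmodType) (f : nat -> V) : \sum_(0 <= j < M) f j -
   \sum_(0 <= j < M - k) f j = \sum_(M - k <= j < M) f j.
  by apply/eqP; rewrite subr_eq addrC -big_cat_nat ?leq_subr.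
by rewrite /series/= !tail; exact: nsum.
Qed.

End CauchyProduct.

(** * The binomial series at a complex point *)
Section BinomialSeries.
Context {R : realType}.
Implicit Types (x y r t lam : R) (z L : R[i]).
Local Notation mu := (@lebesgue_measure R).
Local Notation posR := `]0%R : R, +oo[%classic.
Local Notation normc := (@ComplexField.Normc.normc R).

Definition cexp_term z (k : nat) : R[i] := z ^+ k / k`!%:R.

Lemma factC_neq0 (k : nat) : k`!%:R != 0 :> R[i].
Proof. by rewrite pnatr_eq0 -lt0n fact_gt0. Qed.

Lemma cexp_term_conv (v w : R[i]) : cconv (cexp_term v) (cexp_term w) = cexp_term (v + w).
Proof.
apply/funext => n; rewrite /cconv /cexp_term addrC exprDn big_mkord mulr_suml.
apply: eq_bigr => -[k] /= kn _.
have cE : n`!%:R = 'C(n, k)%:R * (k`!%:R * (n - k)`!%:R) :> R[i].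
  by rewrite -!natrM bin_fact.
have c0 : 'C(n, k)%:R != 0 :> R[i] by rewrite pnatr_eq0 -lt0n bin_gt0.
rewrite -[w ^+ _ * v ^+ _ *+ _]mulr_natr cE; move: (factC_neq0 k) (factC_neq0 (n - k)) c0.
move: (k`!%:R : R[i]) ((n - k)`!%:R : R[i]) ('C(n, k)%:R : R[i]) => p q c p0 q0 c0.
by field; rewrite p0 q0 c0.
Qed.

Lemma normc_cexp_term z (k : nat) : normc (cexp_term z k) = exp_coeff (normc z) k.
Proof.
rewrite /cexp_term normcM normcX normcV natr_complex normc_real.
by rewrite ger0_norm.
Qed.

Lemma cexp_term_cvg z : cvgn (series (fun k => normc (cexp_term z k))).
Proof.
under eq_fun do rewrite normc_cexp_term.
exact: is_cvg_series_exp_coeff.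
Qed.

Lemma ccvg_to_csums u (l : R[i]) :
  series (fun k => complex.Re (u k)) @ \oo --> complex.Re l ->
  series (fun k => complex.Im (u k)) @ \oo --> complex.Im l -> ccvg_to (csums u) l.
Proof.
move=> hr hi; split.
  by under eq_fun do rewrite Re_csums.
by under eq_fun do rewrite Im_csums.
Qed.

Lemma ccvg_to_cexp_real x : ccvg_to (csums (cexp_term x%:C)) (cexp x%:C).
Proof.
have e k : cexp_term x%:C k = (exp_coeff x k)%:C.
  by rewrite /cexp_term natr_complex -rmorphXn -fmorphV -rmorphM.
rewrite cexpE cos0 sin0 mulr1 mulr0; apply: ccvg_to_csums => /=.
  under eq_fun do rewrite e /=.
  exact: is_cvg_series_exp_coeff.
under eq_fun do rewrite e /=.
have -> : series (fun _ : nat => 0 : R) = cst 0.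
  by apply/funext => N; rewrite /series/= big1.
exact: cvg_cst.
Qed.

(** i ^ k is (-1) ^ (k / 2), times i if k is odd. *)
Lemma cexp_term_imag y (k : nat) :
  cexp_term (0 +i* y) k = cos_coeff y k +i* sin_coeff y k.
Proof.
have iE : (0 +i* y) = 'i * y%:C by simpc.
have i2 m : ('i : R[i]) ^+ (m.*2) = ((-1) ^+ m)%:C.
  by rewrite -mul2n exprM sqr_i rmorphXn rmorphN1.
rewrite /cexp_term iE exprMn natr_complex -rmorphXn -fmorphV -mulrA -rmorphM.
rewrite -[in 'i ^+ k](odd_double_half k) exprD i2.
rewrite /cos_coeff /sin_coeff /=.
case: (boolP (odd k)) => ok /=.
  have -> : k.-1./2 = k./2.
    by rewrite -[in LHS](odd_double_half k) ok add1n/= doubleK.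
  by rewrite expr1; simpc; congr (_ +i* _); ring.
by rewrite expr0; simpc; congr (_ +i* _); ring.
Qed.

Lemma ccvg_to_cexp_imag y : ccvg_to (csums (cexp_term (0 +i* y))) (cexp (0 +i* y)).
Proof.
have hc : series (cos_coeff y) @ \oo --> cos y.
  have -> : cos y = limn (series (cos_coeff y)) by rewrite unlock.
  exact: (@is_cvg_series_cos_coeff R y).
have hs : series (sin_coeff y) @ \oo --> sin y.
  have -> : sin y = limn (series (sin_coeff y)) by rewrite unlock.
  exact: (@is_cvg_series_sin_coeff R y).
rewrite cexpE expR0 !mul1r; apply: ccvg_to_csums => /=.
  have -> : (fun k => complex.Re (cexp_term (0 +i* y) k)) = cos_coeff y => //.
  by apply/funext => k; rewrite cexp_term_imag.
have -> : (fun k => complex.Im (cexp_term (0 +i* y) k)) = sin_coeff y => //.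
by apply/funext => k; rewrite cexp_term_imag.
Qed.

Lemma ccvg_to_cexp z : ccvg_to (csums (cexp_term z)) (cexp z).
Proof.
case: z => x y; have -> : x +i* y = x%:C + (0 +i* y) by simpc.
rewrite cexpD -cexp_term_conv.
by apply: ccvg_to_conv; [exact: cexp_term_cvg|exact: cexp_term_cvg|
  exact: ccvg_to_cexp_real|exact: ccvg_to_cexp_imag].
Qed.

Lemma csum_ccvg_to (u : nat -> R[i]) (l : R[i]) : ccvg_to (csums u) l -> csum u = l.
Proof.
case: l => a b [/= hr hi]; rewrite /csum; congr (_ +i* _); apply/cvg_lim => //.
  by move: hr; under eq_fun do rewrite Re_csums.
by move: hi; under eq_fun do rewrite Im_csums.
Qed.

Lemma ccvg_ccvg_to (u : nat -> R[i]) : ccvg u -> ccvg_to (csums u) (csum u).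
Proof. by case=> hr hi; apply: ccvg_to_csums. Qed.

Lemma bcoef_geom_bounded r lam : 0 <= r -> r < 1 -> 0 < lam ->
  exists K, forall N : nat, \sum_(0 <= k < N) r ^+ k * bcoef lam k <= K.
Proof.
move=> r0 r1 l0; have [D D0 DP] := pochhammer_growth (lam%:C).
pose M := (Num.truncn `|lam - 1|).+1.
have [C C0 CP] := poly_geometric_decay M r0 r1.
have [K KP] := @pseries_bounded R 2 (ltr1n R 2).
exists (D * (C * K)) => N.
apply: (@le_trans _ _ (D * (C * \sum_(0 <= k < N) expR (- (2 * ln (k.+1%:R : R)))))); last first.
  by rewrite ler_wpM2l// ler_wpM2l.
rewrite !mulr_sumr; apply: ler_sum => k _.
apply: le_trans (ler_wpM2l D0 (CP k)); rewrite mulrCA ler_wpM2l ?exprn_ge0//.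
have -> : bcoef lam k = normc (pochhammer lam%:C k) / k`!%:R.
  have bE : bcoef lam k = (\prod_(i < k) (lam + i%:R)) / k`!%:R.
    elim: k => [|k IH]; first by rewrite bcoef0 big_ord0 divr1.
    rewrite bcoefS IH big_ord_recr/= factS natrM invfM; ring.
  rewrite bE; congr (_ / _).
  have -> : pochhammer lam%:C k = (\prod_(i < k) (lam + i%:R))%:C.
    by rewrite /pochhammer rmorph_prod; apply: eq_bigr => i _; rewrite natr_complex rmorphD.
  by rewrite normc_real ger0_norm// prodr_ge0// => i _; rewrite addr_ge0// ltW.
apply: le_trans (DP k) _; rewrite ler_wpM2l//=.
have -> : k.+1%:R ^+ M = expR (M%:R * ln k.+1%:R) :> R by rewrite expRM_natl lnK ?posrE.
rewrite ler_expR ler_wpM2r ?ln_ge0 ?ler1n//.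
by rewrite (le_trans (ler_norm _))// ltW// truncnS_gt.
Qed.

(** Newton's series for [(1 - z) ^ (- lam)] at [1 - z = exp(L)]. The gamma integral
    of [t ^ (lam - 1) exp (- exp(L) t)] is [Gamma(lam) exp (- lam L)]; the series
    comes from writing [exp (- exp(L) t) = exp (- t) exp (z t)] and expanding the
    second factor. *)
Lemma ccvg_to_binomial lam L : 0 < lam -> `|complex.Im L| < pi / 2 ->
  normc (1 - cexp L) < 1 ->
  ccvg_to (csums (fun k => (bcoef lam k)%:C * (1 - cexp L) ^+ k)) (cexp (- (lam%:C * L))).
Proof.
move=> l0 Lpi; set z := 1 - cexp L; set r := normc z => r1.
have r0 : 0 <= r by exact: normc_ge0.
have mp : measurable (posR : set (measurableTypeR R)) by exact: measurable_itv.
pose w t := cpow t%:C (lam%:C - 1) * cexp (- t%:C).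
pose f (k : nat) t := w t * cexp_term (z * t%:C) k.
pose h (k : nat) t := r ^+ k / k`!%:R * expR ((lam + k%:R - 1) * ln t - t).
have lk (k : nat) : 0 < lam + k%:R by rewrite ltr_wpDr.
have lkC (k : nat) : 0 < complex.Re (lam%:C + k%:R) by rewrite Re_addn.
have G0 := rGamma_gt0 l0.
have GC0 : (rGamma lam)%:C != 0 :> R[i].
  by rewrite (inj_eq (@complexI R)) lt0r_neq0.
have cpk (k : nat) t : 0 < t ->
    cpow t%:C (lam%:C + k%:R - 1) = cpow t%:C (lam%:C - 1) * t%:C ^+ k.
  move=> t0; elim: k => [|k IH]; first by rewrite addr0 expr0 mulr1.
  have -> : lam%:C + k.+1%:R - 1 = lam%:C + k%:R - 1 + 1 by rewrite -natr1; ring.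
  by rewrite cpowS// IH exprS; ring.
pose g (k : nat) t := cpow t%:C (lam%:C + k%:R - 1) * cexp (- (1 * t%:C)).
have [gi gI] := all_and2 (fun k : nat => cintegral_power (lkC k) (ltr01 : 0 < complex.Re (1 : R[i]))).
have pow1 (s : R[i]) : cpow 1 s = 1.
  by rewrite /cpow (clog_gt0 ltr01) ln1 mulr0 cexp0.
have fE (k : nat) t : posR t -> z ^+ k / k`!%:R * g k t = f k t.
  move=> /posR_gt0 t0; rewrite /f /w /g cpk// mul1r /cexp_term exprMn; ring.
have hE (k : nat) t : posR t -> h k t = r ^+ k * t ^+ k / k`!%:R * expR ((lam - 1) * ln t - t).
  move=> /posR_gt0 t0; rewrite /h.
  have -> : (lam + k%:R - 1) * ln t - t = k%:R * ln t + ((lam - 1) * ln t - t) by ring.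
  by rewrite expRD expRM_natl lnK ?posrE//; ring.
have [fi fI] : (forall k, cintegrable posR (f k)) /\
    forall k, cintegral posR (f k) = z ^+ k / k`!%:R * cGamma (lam%:C + k%:R).
  pose gZ k := cintegralZ (z ^+ k / k`!%:R) mp (gi k).
  split=> k; first by apply: eq_cintegrable (gZ k).1 => // t; exact: fE.
  by rewrite -(eq_cintegral mp (fE k)) (gZ k).2 gI pow1 divr1.
have hi (k : nat) : mu.-integrable posR (EFin \o h k).
  by apply: integrable_EFinZ => //; exact: integrable_Gamma.
have wN t : 0 < t -> normc (w t) = expR ((lam - 1) * ln t - t).
  move=> t0; rewrite /w /cpow clog_gt0// -cexpD normc_cexp; congr expR.
  by rewrite /=; ring.
have fh (k : nat) t : posR t -> normc (f k t) <= h k t.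
  move=> pt; rewrite hE//; have t0 := posR_gt0 pt.
  rewrite /f normcM wN// normc_cexp_term normcM normc_real (gtr0_norm t0).
  by rewrite /exp_coeff/= exprMn mulrC.
have rk (k : nat) : Rintegral mu posR (h k) = rGamma lam * (r ^+ k * bcoef lam k).
  rewrite /h RintegralZl//; last exact: integrable_Gamma.
  rewrite -/(rGamma (lam + k%:R)) -bcoef_Gamma//.
  have : k`!%:R != 0 :> R by rewrite pnatr_eq0 -lt0n fact_gt0.
  by move: (k`!%:R : R) => q q0; field.
have [K KP] := bcoef_geom_bounded r0 r1 l0.
have hK N : \sum_(0 <= k < N) Rintegral mu posR (h k) <= rGamma lam * K.
  under eq_bigr do rewrite rk.
  by rewrite -mulr_sumr ler_wpM2l ?KP// ltW.
have hc t : posR t -> cvgn (series (h ^~ t)).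
  move=> pt; have t0 := posR_gt0 pt.
  have -> : series (h ^~ t) = fun N => expR ((lam - 1) * ln t - t) * series (exp_coeff (r * t)) N.
    apply/funext => N; rewrite /series/= mulr_sumr; apply: eq_bigr => k _.
    by rewrite hE// /exp_coeff/= exprMn mulrC.
  by apply: is_cvgMr; exact: is_cvg_series_exp_coeff.
have [I1 I2 I3] := csum_cintegral mp fi hi fh hK hc.
have sE t : posR t -> csum (f ^~ t) = cpow t%:C (lam%:C - 1) * cexp (- (cexp L * t%:C)).
  move=> pt; have t0 := posR_gt0 pt.
  have h1 := ccvg_to_cexp (z * t%:C).
  have h2 := ccvg_toM (ccvg_to_cst (w t)) h1.
  have -> : cpow t%:C (lam%:C - 1) * cexp (- (cexp L * t%:C)) = w t * cexp (z * t%:C).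
    rewrite /w -mulrA -cexpD; congr (_ * cexp _).
    by rewrite /z mulrBl mul1r addrA addNr add0r.
  apply: csum_ccvg_to; move: h2; congr ccvg_to; apply/funext => N.
  by rewrite /csums mulr_sumr.
have := ckernel_integral_cexp (s := lam%:C) l0 Lpi.
rewrite -(eq_cintegral (f := fun t => csum (f ^~ t)) mp sE) -I3 cGamma_real// => E.
have h1 := ccvg_toM (ccvg_to_cst (rGamma lam)%:C^-1) (ccvg_ccvg_to I2).
have -> : cexp (- (lam%:C * L)) = (rGamma lam)%:C^-1 *
    csum (fun k => cintegral posR (f k)).
  apply: (mulfI (cexp_neq0 (lam%:C * L))); rewrite -cexpD subrr cexp0.
  by rewrite mulrCA E mulVf.
move: h1; congr ccvg_to; apply/funext => N; rewrite /csums mulr_sumr.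
apply: eq_bigr => k _; rewrite fI natr_complex -rmorphD cGamma_real//.
rewrite -bcoef_Gamma// !rmorphM/= -natr_complex.
move: (factC_neq0 k) GC0; move: (k`!%:R : R[i]) (rGamma lam)%:C => q G q0 G0'.
by field; rewrite q0 G0'.
Qed.

End BinomialSeries.

(** * Moments of the Mittag-Leffler function for lam > 2 *)
Section Transform.
Context {R : realType}.
Implicit Types (t r lam eta rho c : R) (N : nat).
Local Notation mu := (@lebesgue_measure R).
Local Notation posR := `]0%R : R, +oo[%classic.
Local Notation normc := (@ComplexField.Normc.normc R).

Lemma mlterm_expR lam eta t (j : nat) : 0 < eta -> 0 < t ->
  mlterm lam (expR (lam * ln (eta * t))) j =
  (- expR (lam * ln eta)) ^+ j * expR (lam * j%:R * ln t) / rGamma (lam * j%:R + 1).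
Proof.
move=> e0 t0; rewrite /mlterm lnM ?posrE// mulrDr expRD -mulNr exprMn.
by congr (_ * _ / _); rewrite -expRM_natl; congr expR; ring.
Qed.

(** Termwise integration; bsum appears because
    [Gamma(lam j + 1 + N) / (N! Gamma(lam j + 1)) = bcoef (lam j + 1) N]. *)
Lemma mlfun_transform lam eta N : 0 < lam -> 0 < eta -> eta < 1 ->
  mu.-integrable posR (EFin \o fun t =>
    mlfun lam (expR (lam * ln (eta * t))) * (expR (N%:R * ln t - t) / N`!%:R)) /\
  Rintegral mu posR (fun t =>
    mlfun lam (expR (lam * ln (eta * t))) * (expR (N%:R * ln t - t) / N`!%:R)) =
  bsum (- expR (lam * ln eta)) lam 1 N.
Proof.
move=> l0 e0 e1; set rho := expR (lam * ln eta).
have rho0 : 0 < rho by exact: expR_gt0.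
have rho1 : `|- rho| < 1.
  by rewrite normrN gtr0_norm// /rho -expR0 ltr_expR pmulr_rlt0// ln_lt0// e0.
have lj (j : nat) : 0 < lam * j%:R + 1 by rewrite ltr_wpDl// mulr_ge0// ltW.
have NF : N`!%:R != 0 :> R by rewrite pnatr_eq0 -lt0n fact_gt0.
pose k (j : nat) := (- rho) ^+ j / rGamma (lam * j%:R + 1) / N`!%:R.
pose e (j : nat) t := expR ((lam * j%:R + 1 + N%:R - 1) * ln t - t).
pose f (j : nat) t := k j * e j t.
pose h (j : nat) t := `|k j| * e j t.
have mp : measurable (posR : set (measurableTypeR R)) by exact: measurable_itv.
have ei (j : nat) : mu.-integrable posR (EFin \o e j).
  by apply: integrable_Gamma; rewrite ltr_wpDr.
have fi (j : nat) : mu.-integrable posR (EFin \o f j) by exact: integrable_EFinZ.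
have hi (j : nat) : mu.-integrable posR (EFin \o h j) by exact: integrable_EFinZ.
have fh (j : nat) t : posR t -> `|f j t| <= h j t.
  by move=> _; rewrite /f /h normrM (ger0_norm (expR_ge0 _)).
have eI (j : nat) : Rintegral mu posR (e j) =
    bcoef (lam * j%:R + 1) N * (N`!%:R * rGamma (lam * j%:R + 1)).
  by rewrite bcoef_Gamma.
have fI (j : nat) : Rintegral mu posR (f j) = bterm (- rho) lam 1 N j.
  rewrite /f RintegralZl// eI /k /bterm.
  have := rGamma_gt0 (lj j); move/lt0r_neq0; move: (rGamma _) (N`!%:R : R) NF => G q q0 G0.
  by field; rewrite q0.
have hI (j : nat) : Rintegral mu posR (h j) = `|bterm (- rho) lam 1 N j|.
  rewrite -fI /h /f RintegralZl// [in RHS]RintegralZl// [in RHS]normrM; congr (_ * _).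
  rewrite ger0_norm// eI mulr_ge0 ?bcoef_ge0 ?ltW//.
  by rewrite mulr_gt0 ?rGamma_gt0// ltr0n fact_gt0.
have cv := @bterm_norm_cvg R (- rho) lam 1 N rho1 (ltW l0) ler01.
have hK M : \sum_(0 <= j < M) Rintegral mu posR (h j) <=
    limn (series (fun j => `|bterm (- rho) lam 1 N j|)).
  under eq_bigr do rewrite hI.
  apply: (nondecreasing_cvgn_le _ cv M).
  by apply: nondecreasing_series => *.
have fS t : posR t -> forall j : nat,
   f j t = mlterm lam (expR (lam * ln (eta * t))) j * (expR (N%:R * ln t - t) / N`!%:R).
  move=> /posR_gt0 t0 j; rewrite /f /e /k mlterm_expR//.
  have -> : (lam * j%:R + 1 + N%:R - 1) * ln t - t =
     lam * j%:R * ln t + (N%:R * ln t - t) by ring.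
  by rewrite expRD; ring.
have mlc t := mlterm_norm_cvg l0 (expR_ge0 (lam * ln (eta * t))).
have hc t : posR t -> cvgn (series (h ^~ t)).
  move=> pt; have -> : series (h ^~ t) = fun M => expR (N%:R * ln t - t) / N`!%:R *
     series (fun j => `|mlterm lam (expR (lam * ln (eta * t))) j|) M.
    apply/funext => M; rewrite /series/= mulr_sumr; apply: eq_bigr => j _.
    rewrite /h -[e j t]ger0_norm ?expR_ge0// -normrM -/(f j t) fS// normrM mulrC.
    by congr (_ * _); rewrite ger0_norm// divr_ge0 ?expR_ge0.
  by apply: is_cvgMr; exact: mlc.
have sE t : posR t -> limn (series (f ^~ t)) =
    mlfun lam (expR (lam * ln (eta * t))) * (expR (N%:R * ln t - t) / N`!%:R).
  move=> pt; apply/cvg_lim => //.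
  have -> : series (f ^~ t) = fun M =>
     series (mlterm lam (expR (lam * ln (eta * t)))) M * (expR (N%:R * ln t - t) / N`!%:R).
    by apply/funext => M; rewrite /series/= mulr_suml; apply: eq_bigr => j _; rewrite fS.
  by apply: cvgMl; apply: (@normed_cvg R R); exact: mlc.
have [I1 I2] := integral_series mp fi hi fh hK hc; split.
  by apply: eq_integrable I1 => // t; rewrite inE => /sE /= ->.
transitivity (Rintegral mu posR (fun t => limn (series (f ^~ t)))).
  by apply: eq_Rintegral => t; rewrite inE => /sE ->.
by rewrite -(cvg_lim _ I2)//; congr (limn (series _)); apply/funext => j; rewrite fI.
Qed.

Lemma exp_coeff_sum_le (x : R) (M : nat) : 0 <= x ->
  \sum_(0 <= k < M) exp_coeff x k <= expR x.
Proof.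
move=> x0; apply: (nondecreasing_cvgn_le _ (@is_cvg_series_exp_coeff R x) M).
apply: nondecreasing_series => k _ _.
by rewrite /exp_coeff/= divr_ge0// exprn_ge0.
Qed.

(** The sum over N of [(r t) ^ N / N!] is [exp (r t)], so the generating series of
    the moments of mlfun is dominated by a Laplace integral. *)
Lemma bsum_geom_bounded lam eta r : 0 < lam -> 0 < eta -> eta < 1 -> 0 <= r ->
  mu.-integrable posR (EFin \o fun t =>
    mlfun lam (expR (lam * ln (eta * t))) * expR (- ((1 - r) * t))) ->
  exists K, forall M : nat,
    \sum_(0 <= N < M) `|bsum (- expR (lam * ln eta)) lam 1 N| * r ^+ N <= K.
Proof.
move=> l0 e0 e1 r0 wi.
have mp : measurable (posR : set (measurableTypeR R)) by exact: measurable_itv.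
pose u t := mlfun lam (expR (lam * ln (eta * t))).
pose v N t := u t * (expR (N%:R * ln t - t) / N`!%:R).
have [vi vI] := all_and2 (fun N => mlfun_transform N l0 e0 e1).
have ni N : mu.-integrable posR (EFin \o fun t => `|v N t|).
  exact: (integrable_norm (vi N)).
pose f N t := r ^+ N * `|v N t|.
have fi N : mu.-integrable posR (EFin \o f N) by exact: integrable_EFinZ.
have wn : mu.-integrable posR (EFin \o fun t => `|u t * expR (- ((1 - r) * t))|).
  exact: (integrable_norm wi).
exists (Rintegral mu posR (fun t => `|u t * expR (- ((1 - r) * t))|)) => M.
have [S1 S2] := Rintegral_sum_nat mp M fi.
apply: (@le_trans _ _ (\sum_(0 <= N < M) Rintegral mu posR (f N))).
  apply: ler_sum => N _; rewrite /f RintegralZl// mulrC ler_wpM2l ?exprn_ge0//.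
  by rewrite -vI le_normr_Rintegral.
rewrite -S2; apply: le_Rintegral => // t pt; have t0 := posR_gt0 pt.
rewrite normrM (ger0_norm (expR_ge0 _)).
have -> : \sum_(0 <= k < M) f k t =
    `|u t| * expR (- t) * \sum_(0 <= k < M) exp_coeff (r * t) k.
  rewrite mulr_sumr; apply: eq_bigr => N _.
  rewrite /f /v normrM [`|_ / _|]ger0_norm ?divr_ge0 ?expR_ge0//.
  rewrite expRD expRM_natl lnK ?posrE// /exp_coeff/= exprMn; ring.
have -> : - ((1 - r) * t) = - t + r * t by ring.
rewrite expRD mulrA ler_wpM2l ?mulr_ge0 ?expR_ge0//.
by rewrite exp_coeff_sum_le// mulr_ge0// ltW.
Qed.

Lemma cos_sin_pi_div lam : 2 < lam ->
  [/\ 0 < cos (pi / lam), cos (pi / lam) < 1, 0 < sin (pi / lam) & sin (pi / lam) < 1].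
Proof.
move=> l2; have l0 : 0 < lam by lra.
have p0 : 0 < pi / lam by rewrite divr_gt0// pi_gt0.
have p2 : pi / lam < pi / 2 by rewrite ltr_pM2l ?pi_gt0// ltf_pV2 ?posrE.
have c0 : 0 < cos (pi / lam).
  apply: cos_gt0_pihalf; rewrite p2 andbT.
  by rewrite (lt_trans _ p0)// oppr_lt0 divr_gt0// pi_gt0.
have s0 : 0 < sin (pi / lam).
  apply: sin_gt0_pi; rewrite p0/= (lt_trans p2)//.
  by rewrite ltr_pdivrMr ?ltr_pMr ?pi_gt0// ltr1n.
split=> //.
  rewrite -(cos0 R) ltr_cos// in_itv/= ?lexx ?(ltW p0) ?(ltW (pi_gt0 R))//=.
  by rewrite ler_pdivrMr// ler_peMr ?(ltW (pi_gt0 R))//; lra.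
rewrite -(@ltr_pXn2r _ 2)// ?nnegrE ?(ltW s0)// expr1n -(cos2Dsin2 (pi / lam)).
by rewrite ltrDr exprn_gt0.
Qed.

(** Let V N be the moments of mlfun_transform, [zeta = eta ^ lam] and
    [phi = pi / lam]. If the Laplace integral converged, the series V(z) would
    converge absolutely for [|z| = sin phi], and
    [V(z) (1 + zeta (1 - z) ^ (- lam)) = 1 / (1 - z)] would hold at
    [w = 1 - eta exp (i phi)], which has norm [sin phi]. But
    [(eta exp (i phi)) ^ (- lam) = - 1 / zeta], so the left-hand side vanishes
    there. *)
Lemma mlfun_not_integrable lam : 2 < lam ->
  let eta := cos (pi / lam) in
  ~ mu.-integrable posR (EFin \o fun t =>
    mlfun lam (expR (lam * ln (eta * t))) * expR (- ((1 - sin (pi / lam)) * t))).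
Proof.
move=> l2 eta; have l0 : 0 < lam by lra.
have [e0 e1 r0 r1] := cos_sin_pi_div l2.
rewrite -/eta in e0 e1; set phi := pi / lam in eta e0 e1 r0 r1 *; set r := sin phi in r0 r1 *.
have phi0 : 0 < phi by rewrite divr_gt0// pi_gt0.
have phi2 : phi < pi / 2 by rewrite ltr_pM2l ?pi_gt0// ltf_pV2 ?posrE.
have cs : eta ^+ 2 + r ^+ 2 = 1 by exact: cos2Dsin2.
move=> /(bsum_geom_bounded l0 e0 e1 (ltW r0)) [K KP].
set zeta := expR (lam * ln eta) in KP; have z0 : 0 < zeta by exact: expR_gt0.
have z1 : `|- zeta| < 1.
  by rewrite normrN gtr0_norm// /zeta -expR0 ltr_expR pmulr_rlt0// ln_lt0// e0.
(* exp L = eta exp (i phi) has real part eta ^ 2 = 1 - (sin phi) ^ 2, so 1 - exp L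
   has norm sin phi. *)
pose L := ln eta +i* phi.
have eL : cexp L = (eta ^+ 2) +i* (eta * r).
  by rewrite cexpE/= lnK ?posrE//.
pose w := 1 - cexp L.
have nw : normc w = r.
  rewrite /w eL normcE/=.
  have -> : (1 - eta ^+ 2) ^+ 2 + (0 - eta * r) ^+ 2 = r ^+ 2.
    have e2 : eta ^+ 2 = 1 - r ^+ 2 by rewrite -cs addrK.
    rewrite -[0 - _]/(0 - eta * r) sub0r sqrrN exprMn e2; ring.
  by rewrite sqrtr_sqr gtr0_norm.
have Lpi : `|complex.Im L| < pi / 2 by rewrite /= gtr0_norm.
have wL1 : normc (1 - cexp L) < 1 by rewrite -/w nw.
have pw : cexp (- (lam%:C * L)) = - (zeta^-1)%:C.
  have -> : - (lam%:C * L) = (- (lam * ln eta)) +i* (- pi).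
    have <- : lam * phi = pi by rewrite /phi mulrC divfK// lt0r_neq0.
    by apply/eqP; rewrite eq_complex/=; apply/andP; split; apply/eqP; ring.
  by rewrite cexpE cosN sinN cospi sinpi oppr0 expRN; simpc.
have h1 := ccvg_to_binomial l0 Lpi wL1; rewrite pw -/w in h1.
pose a (k : nat) : R[i] := (bcoef lam k)%:C * w ^+ k.
pose V (k : nat) : R := bsum (- zeta) lam 1 k.
pose v (k : nat) : R[i] := (V k)%:C * w ^+ k.
have na : cvgn (series (fun k => normc (a k))).
  have [Ka KaP] := bcoef_geom_bounded (ltW r0) r1 l0.
  apply: (@cvgn_nneg_bounded _ _ Ka) => [k|N]; first exact: normc_ge0.
  apply: le_trans (KaP N); apply: ler_sum => k _.
  by rewrite /a normcM normcX nw normc_real ger0_norm ?bcoef_ge0 ?(ltW l0)// mulrC.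
have nv : cvgn (series (fun k => normc (v k))).
  apply: (@cvgn_nneg_bounded _ _ K) => [k|N]; first exact: normc_ge0.
  apply: le_trans (KP N); apply: ler_sum => k _.
  by rewrite /v normcM normcX nw normc_real.
have cv : ccvg v.
  split; apply: (@normed_cvg R R); apply: (series_le_cvg _ _ _ nv) => k //=;
    by rewrite ?normc_ge0 ?norm_Re_le ?norm_Im_le.
have h2 := ccvg_to_conv na nv h1 (ccvg_ccvg_to cv).
have h3 := ccvg_toD (ccvg_toM (ccvg_to_cst zeta%:C) h2) (ccvg_ccvg_to cv).
have {h3} h3 : ccvg_to (csums (fun n => w ^+ n)) 0.
  have e : zeta%:C * (- (zeta^-1)%:C * csum v) + csum v = 0.
    rewrite mulNr mulrN mulrA -rmorphM/= divff ?lt0r_neq0//.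
    by rewrite mul1r addNr.
  rewrite e in h3; move: h3; congr ccvg_to; apply/funext => M.
  rewrite /csums mulr_sumr -big_split/=; apply: eq_bigr => n _.
  have VE : V n = 1 - zeta * \sum_(k < n.+1) bcoef lam k * V (n - k)%N.
    by rewrite bsum_conv ?(ltW l0)// /V bsum_shift ?(ltW l0)// bcoef1 mulNr.
  have cE : cconv a v n = (\sum_(k < n.+1) bcoef lam k * V (n - k)%N)%:C * w ^+ n.
    rewrite /cconv big_mkord rmorph_sum mulr_suml; apply: eq_bigr => -[k /= kn] _.
    by rewrite /a /v mulrACA -exprD subnKC// rmorphM.
  rewrite cE /v VE mulrA -rmorphM -mulrDl -rmorphD.
  by rewrite addrC subrK mul1r.
have h4 := ccvg_toM (ccvg_to_cst (1 - w)) h3; rewrite mulr0 in h4.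
have h5 : ccvg_to (fun n => (1 - w) * csums (fun n => w ^+ n) n) 1.
  have -> : (fun n => (1 - w) * csums (fun n => w ^+ n) n) = fun n => 1 + - w ^+ n.
    apply/funext => n; rewrite /csums big_mkord; have := subrX1 w n => e.
    by rewrite -opprB mulNr -e opprB.
  rewrite -[X in ccvg_to _ X]addr0; apply: ccvg_toD; first exact: ccvg_to_cst.
  apply: ccvg_to_normc0.
  have -> : (fun n => normc (- w ^+ n)) = fun n => r ^+ n.
    by apply/funext => n; rewrite -nw -normcX normcE [in RHS]normcE; case: (w ^+ n) => x y /=; rewrite !sqrrN.
  by apply: cvg_expr; rewrite ger0_norm// ltW.
by have := ccvg_to_unique h4 h5 => /eqP; rewrite eq_sym oner_eq0.
Qed.

End Transform.

(** * Continuity of the Mittag-Leffler function and change of variables *)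
Section Substitution.
Context {R : realType}.
Implicit Types (x y t lam c : R).
Local Notation mu := (@lebesgue_measure R).

(** The factor k + 1 is absorbed by doubling the radius. *)
Lemma pseries_diffs_cvg (f : nat -> R) : (forall x, cvgn (pseries f x)) ->
  forall x, cvgn (pseries (pseries_diffs f) x).
Proof.
move=> fc x; pose z := 2 * (`|x| + 1); have z0 : 0 < z by rewrite mulr_gt0// ltr_wpDl.
have nc : cvgn (pseries (fun i => `|f i|) z).
  by apply: (is_cvg_pseries_inside_norm (fc (z + 1))); rewrite !gtr0_norm ?addr_gt0// ltrDl.
apply: (@normed_cvg R R).
apply: (@cvgn_nneg_bounded _ _ (limn (pseries (fun i => `|f i|) z))) => [k|N].
  exact: normr_ge0.
apply: le_trans (nondecreasing_cvgn_le _ nc N.+1); last first.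
  by apply: nondecreasing_series => k _ _; rewrite mulr_ge0// exprn_ge0// ltW.
rewrite /pseries /series/= [leRHS]big_nat_recl//= -[leLHS]add0r lerD ?mulr_ge0//.
apply: ler_sum => j _; rewrite /pseries_diffs !normrM normrX mulrAC mulrC ler_wpM2l//.
rewrite ger0_norm// /z exprMn ler_pM ?exprn_ge0//.
  by rewrite -natrX ler_nat ltnW// ltn_expl.
rewrite exprS -[leLHS]mul1r ler_pM ?exprn_ge0 ?lerDr//.
by rewrite lerXn2r ?nnegrE ?addr_ge0// lerDl.
Qed.

Lemma mlfun_continuous lam : 0 < lam -> continuous (mlfun lam).
Proof.
move=> l0; pose f (j : nat) : R := (-1) ^+ j / rGamma (lam * j%:R + 1).
have fE x : pseries f x = series (mlterm lam x).
  apply/funext => N; apply: eq_bigr => j _.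
  by rewrite /f /mlterm (exprNn x) mulrAC.
have fc x : cvgn (pseries f x).
  apply: (@is_cvg_pseries_inside _ _ (`|x| + 1)).
    rewrite fE; apply: (@normed_cvg R R); apply: mlterm_norm_cvg => //.
  by rewrite [ltRHS]ger0_norm ?addr_ge0// ltrDl.
have f1 := pseries_diffs_cvg fc; have f2 := pseries_diffs_cvg f1.
move=> x; have xx : `|x| < `| `|x| + 1|.
  by rewrite [ltRHS]ger0_norm ?addr_ge0// ltrDl.
have := pseries_snd_diffs (fc _) (f1 _) (f2 _) xx.
have -> : (fun x => limn (pseries f x)) = mlfun lam by apply/funext => y; rewrite fE.
by move=> ?; apply/differentiable_continuous/derivable1_diffP.
Qed.

Lemma mlfun_bounded lam x y : 0 < lam -> 0 <= x -> x <= y ->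
  `|mlfun lam x| <= limn (series (fun j => `|mlterm lam y j|)).
Proof.
move=> l0 x0 xy; have y0 := le_trans x0 xy.
have cx := mlterm_norm_cvg l0 x0; have cy := mlterm_norm_cvg l0 y0.
apply: le_trans (lim_series_norm cx) _.
apply: (lim_series_le cx cy) => j; rewrite !normrM ler_wpM2r// !normrX !normrN.
by rewrite lerXn2r ?nnegrE// !ger0_norm.
Qed.

Lemma smooth_substitution (F f G : R -> R) a b : a < b ->
  {in `[a, b], forall t : R, is_derive t 1 F (f t)} ->
  {in `[a, b], forall t : R, {for t, continuous f}} ->
  {in `[a, b] &, {homo F : x y / (x < y)%R}} ->
  {within `[F a, F b], continuous G} ->
  (\int[mu]_(x in `[F a, F b]) (G x)%:E =
   \int[mu]_(t in `[a, b]) (G (F t) * f t)%:E)%E.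
Proof.
move=> ab dF cf incF cG.
have aab : a \in `[a, b] by rewrite in_itv/= lexx ltW.
have bab : b \in `[a, b] by rewrite in_itv/= lexx ltW.
have FE t : t \in `[a, b] -> (F^`())%classic t = f t.
  by move=> tab; have tF := dF t tab; rewrite derive1E derive_val.
have sub t : t \in `]a, b[ -> t \in `[a, b] by exact: subset_itv_oo_cc.
have cF t : t \in `[a, b] -> {for t, continuous F}.
  by move=> /dF ?; apply/differentiable_continuous/derivable1_diffP.
rewrite (integration_by_substitution_increasing (ltW ab) incF)//.
- by apply: eq_integral => t; rewrite inE /= => tab; rewrite -(FE _ tab).
- move=> t tab; rewrite /continuous_at FE; last exact: sub.
  apply: cvg_trans (cf t (sub _ tab)); apply: near_eq_cvg.
  near=> s; rewrite FE//; apply: sub; near: s; exact: near_in_itvoo.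
- apply/cvg_ex; exists (f a).
  have : f t @[t --> a^'+] --> f a by apply: cvg_at_right_filter; exact: cf.
  apply: cvg_trans; apply: near_eq_cvg; near=> s; rewrite FE// in_itv/=.
  by apply/andP; split; [near: s; exact: nbhs_right_ge|near: s; exact: nbhs_right_le].
- apply/cvg_ex; exists (f b).
  have : f t @[t --> b^'-] --> f b by apply: cvg_at_left_filter; exact: cf.
  apply: cvg_trans; apply: near_eq_cvg; near=> s; rewrite FE// in_itv/=.
  by apply/andP; split; [near: s; exact: nbhs_left_ge|near: s; exact: nbhs_left_le].
- split.
  + by move=> t tab; have [] := dF t (sub _ tab).
  + by apply: cvg_at_right_filter; exact: cF.
  + by apply: cvg_at_left_filter; exact: cF.
Unshelve. all: by end_near. Qed.

End Substitution.

(** * From the beta integral to a Laplace integral *)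
Section Transfer.
Context {R : realType}.
Implicit Types (x y t lam c q X Y : R).
Local Notation mu := (@lebesgue_measure R).
Local Notation lmu :=
  (@lebesgue_measure R : {measure set (measurableTypeR R) -> \bar R}).
Local Notation posR := `]0%R : R, +oo[%classic.
Local Notation I01 := (`]0%R : R, 1%R[%classic).

(** The s > 0 with s ^ lam = exp q / (t (1 - t)). *)
Definition warp lam q t : R := expR ((q - ln t - ln (1 - t)) / lam).

Definition dwarp lam q t : R := warp lam q t * (((1 - t)^-1 - t^-1) / lam).

Lemma is_derive_warp lam q t : 0 < t -> t < 1 ->
  is_derive t 1 (warp lam q) (dwarp lam q t).
Proof.
move=> t0 t1; have dln := is_derive1_ln t0.
have s0 : 0 < 1 - t by rewrite subr_gt0.
have dln1 : is_derive (1 - t) 1 (@ln R) (1 - t)^-1 := is_derive1_ln s0.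
have dc : is_derive t 1 (@ln R \o (cst 1 - id)) ((1 - t)^-1 * (0 - 1)).
  by apply: is_derive_eq.
pose G : R -> R := expR \o (lam^-1 *: (cst q - @ln R - (@ln R \o (cst 1 - id)))).
have -> : warp lam q = G.
  by apply/funext => s; rewrite /warp /G !fctE/= /GRing.scale/= mulrC.
apply: is_derive_eq.
rewrite /dwarp /warp !fctE/= /GRing.scale/= (mulrC lam^-1).
ring.
Qed.

Lemma dwarp_continuous lam q t : 0 < t -> t < 1 -> {for t, continuous (dwarp lam q)}.
Proof.
move=> t0 t1; apply: cvgM.
  have dw := is_derive_warp lam q t0 t1.
  by apply/differentiable_continuous/derivable1_diffP.
apply: cvgMl; apply: cvgB.
  by apply: cvgV; [rewrite subr_eq0 gt_eqF|apply: cvgB; [exact: cvg_cst|exact: cvg_id]].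
by apply: cvgV; [rewrite gt_eqF|exact: cvg_id].
Qed.

Lemma warp_increasing lam q b : 0 < lam -> b < 1 ->
  {in `[2^-1, b] &, {homo warp lam q : x y / x < y}}.
Proof.
move=> l0 b1 x y; rewrite !in_itv/= => /andP[x2 xb] /andP[y2 yb] xy.
rewrite ltr_expR ltr_pM2r ?invr_gt0// -!addrA ltrD2l -!opprD ltrN2.
rewrite -!lnM ?posrE; try lra.
rewrite ltr_ln ?posrE ?mulr_gt0; try lra.
nra.
Qed.

(** The exponential beats any power of 1 - t, because 1 / (1 - t) is at most a
    constant times (warp t) ^ lam. *)
Lemma dwarp_decay lam q c X Y : 0 < lam -> 0 < c -> exists2 C, 0 <= C &
  forall t, 2^-1 <= t -> t < 1 ->
  dwarp lam q t * expR (- (c * warp lam q t)) <=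
  C * expR (X * ln t + Y * ln (1 - t)).
Proof.
move=> l0 c0; pose m := 1 + `|1 + Y| * lam.
have m0 : 0 < m by rewrite ltr_wpDr// mulr_ge0// ltW.
pose K := `|X| * ln 2 - `|1 + Y| * q + m * (ln (m / c) - 1).
exists (lam^-1 * expR K) => [|t t2 t1]; first by rewrite mulr_ge0 ?expR_ge0 ?invr_ge0 ?ltW.
have t0 : 0 < t by apply: lt_le_trans t2.
have s0 : 0 < 1 - t by rewrite subr_gt0.
have lt : ln t <= 0 by rewrite ln_le0// ltW.
have ls : ln (1 - t) <= 0 by rewrite ln_le0// gerBl ltW.
have l2 : - ln t <= ln 2.
  by rewrite -lnV ?posrE// ler_ln ?posrE ?invr_gt0// -[leRHS]invrK lef_pV2 ?posrE ?invr_gt0.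
set g := warp lam q t; have g0 : 0 < g by exact: expR_gt0.
have lg : lam * ln g = q - ln t - ln (1 - t).
  by rewrite /g /warp expRK mulrC divfK// lt0r_neq0.
have h1 : dwarp lam q t <= lam^-1 * expR (ln g - ln (1 - t)).
  rewrite /dwarp -/g expRD lnK ?posrE// expRN lnK ?posrE// mulrCA [leLHS]mulrA mulrC.
  rewrite ler_wpM2l ?invr_ge0 ?(ltW l0)// mulrC ler_wpM2l ?(ltW g0)//.
  by rewrite gerBl invr_ge0 ltW.
apply: le_trans (ler_wpM2r (expR_ge0 _) h1) _.
rewrite -!mulrA ler_wpM2l ?invr_ge0 ?(ltW l0)// -!expRD ler_expR.
have h2 := ln_sub_linear_le m0 c0 g0.
have h3 : - X * ln t <= `|X| * ln 2.
  rewrite mulNr -mulrN; apply: (@le_trans _ _ (`|X| * - ln t)).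
    by rewrite ler_wpM2r ?oppr_ge0// ler_norm.
  by rewrite ler_wpM2l.
have h4 : - (1 + Y) * ln (1 - t) <= `|1 + Y| * (lam * ln g - q).
  rewrite mulNr -mulrN; apply: (@le_trans _ _ (`|1 + Y| * - ln (1 - t))).
    by rewrite ler_wpM2r ?oppr_ge0// ler_norm.
  by rewrite ler_wpM2l// lg; lra.
have e1 : m * ln g = ln g + `|1 + Y| * (lam * ln g) by rewrite /m; ring.
have e2 : `|1 + Y| * (lam * ln g - q) = `|1 + Y| * (lam * ln g) - `|1 + Y| * q by ring.
have e3 : - (1 + Y) * ln (1 - t) = - ln (1 - t) - Y * ln (1 - t) by ring.
move: h2 h3 h4; rewrite /K e1 e2 e3 mulNr; clear; lra.
Qed.

Lemma warp_half_lt lam q t : 0 < lam -> 2^-1 < t -> t < 1 ->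
  warp lam q 2^-1 < warp lam q t.
Proof.
move=> l0 t2 t1; apply: (warp_increasing q l0 t1) => //;
  by rewrite in_itv/= ?lexx ?ltW.
Qed.

Lemma warp_unbounded lam q y : 0 < lam -> exists2 b, 2^-1 < b < 1 & y <= warp lam q b.
Proof.
move=> l0; pose s := Num.min (4^-1) (expR (q - lam * y)).
have s0 : 0 < s by rewrite lt_min expR_gt0 invr_gt0 ltr0n.
have s4 : s <= 4^-1 by rewrite ge_min lexx.
have sq : ln s <= q - lam * y.
  by rewrite -[leRHS]expRK ler_ln ?posrE ?expR_gt0// ge_min lexx orbT.
exists (1 - s); first by apply/andP; split; lra.
have lt : ln (1 - s) <= 0 by rewrite ln_le0// gerBl ltW.
apply: le_trans (expR_ge1Dx _); rewrite subKr.
have -> : (q - ln (1 - s) - ln s) / lam = y + (q - ln (1 - s) - ln s - lam * y) / lam.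
  by field; rewrite lt0r_neq0.
have : 0 <= (q - ln (1 - s) - ln s - lam * y) / lam.
  by rewrite divr_ge0 ?(ltW l0)//; lra.
lra.
Qed.

(** Substitute [s = warp t] with [q = ln p - lam ln eta], which turns
    [mlfun (exp (lam ln (eta s)))] into [mlfun (p / (t (1 - t)))]: the part
    [s >= warp (1 / 2)] of the integral is at most a constant times the integral of
    N. For smaller s the Mittag-Leffler function is bounded. *)
Lemma laplace_integrable lam eta c p X Y (N : R -> R) :
  0 < lam -> 0 < eta -> 0 < c -> 0 < p ->
  mu.-integrable I01 (EFin \o N) ->
  (forall t, 0 < t < 1 -> expR (X * ln t + Y * ln (1 - t)) *
     `|mlfun lam (p / (t * (1 - t)))| <= N t) ->
  mu.-integrable posR (EFin \o fun t =>
    mlfun lam (expR (lam * ln (eta * t))) * expR (- (c * t))).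
Proof.
move=> l0 e0 c0 p0 Ni NP.
pose u (t : R) : R := mlfun lam (expR (lam * ln (eta * t))).
have mu_ : measurable_fun setT (fun t : R => u t * expR (- (c * t))).
  apply: measurable_funM.
    apply: (measurableT_comp (f := mlfun lam)).
      by apply: continuous_measurable_fun; exact: mlfun_continuous.
    apply: measurableT_comp => //; apply: measurable_funM => //.
    by apply: measurableT_comp; [exact: measurable_ln|exact: measurable_funM].
  by apply: measurableT_comp => //; apply: measurableT_comp => //; exact: measurable_funM.
pose f (t : R) : R := `|u t * expR (- (c * t))|.
have mf : measurable_fun setT f by exact: measurableT_comp.
have f0 t : 0 <= f t by exact: normr_ge0.
pose q := ln p - lam * ln eta.
have [C C0 CP] := dwarp_decay q X Y l0 c0.
pose A := warp lam q 2^-1; have A0 : 0 < A by exact: expR_gt0.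
pose M : R := limn (series (fun j => `|mlterm lam (expR (lam * ln (eta * A))) j|)).
have N0 t : 0 < t < 1 -> 0 <= N t.
  by move=> t01; apply: le_trans (NP t t01); rewrite mulr_ge0 ?expR_ge0.
have fM t : 0 < t -> t <= A -> f t <= M.
  move=> t0 tA; rewrite /f normrM (ger0_norm (expR_ge0 _)).
  apply: (@le_trans _ _ `|u t|).
    by rewrite ler_piMr// -expR0 ler_expR oppr_le0 mulr_ge0 ?ltW.
  apply: mlfun_bounded => //; rewrite ?expR_ge0// ler_expR ler_wpM2l ?(ltW l0)//.
  by rewrite ler_ln ?posrE ?mulr_gt0// ler_wpM2l ?(ltW e0).
have bnd (n : nat) :
    (\int[mu]_(t in `[((n.+1%:R)^-1)%R, (n.+1%:R)%R]%classic) (f t)%:E <=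
     (M * A + C * Rintegral mu I01 N)%:E)%E.
  (* The interval is covered by ]0, A[, where f is bounded, and [A, warp b]. *)
  have [b /andP[b2 b1] nb] := warp_unbounded q n.+1%:R l0.
  have Ab : A < warp lam q b by exact: warp_half_lt.
  pose U := `]0%R, A[%classic : set (measurableTypeR R).
  pose V := `[A, warp lam q b]%classic : set (measurableTypeR R).
  have mU : measurable U by exact: measurable_itv.
  have mV : measurable V by exact: measurable_itv.
  have mfE D : measurable_fun (D : set (measurableTypeR R)) (EFin \o f).
    by apply/measurable_EFinP; exact: measurable_funTS.
  apply: (@le_trans _ _ (\int[lmu]_(t in U `|` V) (f t)%:E)%E).
    apply: (@ge0_subset_integral _ _ _ lmu) => //.
    - exact: measurableU.
    - by move=> t _; rewrite lee_fin.
    move=> t; rewrite /= in_itv/= => /andP[n1 n2].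
    have t0 : 0 < t by apply: lt_le_trans n1; rewrite invr_gt0.
    rewrite /U /V /= !in_itv/= t0/=; case: (ltP t A) => tA; [by left|right].
    exact: le_trans nb.
  rewrite ge0_integral_setU//; last 2 first.
  - by move=> t _; rewrite lee_fin.
  - apply/disj_setPS => t; rewrite /U /V /= !in_itv/= => -[/andP[_ h1] /andP[h2 _]].
    by move: (lt_le_trans h1 h2); rewrite ltxx.
  have M0 : 0 <= M by apply: le_trans (f0 A) (fM A A0 (lexx _)).
  rewrite EFinD; apply: leeD.
    apply: (@le_trans _ _ (\int[lmu]_(t in U) (M%:E))%E).
      apply: ge0_le_integral => //; first by move=> t _; rewrite lee_fin.
      move=> t; rewrite /U /= in_itv/= lee_fin => /andP[t0 tA].
      by apply: fM => //; exact: ltW.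
    rewrite integral_cst// /U/= lebesgue_measure_itv/= lte_fin A0.
    by rewrite sube0 -EFinM.
  have cf t : 0 < t -> {for t, continuous f}.
    move=> t0.
    have c1 : {for t, continuous (fun s : R => lam * ln (eta * s))}.
      apply: cvgMr; apply: (@continuous_comp _ _ _ (fun s : R => eta * s) (@ln R)).
        by apply: cvgMr; exact: cvg_id.
      by apply: continuous_ln; rewrite mulr_gt0.
    have c2 : {for t, continuous (fun s : R => - (c * s))}.
      by apply: cvgN; apply: cvgMr; exact: cvg_id.
    have c3 := continuous_comp c1 (@continuous_expR R _).
    have c4 := continuous_comp c3 (@mlfun_continuous R lam l0 _).
    have c5 := continuous_comp c2 (@continuous_expR R _).
    by apply: cvg_norm; exact: (cvgM c4 c5).
  have bP t : t \in `[2^-1, b] -> [/\ 0 < t, t < 1 & 2^-1 <= t].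
    rewrite in_itv/= => /andP[h1 h2]; split=> //.
      by apply: lt_le_trans h1; rewrite invr_gt0.
    exact: le_lt_trans b1.
  have d1 : {in `[2^-1, b], forall t : R, is_derive t 1 (warp lam q) (dwarp lam q t)}.
    by move=> t /bP[? ? _]; exact: is_derive_warp.
  have d2 : {in `[2^-1, b], forall t : R, {for t, continuous (dwarp lam q)}}.
    by move=> t /bP[? ? _]; exact: dwarp_continuous.
  have sub := smooth_substitution b2 d1 d2 (warp_increasing q l0 b1)
    (@continuous_at_within_itv R f A (warp lam q b) A0 cf).
  have mI : measurable (I01 : set (measurableTypeR R)) by exact: measurable_itv.
  have CNi : mu.-integrable I01 (EFin \o fun t => C * N t) by exact: integrable_EFinZ.
  have NE : (\int[mu]_(t in I01) (C * N t)%:E = (C * Rintegral mu I01 N)%:E)%E.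
    by rewrite -RintegralZl// /Rintegral fineK//; exact: (integrable_fin_num mI CNi).
  rewrite -NE.
  pose B := `[2^-1, b]%classic : set (measurableTypeR R).
  have mB : measurable B by exact: measurable_itv.
  have BI : B `<=` I01 by move=> t /bP[t0 t1 _]; rewrite /= in_itv/= t0.
  have mCN := measurable_int _ CNi.
  apply: (@le_trans _ _ (\int[lmu]_(t in B) (C * N t)%:E)%E); last first.
    apply: (@ge0_subset_integral _ _ _ lmu) => //.
    by move=> t /I01P t01; rewrite lee_fin mulr_ge0// N0.
  have dN t : t \in `[2^-1, b] -> 0 <= dwarp lam q t.
    move=> /bP[t0 t1 t2]; rewrite mulr_ge0 ?expR_ge0// divr_ge0 ?(ltW l0)//.
    by rewrite subr_ge0 lef_pV2 ?posrE ?subr_gt0//; lra.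
  have cB : {within `[2^-1, b], continuous (fun t => f (warp lam q t) * dwarp lam q t)}.
    apply: continuous_in_subspaceT => t; rewrite inE => tB.
    have [t0 t1 _] := bP t tB; apply: cvgM; last exact: d2.
    apply: (@continuous_comp _ _ _ (warp lam q) f); last by apply: cf; exact: expR_gt0.
    by have ? := d1 t tB; apply/differentiable_continuous/derivable1_diffP.
  rewrite sub; apply: (@ge0_le_integral _ _ _ lmu) => //.
  - by move=> t tB; rewrite lee_fin mulr_ge0// dN.
  - by apply/measurable_EFinP; exact: subspace_continuous_measurable_fun.
  - by apply: measurable_funS mCN.
  move=> t tB; have [t0 t1 t2] := bP t tB.
  have t01 : 0 < t < 1 by rewrite t0.
  have s0 : 0 < 1 - t by rewrite subr_gt0.
  rewrite lee_fin; apply: le_trans (ler_wpM2l C0 (NP t t01)).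
  have -> : f (warp lam q t) = `|mlfun lam (p / (t * (1 - t)))| * expR (- (c * warp lam q t)).
    rewrite /f normrM (ger0_norm (expR_ge0 _)) /u lnM ?posrE ?expR_gt0//.
    congr (`|mlfun lam _| * _); rewrite /warp expRK.
    rewrite -[RHS]lnK ?posrE ?divr_gt0 ?mulr_gt0//; congr expR.
    rewrite ln_div ?posrE ?mulr_gt0// lnM ?posrE// /q.
    by move: (ln _) (ln _) (ln _) (ln _) => *; field; rewrite lt0r_neq0.
  rewrite -mulrA mulrC (mulrC (expR (- _))) mulrA; apply: ler_wpM2r => //.
  exact: CP.
have mp : measurable (posR : set (measurableTypeR R)) by exact: measurable_itv.
apply/integrableP; split.
  by apply/measurable_EFinP; apply: measurable_funTS.
apply: le_lt_trans (ltry (M * A + C * Rintegral mu I01 N)).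
apply: (ge0_integral_exhaust (f := f)) => //.
exact: measurable_funTS.
Qed.

End Transfer.

(** * Extended beta integrals and the summability bound *)
Section ExtendedBeta.
Context {R : realType}.
Implicit Types (t lambda p : R) (x y gamma sigma z : R[i]).
Local Notation I01 := (`]0%R : R, 1%R[%classic).
Local Notation normc := (@ComplexField.Normc.normc R).

Definition beta_kernel x y p lambda (t : R) : R[i] :=
  cpow t%:C (x - 1) * cpow (1 - t)%:C (y - 1)
    * mittag_leffler lambda (- (p / (t * (1 - t)))%:C).

Lemma normc_beta_kernel x y p lambda t : 0 < lambda -> 0 < t < 1 ->
  normc (beta_kernel x y p lambda t) =
  expR (complex.Re (x - 1) * ln t + complex.Re (y - 1) * ln (1 - t)) *
    `|mlfun lambda (p / (t * (1 - t)))|.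
Proof.
move=> l0 /andP[t0 t1]; rewrite /beta_kernel mittag_lefflerE// normcM normc_real.
have s0 : 0 < 1 - t by rewrite subr_gt0.
congr (_ * _); rewrite /cpow !clog_gt0// -cexpD normc_cexp; congr expR.
by case: x => x1 x2; case: y => y1 y2 /=; ring.
Qed.

(** The Mittag-Leffler factor is too large near the end points for absolute
    convergence, whatever x and y are, and the integral of a function that is not
    integrable is 0. *)
Lemma ext_beta_eq0 x y p lambda : 2 < lambda -> 0 < p -> ext_beta x y p lambda = 0.
Proof.
move=> l2 p0; rewrite /ext_beta /cintegral asboolF// -/(beta_kernel x y p lambda).
have l0 : 0 < lambda by lra.
have [e0 e1 s0 s1] := cos_sin_pi_div l2.
have c0 : 0 < 1 - sin (pi / lambda) by rewrite subr_gt0.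
have mI : measurable (I01 : set (measurableTypeR R)) by exact: measurable_itv.
move=> [gr gi]; apply: (mlfun_not_integrable l2).
apply: (laplace_integrable (p := p) (X := complex.Re (x - 1)) (Y := complex.Re (y - 1))
  l0 e0 c0 p0 (integrable_EFinD mI (integrable_norm gr) (integrable_norm gi))).
by move=> t t01; rewrite -normc_beta_kernel//; exact: normc_le.
Qed.

Lemma ext_beta_bounded x y p lambda :
  exists2 M, 0 <= M & forall k : nat, normc (ext_beta (x + k%:R) y p lambda) <= M.
Proof.
apply: cintegral_shrink_bounded => k t /andP[t0 _].
have -> : x + k.+1%:R - 1 = x + k%:R - 1 + 1 by rewrite -natr1; ring.
by rewrite cpowS// !mulrA.
Qed.

(** The Mittag-Leffler factor is bounded by 1 if lambda <= 2 and constant if p = 0;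
    otherwise all the integrals are 0. *)
Lemma ext_beta_decay x y p lambda : 0 <= p -> 0 < lambda -> 1 < complex.Re y ->
  exists2 C, 0 <= C & forall k : nat, normc (ext_beta (x + k%:R) y p lambda) <=
    C * expR (- ((complex.Re y - 1) * ln k.+1%:R)).
Proof.
move=> p0 l0 y1; have [l2|l2] := leP lambda 2.
  apply: (@beta_terms_decay R x y (fun t => mittag_leffler lambda (- (p / (t * (1 - t)))%:C)) 1 y1).
  move=> t /andP[t0 t1].
  rewrite mittag_lefflerE// normc_real mlfun_le1// divr_ge0// mulr_ge0 ?(ltW t0)//.
  by rewrite subr_ge0 ltW.
have [p_gt0|p_le0] := ltP 0 p.
  by exists 0 => // k; rewrite ext_beta_eq0// normc0 mul0r.
have -> : p = 0 by apply/le_anti/andP.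
apply: (@beta_terms_decay R x y
  (fun t => mittag_leffler lambda (- (0 / (t * (1 - t)))%:C)) `|mlfun lambda 0| y1).
move=> t _; by rewrite mul0r mittag_lefflerE// normc_real.
Qed.

(** For |z| < 1 the geometric factor wins against any power. For |z| = 1 the decay
    of the beta integrals is used if Re y > 1, and their boundedness otherwise. *)
Lemma hurwitz_lerch_summable gamma sigma z x y (B : R[i]) p lambda :
  0 <= p -> 0 < lambda ->
  normc z < 1 \/
    (normc z = 1 /\ complex.Re gamma < complex.Re y - 1 + complex.Re sigma) ->
  exists K, forall N : nat, \sum_(0 <= k < N)
    normc (pochhammer gamma k * (ext_beta (x + k%:R) y p lambda / B) / k`!%:R
      * z ^+ k) * expR (- (complex.Re sigma * ln k.+1%:R)) <= K.
Proof.
move=> p0 l0; have [M M0 bM] := ext_beta_bounded x y p lambda.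
case=> [z1|[z1 sy]].
  pose q := `|complex.Re gamma| + `|complex.Re sigma| + 1.
  have q0 : 0 < q by rewrite ltr_wpDl ?addr_ge0.
  have [C C0 CP] := geometric_decay M0 z1 bM q0.
  apply: (terms_summable B C0 CP).
  have := ler_norm (complex.Re gamma); have := ler_norm (- complex.Re sigma).
  by rewrite normrN /q; lra.
have bz k C : normc (ext_beta (x + k%:R) y p lambda) <= C ->
    normc (ext_beta (x + k%:R) y p lambda * z ^+ k) <= C.
  by rewrite normcM normcX z1 expr1n mulr1.
have [y1|y1] := ltP 1 (complex.Re y).
  have [C C0 CP] := ext_beta_decay x p0 l0 y1.
  by apply: (terms_summable B C0 (q := complex.Re y - 1)) => // k; exact: bz.
apply: (terms_summable B M0 (q := 0)); last lra.
by move=> k; rewrite mul0r oppr0 expR0 mulr1; exact: bz.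
Qed.

End ExtendedBeta.

Theorem theorem3p1 (R : realType) (p lambda : R)
    (gamma theta upsilon a sigma z : R[i])
    (p_ge0 : 0 <= p) (lambda_gt0 : 0 < lambda)
    (a_notin : forall k : nat, a != - k%:R)
    (z_sigma : `|z| < 1 \/
      (`|z| = 1 /\ 1 < complex.Re (sigma + upsilon - gamma - theta)))
    (Re_sigma_gt0 : 0 < complex.Re sigma) (Re_a_gt0 : 0 < complex.Re a) :
  let integrand := fun t : R =>
    cpow t%:C (sigma - 1) * cexp (- (a * t%:C))
      * ext_hypergeometric p lambda gamma theta upsilon (z * cexp (- t%:C)) in
  cintegrable `]0, +oo[ integrand /\
  ext_hurwitz_lerch gamma theta upsilon z sigma a p lambda
    = (cGamma sigma)^-1 * cintegral `]0, +oo[ integrand.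
Proof.
pose B := cBeta theta (upsilon - theta).
pose c k := pochhammer gamma k *
  (ext_beta (theta + k%:R) (upsilon - theta) p lambda / B) / k`!%:R.
have zP : ComplexField.Normc.normc z < 1 \/ (ComplexField.Normc.normc z = 1 /\
    complex.Re gamma < complex.Re (upsilon - theta) - 1 + complex.Re sigma).
  case: z_sigma => [|[/eqP + h]]; rewrite normr_normc.
    by rewrite -[1]/(1%:C) ltcR; left.
  rewrite -[1]/(1%:C) (inj_eq (@complexI R)) => /eqP z1; right; split=> //.
  by move: h; case: gamma theta upsilon sigma {c B a_notin Re_sigma_gt0}
    => [? ?] [? ?] [? ?] [? ?] /=; lra.
have [K KP] := hurwitz_lerch_summable theta B p_ge0 lambda_gt0 zP.
have [F1 F2] := hurwitz_swap Re_sigma_gt0 Re_a_gt0 KP.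
have hE w : ext_hypergeometric p lambda gamma theta upsilon w =
    csum (fun k => c k * w ^+ k).
  by congr csum; apply/funext => k; rewrite /c -/B; ring.
move=> integrand.
have -> : integrand = fun t => cpow t%:C (sigma - 1) * cexp (- (a * t%:C)) *
    csum (fun k => c k * (z * cexp (- t%:C)) ^+ k).
  by apply/funext => t; rewrite /integrand hE.
split; first exact: F1.
rewrite -F2; congr csum; apply/funext => k.
by rewrite -/B invfM /c; ring.
Qed.
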